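(* Let $(t_1,j_1),\dots,(t_n,j_n)$ be pairwise distinct pairs with $t_a\in\mathbb Z$, $u_0<t_a<u_N$, and $j_a\in\mathbb Z+\frac12$. In the setting described in the context, $$ \mathrm{Prob}\big(j_a\in L(t_a)\ \text{for all } a=1,\dots,n\big)=\det\big[K((t_a,j_a),(t_b,j_b))\big]_{a,b=1}^n, $$ where $$ K((t_1,j_1),(t_2,j_2))=\frac{1}{(2\pi i)^2}\oint_{|z|=\rho_1}\oint_{|w|=\rho_2}\frac{\Phi_-(z,t_1)\,\Phi_+(w,t_2)}{\Phi_+(z,t_1)\,\Phi_-(w,t_2)}\,\frac{z^{-j_1-\frac12}\,w^{j_2-\frac12}}{z-w}\,dz\,dw . $$ Both circles are positively oriented, with radii chosen as follows: - $\rho_1<R(t_1)$ and $\rho_2>R^*(t_2)$; - $\rho_2<\rho_1$ if $t_1\ge t_2$, and $\rho_1<\rho_2$ if $t_1<t_2$. Such radii always exist, and the integral does not depend on the choice.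
   Context: Fix an integer $N\ge1$ and integers $u_0<v_1<u_1<\dots<u_{N-1}<v_N<u_N$. For each integer $t$ with $u_0<t<u_N$ fix $q_t\in(0,1)$. For a half-integer $m\in(\mathbb Z+\frac12)\cap(u_0,u_N)$ write $m\in D^+$ if $v_i<m<u_i$ for some $i$, and $m\in D^-$ if $u_{i-1}<m<v_i$ for some $i$. For partitions, $\lambda\succ\mu$ (equivalently $\mu\prec\lambda$) means $\lambda_1\ge\mu_1\ge\lambda_2\ge\cdots$. A configuration is a sequence of partitions $(\lambda(t))_{t\in\mathbb Z}$ such that: - $\lambda(t)=\emptyset$ for $t\le u_0$ and $t\ge u_N$; - for each half-integer $m\in(u_0,u_N)$: if $m\in D^-$ then $\lambda(m-\frac12)\prec\lambda(m+\frac12)$, and if $m\in D^+$ then $\lambda(m-\frac12)\succ\lambda(m+\frac12)$. A configuration has probability proportional to $\prod_{u_0<t<u_N}q_t^{|\lambda(t)|}$. For each $t$ let $L(t)=\{\lambda(t)_k-k+\frac12: k\ge1\}\subset\mathbb Z+\frac12$. Put $x^+_m=\prod_{t\in\mathbb Z,\,u_0<t<m}q_t$ and $x^-_m=(x^+_m)^{-1}$ for half-integers $m$. Define $$ \Phi_+(z,t)=\prod_{m\in D^+,\,m>t}(1-zx^+_m),\qquad \Phi_-(z,t)=\prod_{m\in D^-,\,m<t}(1-x^-_m/z), $$ $$ R(t)=\min_{m\in D^+,\,m>t}1/x^+_m\ (=+\infty\text{ if empty}),\qquad R^*(t)=\max_{m\in D^-,\,m<t}x^-_m\ (=0\text{ if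 empty}). $$ *)

(* Defs.v *)
From HB Require Import structures.
From mathcomp Require Import all_boot all_order all_algebra.
From mathcomp Require Import complex.
From mathcomp Require Import all_classical all_reals all_analysis.
Set Implicit Arguments.
Unset Strict Implicit.
Unset Printing Implicit Defensive.
Import Order.TTheory GRing.Theory Num.Theory.
Local Open Scope ring_scope.
Local Open Scope classical_set_scope.
Local Open Scope complex_scope.

(* Conventions.
   - The data u_0 < v_1 < u_1 < ... < v_N < u_N are given by u v : nat -> int
     (only u 0..u N and v 1..v N matter).
   - A half-integer m in Z + 1/2 is encoded by the integer k with m = k + 1/2.
   - A half-integer j in Z + 1/2 (a point of L(t)) is encoded by J with j = J + 1/2.
   - A partition is a weakly decreasing list of positive naturals;
     lambda_k (k >= 1) is  nth 0 lambda (k-1). *)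

Definition irange (a b : int) : seq int :=
  if a <= b then [seq a + (i%:Z) | i <- iota 0 `|b - a|%N] else [::].

Section Setting.
Variables (R : realType) (N : nat) (u v : nat -> int) (q : int -> R).

(* m = k + 1/2 belongs to D^+ : v_i < m < u_i for some i in 1..N *)
Definition inDplus (k : int) : bool :=
  [exists i : 'I_N, (v i.+1 <= k) && (k < u i.+1)].
(* m = k + 1/2 belongs to D^- : u_{i-1} < m < v_i for some i in 1..N *)
Definition inDminus (k : int) : bool :=
  [exists i : 'I_N, (u i <= k) && (k < v i.+1)].

(* x^+_m = prod_{u_0 < t < m} q_t, for m = k + 1/2 (t ranges over u_0+1..k) *)
Definition xplus (k : int) : R := \prod_(t <- irange (u 0 + 1) (k + 1)) q t.
Definition xminus (k : int) : R := (xplus k)^-1.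

(* Phi_+(z,t) = prod_{m in D^+, m > t} (1 - z x^+_m);  m = k+1/2 > t  <=>  t <= k *)
Definition Phi_plus (z : R[i]) (t : int) : R[i] :=
  \prod_(k <- irange (u 0) (u N) | inDplus k && (t <= k)) (1 - z * (xplus k)%:C).
(* Phi_-(z,t) = prod_{m in D^-, m < t} (1 - x^-_m / z);  m = k+1/2 < t  <=>  k < t *)
Definition Phi_minus (z : R[i]) (t : int) : R[i] :=
  \prod_(k <- irange (u 0) (u N) | inDminus k && (k < t)) (1 - (xminus k)%:C / z).

Definition Rrad (t : int) : \bar R :=
  \big[Order.min/+oo%E]_(k <- irange (u 0) (u N) | inDplus k && (t <= k))
     ((xplus k)^-1)%:E.
Definition Rstar (t : int) : R :=
  \big[Num.max/0]_(k <- irange (u 0) (u N) | inDminus k && (k < t)) xminus k.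

Definition is_partition (l : seq nat) : bool :=
  sorted (fun a b => b <= a)%N l && all (fun a => 0 < a)%N l.

Definition succ_interlace (lam mu : seq nat) : Prop :=
  forall k : nat, (nth 0 mu k <= nth 0 lam k)%N /\ (nth 0 lam k.+1 <= nth 0 mu k)%N.

Definition configuration (lam : int -> seq nat) : Prop :=
  (forall t : int, (t <= u 0) || (u N <= t) -> lam t = [::]) /\
  (forall t : int, is_partition (lam t)) /\
  (forall k : int, u 0 <= k < u N ->
     (inDminus k -> succ_interlace (lam (k + 1)) (lam k)) /\
     (inDplus k -> succ_interlace (lam k) (lam (k + 1)))).

Definition weight (lam : int -> seq nat) : R :=
  \prod_(t <- irange (u 0 + 1) (u N)) q t ^+ sumn (lam t).

Definition Prob (E : set (int -> seq nat)) : R :=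
  fine (\esum_(lam in [set l | configuration l] `&` E) (weight lam)%:E) /
  fine (\esum_(lam in [set l | configuration l]) (weight lam)%:E).

(* j = J + 1/2 belongs to L(t) = { lambda(t)_k - k + 1/2 : k >= 1 } *)
Definition inL (lam : int -> seq nat) (t J : int) : Prop :=
  exists k : nat, (nth 0 (lam t) k)%:Z - (k.+1)%:Z = J.

Definition cexpi (theta : R) : R[i] := cos theta +i* sin theta.

Definition integral02pi (g : R -> R[i]) : R[i] :=
  (Rintegral lebesgue_measure `[0, 2 * pi] (fun th => complex.Re (g th)))%:C +
  'i * (Rintegral lebesgue_measure `[0, 2 * pi] (fun th => complex.Im (g th)))%:C.

(* contour integral  \oint_{|z| = rho} f(z) dz  over the positively oriented
   circle, parametrized by z = rho e^{i theta}, dz = i rho e^{i theta} d theta *)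
Definition circle_integral (rho : R) (f : R[i] -> R[i]) : R[i] :=
  integral02pi (fun th => f (rho%:C * cexpi th) * ('i * rho%:C * cexpi th)).

(* K((t1,j1),(t2,j2)) with j1 = J1 + 1/2, j2 = J2 + 1/2, so that
   z^{-j1-1/2} = z^{-J1-1} and w^{j2-1/2} = w^{J2}. *)
Definition corr_kernel (rho1 rho2 : R) (t1 J1 t2 J2 : int) : R[i] :=
  ((2 * pi)%:C * 'i)^-2 *
  circle_integral rho1 (fun z =>
    circle_integral rho2 (fun w =>
      (Phi_minus z t1 * Phi_plus w t2) / (Phi_plus z t1 * Phi_minus w t2) *
      ((z ^ (- J1 - 1) * w ^ J2) / (z - w)))).

Definition admissible_radii (t1 t2 : int) (rho1 rho2 : R) : Prop :=
  0 < rho1 /\ (rho1%:E < Rrad t1)%E /\ Rstar t2 < rho2 /\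
  (if t2 <= t1 then rho2 < rho1 else rho1 < rho2).

End Setting.

(* Main.v *)
(* Encode a configuration by M non-colliding particles at the positions
   lambda_k + (M - 1 - k).  Given the later partition, the earlier one ranges over
   independent intervals, so one interlacing step acts on a determinant by partial
   sums (up to differences of consecutive lines), and the weighted sum over all
   configurations is a determinant whose M columns evolve separately by partial sums.
   Forbidding a set A of space-time points subtracts from each of these trajectories
   multiples of the trajectories seeded at the points of A.  As a function of its
   second point, K, suitably rescaled, obeys the same evolution with a unit source at its first point
   and vanishes at the final time on the M occupied positions; by det(1 - XY) =
   det(1 - YX) the probability of avoiding A is therefore det(1 - 1_A K), and
   inclusion-exclusion gives det K.

   No residue calculus is needed for K.  The identity z - (z - w) = w makes
   K(J1 - 1, J2) - K(J1, J2 + 1) a product of two Laurent coefficients, and the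
   double integral decays geometrically along the diagonals, in a direction given by
   the order of the radii; this forces the independence of the radii, the vanishing of
   K at the boundary and the delta jump of K when the circles cross. *)
Require Import Defs.
From HB Require Import structures.
From mathcomp Require Import all_boot all_order all_algebra.
From mathcomp Require Import complex perm.
From mathcomp Require Import all_classical all_reals all_analysis.
From mathcomp Require Import ring lra zify.
Set Implicit Arguments.
Unset Strict Implicit.
Import Order.TTheory GRing.Theory Num.Theory.
Import numFieldNormedType.Exports ComplexField.Normc.
Local Open Scope ring_scope.
Local Open Scope classical_set_scope.
Local Open Scope complex_scope.

(** * Averages over circles *)

(** A correlation kernel is usually found by inverting the M by M matrix of weighted sums
    (Eynard-Mehta). Here no inverse is computed: the values of K at the initial time form a matrix
    X, and the vanishing of K at the final time says exactly that X solves the linear system that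
    the inverse would solve. What remains to be known of K is local in time: one recursion per step,
    two boundary values and the jump.

    The evolution sums with coefficient 1, while the recursion of K has coefficient x^+ or x^-. A
    power of x^+ absorbs it; on the matrix of K this is a conjugation by a diagonal matrix, which
    the determinant does not see.

    M must exceed more than the number of rows: K also has to vanish just below the lowest position,
    or sums from below would acquire a boundary term. This is why the number of time steps enters M
    twice.

    Sums over configurations have nonnegative terms, determinants are signed; each sum of
    determinants is therefore split into its even and its odd permutations, both with finite
    sums. *)

Section CircleAverage.
Variable R : realType.
Implicit Types (f g : R -> R[i]) (h : R -> R).

Lemma ReD (x y : R[i]) : complex.Re (x + y) = complex.Re x + complex.Re y.
Proof. by case: x; case: y. Qed.
Lemma ImD (x y : R[i]) : complex.Im (x + y) = complex.Im x + complex.Im y.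
Proof. by case: x; case: y. Qed.
Lemma ReM (x y : R[i]) : complex.Re (x * y) =
  complex.Re x * complex.Re y - complex.Im x * complex.Im y.
Proof. by case: x; case: y. Qed.
Lemma ImM (x y : R[i]) : complex.Im (x * y) =
  complex.Re x * complex.Im y + complex.Im x * complex.Re y.
Proof. by case: x => a b; case: y => c d /=. Qed.

Definition ccont g :=
  continuous (fun x => complex.Re (g x)) /\ continuous (fun x => complex.Im (g x)).

Lemma ccont_ext f g : f =1 g -> ccont f -> ccont g.
Proof. by move=> /funext ->. Qed.

Lemma ccont_cst (c : R[i]) : ccont (fun _ => c).
Proof. by split=> x; apply: cvg_cst. Qed.

Lemma ccontD f g : ccont f -> ccont g -> ccont (fun x => f x + g x).
Proof.
move=> [f1 f2] [g1 g2]; split=> x.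
  under eq_fun do rewrite ReD.
  by apply: cvgD; [exact: f1|exact: g1].
under eq_fun do rewrite ImD.
by apply: cvgD; [exact: f2|exact: g2].
Qed.

Lemma ccontM f g : ccont f -> ccont g -> ccont (fun x => f x * g x).
Proof.
move=> [f1 f2] [g1 g2]; split=> x.
  under eq_fun do rewrite ReM.
  by apply: cvgB; apply: cvgM; [exact: f1|exact: g1|exact: f2|exact: g2].
under eq_fun do rewrite ImM.
by apply: cvgD; apply: cvgM; [exact: f1|exact: g2|exact: f2|exact: g1].
Qed.

Lemma ccontV f : ccont f -> (forall x, f x != 0) -> ccont (fun x => (f x)^-1).
Proof.
move=> [f1 f2] f0.
pose n2 x := complex.Re (f x) ^+ 2 + complex.Im (f x) ^+ 2.
have n20 x : n2 x != 0.
  rewrite /n2; case: (f x) (f0 x) => a b /=; apply: contra_neq => /eqP.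
  by rewrite paddr_eq0 ?sqr_ge0// !sqrf_eq0 => /andP[/eqP-> /eqP->].
have n2c : continuous n2.
  move=> x; apply: cvgD; rewrite /GRing.exp /=;
  by apply: cvgM; (exact: f1 || exact: f2).
split=> x.
  have -> : (fun x => complex.Re (f x)^-1) = (fun x => complex.Re (f x) / n2 x).
    by apply/funext => y; rewrite /n2; case: (f y).
  by apply: cvgM; [exact: f1|apply: cvgV => //; exact: n2c].
have -> : (fun x => complex.Im (f x)^-1) = (fun x => - (complex.Im (f x) / n2 x)).
  by apply/funext => y; rewrite /n2; case: (f y).
by apply: cvgN; apply: cvgM; [exact: f2|apply: cvgV => //; exact: n2c].
Qed.

Lemma ccontX f n : ccont f -> ccont (fun x => f x ^+ n).
Proof.
move=> fc; elim: n => [|n IH]; first by under eq_fun do rewrite expr0; exact: ccont_cst.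
by under eq_fun do rewrite exprS; exact: ccontM.
Qed.

Lemma ccontXz f (k : int) : ccont f -> (forall x, f x != 0) -> ccont (fun x => f x ^ k).
Proof.
move=> fc f0; case: k => n; first exact: ccontX.
by apply: ccontV; [exact: ccontX|move=> x; rewrite expf_neq0].
Qed.

Lemma ccont_cexpi : ccont (@cexpi R).
Proof. by split=> x /=; [exact: continuous_cos|exact: continuous_sin]. Qed.

Definition int02pi h : R := Rintegral lebesgue_measure `[0, 2 * pi] h.

Lemma twopi_gt0 : 0 < 2 * pi :> R.
Proof. by rewrite mulr_gt0 ?pi_gt0. Qed.

Lemma int02pi_integrable h : continuous h ->
  lebesgue_measure.-integrable `[0, 2 * pi] (EFin \o h).
Proof.
move=> hc; apply: continuous_compact_integrable; first exact: segment_compact.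
by apply: continuous_subspaceT.
Qed.

Lemma int02piD h1 h2 : continuous h1 -> continuous h2 ->
  int02pi (fun x => h1 x + h2 x) = int02pi h1 + int02pi h2.
Proof. by move=> h1c h2c; apply: RintegralD => //; exact: int02pi_integrable. Qed.

Lemma int02piZ c h : continuous h -> int02pi (fun x => c * h x) = c * int02pi h.
Proof. by move=> hc; apply: RintegralZl => //; exact: int02pi_integrable. Qed.

Lemma int02pi_cst c : int02pi (fun _ => c) = c * (2 * pi).
Proof.
rewrite /int02pi Rintegral_cst//= lebesgue_measure_itv/= lte_fin twopi_gt0/=.
by rewrite subr0.
Qed.

Lemma int02pi_bound h (B : R) : continuous h -> (forall x, 0 <= x <= 2 * pi -> `|h x| <= B) ->
  `|int02pi h| <= B * (2 * pi).
Proof.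
move=> hc hB; rewrite -int02pi_cst.
have hi := int02pi_integrable hc.
have le1 : `|int02pi h| <= int02pi (fun x => `|h x|) by apply: le_normr_Rintegral.
apply: (le_trans le1).
apply: le_Rintegral => //.
- by apply: (@int02pi_integrable (fun x => `|h x|)) => x; apply: cvg_norm; exact: hc.
- by apply: (@int02pi_integrable (fun=> B)) => x; exact: cvg_cst.
Qed.

Definition avg g : R[i] := ((2 * pi)^-1)%:C * integral02pi g.

Lemma integral02piE g : integral02pi g =
  int02pi (fun x => complex.Re (g x)) +i* int02pi (fun x => complex.Im (g x)).
Proof.
rewrite /integral02pi -/(int02pi _) -/(int02pi _).
by rewrite [RHS]complexE.
Qed.

Lemma integral02piD f g : ccont f -> ccont g ->
  integral02pi (fun x => f x + g x) = integral02pi f + integral02pi g.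
Proof.
move=> [f1 f2] [g1 g2]; rewrite !integral02piE; apply/eqP; rewrite eq_complex /=.
by under eq_fun do rewrite ReD; under [in X in _ && X]eq_fun do rewrite ImD;
  rewrite !int02piD// !eqxx.
Qed.

Lemma integral02piZ c f : ccont f ->
  integral02pi (fun x => c * f x) = c * integral02pi f.
Proof.
move=> [f1 f2]; rewrite !integral02piE; apply/eqP; rewrite eq_complex.
rewrite /= -!/(complex.Re _); case: c => a b /=.
under eq_fun do rewrite ReM; under [in X in _ && X]eq_fun do rewrite ImM.
have c1 a' : continuous (fun x => a' * complex.Re (f x)).
  by move=> x; apply: cvgM; [exact: cvg_cst|exact: f1].
have c2 a' : continuous (fun x => a' * complex.Im (f x)).
  by move=> x; apply: cvgM; [exact: cvg_cst|exact: f2].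
under eq_fun do rewrite /= -mulNr.
by rewrite !int02piD// !int02piZ// mulNr !eqxx.
Qed.

Lemma avgD f g : ccont f -> ccont g -> avg (fun x => f x + g x) = avg f + avg g.
Proof. by move=> fc gc; rewrite /avg integral02piD// mulrDr. Qed.

Lemma avgZ c f : ccont f -> avg (fun x => c * f x) = c * avg f.
Proof. by move=> fc; rewrite /avg integral02piZ// mulrCA. Qed.

Lemma normc_ReIm (z : R[i]) : normc z <= `|complex.Re z| + `|complex.Im z|.
Proof.
case: z => a b /=; rewrite -[leRHS]ger0_norm ?addr_ge0// -sqrtr_sqr ler_wsqrtr//.
by rewrite sqrrD !real_normK ?num_real// lerD2r lerDl mulrn_wge0// mulr_ge0.
Qed.

Lemma Re_normc (z : R[i]) : `|complex.Re z| <= normc z.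
Proof. by case: z => a b /=; rewrite -sqrtr_sqr ler_wsqrtr// lerDl sqr_ge0. Qed.

Lemma Im_normc (z : R[i]) : `|complex.Im z| <= normc z.
Proof. by case: z => a b /=; rewrite -sqrtr_sqr ler_wsqrtr// lerDr sqr_ge0. Qed.

(** The factor 2 comes from estimating real and imaginary part separately; only geometric rates
    matter later, so constants are not optimized. *)
Lemma avg_bound f (B : R) : ccont f -> (forall x, 0 <= x <= 2 * pi -> normc (f x) <= B) ->
  normc (avg f) <= 2 * B.
Proof.
move=> [f1 f2] fB; rewrite /avg normcM integral02piE.
have p0 := twopi_gt0.
have -> : normc ((2 * pi)^-1)%:C = (2 * pi)^-1 :> R.
  by rewrite /= expr0n addr0 sqrtr_sqr ger0_norm// invr_ge0 ltW.
rewrite ler_pdivrMl//; apply: le_trans (normc_ReIm _) _ => /=.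
have -> : 2 * pi * (2 * B) = B * (2 * pi) + B * (2 * pi) :> R by ring.
apply: lerD; apply: int02pi_bound => // x xi; apply: le_trans (fB _ xi).
  exact: Re_normc.
exact: Im_normc.
Qed.

Lemma cexpiD a b : cexpi (a + b) = cexpi a * cexpi b :> R[i].
Proof. by apply/eqP; rewrite eq_complex /= cosD sinD [X in _ && (_ == X)]addrC !eqxx. Qed.

Lemma cexpi0 : cexpi 0 = 1 :> R[i].
Proof. by rewrite /cexpi cos0 sin0. Qed.

Lemma cexpi_neq0 a : cexpi a != 0 :> R[i].
Proof.
apply/eqP => a0; have := cexpiD a (- a); rewrite a0 subrr cexpi0 mul0r.
by apply/eqP; rewrite oner_eq0.
Qed.

Lemma cexpiXn a n : cexpi a ^+ n = cexpi (n%:R * a) :> R[i].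
Proof.
elim: n => [|n IH]; first by rewrite mul0r cexpi0.
by rewrite exprS IH -cexpiD -[in RHS]natr1 mulrDl mul1r addrC.
Qed.

Lemma cexpiN a : cexpi (- a) = (cexpi a)^-1 :> R[i].
Proof.
by apply: (mulfI (cexpi_neq0 a)); rewrite mulfV ?cexpi_neq0// -cexpiD subrr cexpi0.
Qed.

Lemma cexpiXz a (k : int) : cexpi a ^ k = cexpi (k%:~R * a) :> R[i].
Proof.
case: k => n; first by rewrite -exprnP cexpiXn.
by rewrite NegzE -exprnN cexpiXn mulrNz mulNr cexpiN.
Qed.

Lemma cexpi2pi : cexpi (2 * pi) = 1 :> R[i].
Proof. by rewrite /cexpi mulr_natl cos2pi sin2pi. Qed.

Lemma normc_cexpi a : normc (cexpi a) = 1 :> R.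
Proof. by rewrite /= cos2Dsin2 sqrtr1. Qed.

Lemma int02pi_deriv (F h : R -> R) : continuous h ->
  (forall x : R, is_derive (x : R^o) (1 : R^o) (F : R^o -> R^o) (h x)) ->
  int02pi h = F (2 * pi) - F 0.
Proof.
move=> hc Fh; rewrite /int02pi /Rintegral.
have Fc : continuous F.
  by move=> x; apply/differentiable_continuous/derivable1_diffP; have [] := Fh x.
rewrite (@continuous_FTC2 _ h F)//; first exact: twopi_gt0.
- exact: continuous_subspaceT.
- split; first by move=> x _; have [] := Fh x.
    by apply: cvg_at_right_filter; exact: Fc.
  by apply: cvg_at_left_filter; exact: Fc.
- by move=> x _; rewrite derive1E; apply: derive_val.
Qed.

(** Orthogonality of characters: for [k != 0] the antiderivatives of both coordinates take the same
    value at [0] and [2 * pi]. *)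
Lemma avg_cexpi (k : int) : avg (fun x => cexpi x ^ k) = (k == 0)%:R.
Proof.
have [->|k0] := eqVneq k 0.
  under eq_fun do rewrite expr0z.
  rewrite /avg integral02piE /= !int02pi_cst mul0r mul1r.
  apply/eqP; rewrite eq_complex /= !mulr0 !mul0r subr0 addr0 mulVf ?eqxx//.
  exact: lt0r_neq0 twopi_gt0.
have k0' : k%:~R != 0 :> R by rewrite intr_eq0.
have := cexpiXz (2 * pi) k; rewrite cexpi2pi exp1rz /cexpi => -[] ck sk.
under eq_fun do rewrite cexpiXz.
rewrite /avg integral02piE /=.
have lin x : is_derive (x : R^o) (1 : R^o) (fun x : R^o => (k%:~R * x : R^o)) (k%:~R).
  have d := is_derive_id (x : R^o) (1 : R^o).
  have := @is_deriveZ _ _ _ id (k%:~R : R) _ _ _ d.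
  by rewrite /GRing.scale /= mulr1.
have linc : continuous (fun x : R => k%:~R * x).
  by move=> x; apply: cvgM; [exact: cvg_cst|exact: cvg_id].
have -> : int02pi (fun x : R => cos (k%:~R * x)) =
    (k%:~R)^-1 * sin (k%:~R * (2 * pi)) - (k%:~R)^-1 * sin (k%:~R * 0).
  apply: (@int02pi_deriv (fun x => (k%:~R)^-1 * sin (k%:~R * x))) => x.
    by apply: continuous_comp; [exact: linc|exact: continuous_cos].
  have d := is_derive_sin (k%:~R * x).
  have d2 := @is_derive1_comp _ _ _ _ _ _ d (lin x).
  have := @is_deriveZ _ _ _ _ ((k%:~R)^-1 : R) _ _ _ d2.
  by rewrite /GRing.scale /= mulrCA mulVf// mulr1.
have -> : int02pi (fun x : R => sin (k%:~R * x)) =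
    - (k%:~R)^-1 * cos (k%:~R * (2 * pi)) - - (k%:~R)^-1 * cos (k%:~R * 0).
  apply: (@int02pi_deriv (fun x => - (k%:~R)^-1 * cos (k%:~R * x))) => x.
    by apply: continuous_comp; [exact: linc|exact: continuous_sin].
  have d := is_derive_cos (k%:~R * x).
  have d2 := @is_derive1_comp _ _ _ _ _ _ d (lin x).
  have := @is_deriveZ _ _ _ _ (- (k%:~R)^-1 : R) _ _ _ d2.
  by rewrite /GRing.scale /= !mulNr mulrN opprK mulrCA mulVf// mulr1.
rewrite -[cos (_ * (2 * pi))]ck -[sin (_ * (2 * pi))]sk !mulr0 cos0 sin0 !mulr0 !subrr.
by apply/eqP; rewrite eq_complex /= !mulr0 !addr0 ?subr0 eqxx.
Qed.

End CircleAverage.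

(** * Double averages against the Cauchy kernel *)

Fact circle_avg_key : unit. Proof. by []. Qed.
Fact cauchy_int_key : unit. Proof. by []. Qed.

Section CircleKernel.
Variable R : realType.
Implicit Types (f g F G : R[i] -> R[i]) (r : R).

Definition circ r x : R[i] := r%:C * cexpi x.
Definition circle_cont r F := ccont (fun x => F (circ r x)).
Definition circle_avg : R -> (R[i] -> R[i]) -> R[i] :=
  locked_with circle_avg_key (fun r F => avg (fun x => F (circ r x))).
Definition circle_bound r F (B : R) := forall x, 0 <= x <= 2 * pi -> normc (F (circ r x)) <= B.

Lemma circle_avgE r F : circle_avg r F = avg (fun x => F (circ r x)).
Proof. by rewrite /circle_avg unlock. Qed.

Lemma normc_real (x : R) : normc x%:C = `|x|.
Proof. by rewrite /= expr0n addr0 sqrtr_sqr. Qed.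

Lemma normc_ge0 (z : R[i]) : 0 <= normc z.
Proof. by case: z => a b; apply: sqrtr_ge0. Qed.

Lemma normc_circ r x : 0 < r -> normc (circ r x) = r.
Proof. by move=> r0; rewrite normcM normc_real normc_cexpi mulr1 gtr0_norm. Qed.

Lemma circ_neq0 r x : 0 < r -> circ r x != 0.
Proof. by move=> r0; apply/eqP => /(congr1 (@normc R)); rewrite normc_circ// normc0; lra. Qed.

Lemma ccont_circ r : ccont (circ r).
Proof. by apply: ccontM; [exact: ccont_cst|exact: ccont_cexpi]. Qed.

Lemma normcXz (z : R[i]) (k : int) : normc (z ^ k) = normc z ^ k.
Proof.
have Xn n : normc (z ^+ n) = normc z ^+ n.
  by elim: n => [|n IH]; [exact: normc1|rewrite !exprS normcM IH].
by case: k => n; [exact: Xn|rewrite /exprz normcV Xn].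
Qed.

Lemma normcB_ge (z w : R[i]) : normc z - normc w <= normc (z - w).
Proof.
rewrite lerBlDr; apply: le_trans (le_normcD _ _).
by rewrite -[X in _ <= normc X]/(z - w + w) subrK.
Qed.

Lemma normcBC (z w : R[i]) : normc (z - w) = normc (w - z).
Proof. by rewrite -opprB normcN. Qed.

Lemma normcB_ge_abs (z w : R[i]) : `|normc z - normc w| <= normc (z - w).
Proof.
by rewrite ler_norml normcB_ge andbT lerNl opprB normcBC normcB_ge.
Qed.

Lemma circle_cont_cst r (c : R[i]) : circle_cont r (fun _ => c).
Proof. exact: ccont_cst. Qed.
Lemma circle_cont_id r : circle_cont r id.
Proof. exact: ccont_circ. Qed.
Lemma circle_contD r F G : circle_cont r F -> circle_cont r G -> circle_cont r (fun z => F z + G z).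
Proof. exact: ccontD. Qed.
Lemma circle_contM r F G : circle_cont r F -> circle_cont r G -> circle_cont r (fun z => F z * G z).
Proof. exact: ccontM. Qed.
Lemma circle_contV r F : circle_cont r F -> (forall x, F (circ r x) != 0) -> circle_cont r (fun z => (F z)^-1).
Proof. exact: ccontV. Qed.
Lemma circle_contXz r (k : int) : 0 < r -> circle_cont r (fun z => z ^ k).
Proof. by move=> r0; apply: ccontXz; [exact: ccont_circ|move=> x; exact: circ_neq0]. Qed.

Lemma eq_circle_cont r F G : (forall x, F (circ r x) = G (circ r x)) -> circle_cont r F -> circle_cont r G.
Proof. by move=> FG; apply: ccont_ext. Qed.

Lemma eq_circle_avg r F G : (forall x, F (circ r x) = G (circ r x)) -> circle_avg r F = circle_avg r G.
Proof. by move=> FG; rewrite !circle_avgE; congr avg; apply/funext. Qed.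

Lemma circle_avgD r F G : circle_cont r F -> circle_cont r G ->
  circle_avg r (fun z => F z + G z) = circle_avg r F + circle_avg r G.
Proof. rewrite !circle_avgE; exact: avgD. Qed.

Lemma circle_avgZ r c F : circle_cont r F -> circle_avg r (fun z => c * F z) = c * circle_avg r F.
Proof. rewrite !circle_avgE; exact: avgZ. Qed.

Lemma circle_avgXz r (k : int) : 0 < r -> circle_avg r (fun z => z ^ k) = (k == 0)%:R.
Proof.
move=> r0.
have r0' : r%:C != 0 :> R[i] by rewrite eq_complex /= negb_and gt_eqF.
have E : (fun x => circ r x ^ k) = (fun x => r%:C ^ k * cexpi x ^ k).
  by apply/funext => x; rewrite exprzMl ?unitfE ?cexpi_neq0.
have cc : ccont (fun x => cexpi x ^ k : R[i]).
  by apply: ccontXz; [exact: ccont_cexpi|exact: cexpi_neq0].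
rewrite circle_avgE E avgZ// avg_cexpi.
by case: eqVneq => [->|_]; rewrite ?expr0z ?mulr1 ?mulr0.
Qed.

Lemma circle_avg_bound r F B : circle_cont r F -> circle_bound r F B -> normc (circle_avg r F) <= 2 * B.
Proof. by move=> Fc FB; rewrite circle_avgE; apply: avg_bound. Qed.

Lemma circle_cont_bounded r F : circle_cont r F -> exists2 B, 0 <= B & circle_bound r F B.
Proof.
move=> [F1 F2].
pose h x := `|complex.Re (F (circ r x))| + `|complex.Im (F (circ r x))|.
have hc : continuous h.
  by move=> x; apply: cvgD; apply: cvg_norm; [exact: F1|exact: F2].
have [//||c _ hmax] := @EVT_max R h 0 (2 * pi); first exact/ltW/twopi_gt0.
  exact: continuous_subspaceT.
exists (h c) => [|x xi]; first by rewrite addr_ge0.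
by apply: le_trans (normc_ReIm _) _; apply: hmax; rewrite in_itv.
Qed.

Lemma circle_boundM r F G B C : 0 <= B -> circle_bound r F B -> circle_bound r G C -> circle_bound r (fun z => F z * G z) (B * C).
Proof.
by move=> B0 FB GC x xi; rewrite normcM ler_pM ?normc_ge0 ?FB ?GC.
Qed.

Lemma circle_boundXz r (k : int) : 0 < r -> circle_bound r (fun z => z ^ k) (r ^ k).
Proof. by move=> r0 x _; rewrite normcXz normc_circ. Qed.

Lemma cvg_dom (h d : R -> R) (x : R) : (forall y, `|h y - h x| <= d y) ->
  d y @[y --> x] --> (0 : R) -> h y @[y --> x] --> h x.
Proof.
move=> hd d0; apply/cvgrPdist_lt => e e0; near=> y.
rewrite distrC; apply: le_lt_trans (hd y) _.
by near: y; apply: (cvgr_lt 0).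
Unshelve. all: by end_near. Qed.

Definition double_avg (r1 r2 : R) (H : R[i] -> R[i] -> R[i]) := circle_avg r1 (fun z => circle_avg r2 (H z)).
(** Just enough for the iterated average to be linear; neither joint continuity nor an exchange of
    the two integrals is involved. *)
Definition double_cont (r1 r2 : R) (H : R[i] -> R[i] -> R[i]) :=
  (forall x, circle_cont r2 (H (circ r1 x))) /\ circle_cont r1 (fun z => circle_avg r2 (H z)).

Lemma double_avgD r1 r2 H H' : double_cont r1 r2 H -> double_cont r1 r2 H' ->
  double_avg r1 r2 (fun z w => H z w + H' z w) = double_avg r1 r2 H + double_avg r1 r2 H'.
Proof.
move=> [H1 H2] [H1' H2']; rewrite /double_avg -circle_avgD//; apply: eq_circle_avg => x.
by rewrite -circle_avgD.
Qed.

Lemma double_avgZ r1 r2 c H : double_cont r1 r2 H ->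
  double_avg r1 r2 (fun z w => c * H z w) = c * double_avg r1 r2 H.
Proof.
by move=> [H1 H2]; rewrite /double_avg -circle_avgZ//; apply: eq_circle_avg => x; rewrite -circle_avgZ.
Qed.

Lemma double_cont_prod r1 r2 F G : circle_cont r1 F -> circle_cont r2 G -> double_cont r1 r2 (fun z w => F z * G w).
Proof.
move=> Fc Gc; split=> [x|]; first by apply: circle_contM => //; exact: circle_cont_cst.
apply: eq_circle_cont (circle_contM Fc (circle_cont_cst r1 (circle_avg r2 G))) => x.
by rewrite -circle_avgZ.
Qed.

Lemma double_avg_prod r1 r2 F G : circle_cont r1 F -> circle_cont r2 G ->
  double_avg r1 r2 (fun z w => F z * G w) = circle_avg r1 F * circle_avg r2 G.
Proof.
move=> Fc Gc; rewrite mulrC -circle_avgZ//; apply: eq_circle_avg => x.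
by rewrite circle_avgZ// mulrC.
Qed.

Lemma circB_neq0 r1 r2 x y : 0 < r1 -> 0 < r2 -> r1 != r2 -> circ r1 x - circ r2 y != 0.
Proof.
move=> r10 r20; apply: contra_neq => /eqP; rewrite subr_eq0 => /eqP e.
by have := normc_circ x r10; rewrite e normc_circ.
Qed.

Lemma circle_cont_cauchy r1 r2 G x : 0 < r1 -> 0 < r2 -> r1 != r2 -> circle_cont r2 G ->
  circle_cont r2 (fun w => G w / (circ r1 x - w)).
Proof.
move=> r10 r20 r12 Gc; apply: circle_contM => //; apply: circle_contV.
  apply: circle_contD; first exact: circle_cont_cst.
  by apply: eq_circle_cont (circle_contM (circle_cont_cst r2 (-1)) (circle_cont_id r2)) => y; rewrite mulN1r.
by move=> y; apply: circB_neq0.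
Qed.

Lemma circle_bound_cauchy r1 r2 G x B : 0 < r1 -> 0 < r2 -> r1 != r2 -> 0 <= B -> circle_bound r2 G B ->
  circle_bound r2 (fun w => G w / (circ r1 x - w)) (B / `|r1 - r2|).
Proof.
move=> r10 r20 r12 B0 GB y yi; rewrite normcM normcV ler_pM ?normc_ge0 ?invr_ge0 ?normc_ge0 ?GB//.
have d0 : 0 < `|r1 - r2| by rewrite normr_gt0 subr_eq0.
have dle := normcB_ge_abs (circ r1 x) (circ r2 y).
rewrite !normc_circ// in dle.
by rewrite lef_pV2// posrE (lt_le_trans d0).
Qed.

(** The inner average is Lipschitz in [z] by the resolvent identity 1/(z' - w) - 1/(z - w) = (z -
    z') / ((z - w)(z' - w)), both factors being bounded because the radii differ. *)
Lemma double_cont_cauchy r1 r2 F G : 0 < r1 -> 0 < r2 -> r1 != r2 -> circle_cont r1 F -> circle_cont r2 G ->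
  double_cont r1 r2 (fun z w => F z * (G w / (z - w))).
Proof.
move=> r10 r20 r12 Fc Gc; have Cc x := circle_cont_cauchy x r10 r20 r12 Gc.
split=> [x|]; first by apply: circle_contM => //; exact: circle_cont_cst.
suff Hc : circle_cont r1 (fun z => circle_avg r2 (fun w => G w / (z - w))).
  by apply: eq_circle_cont (circle_contM Fc Hc) => x; rewrite circle_avgZ.
have [B B0 GB] := circle_cont_bounded Gc.
have d0 : 0 < `|r1 - r2| by rewrite normr_gt0 subr_eq0.
pose D := 2 * (B / `|r1 - r2| * (`|r1 - r2|)^-1).
have D0 : 0 <= D by rewrite /D mulr_ge0// mulr_ge0 ?divr_ge0 ?invr_ge0.
pose H x := circle_avg r2 (fun w => G w / (circ r1 x - w)).
have lip x y : normc (H y - H x) <= normc (circ r1 x - circ r1 y) * D.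
  have -> : H y - H x = (circ r1 x - circ r1 y) *
      circle_avg r2 (fun w => G w / (circ r1 x - w) * (1 / (circ r1 y - w))).
    have c2 := circle_cont_cauchy y r10 r20 r12 (circle_cont_cst r2 1).
    rewrite -circle_avgZ; last exact: circle_contM.
    rewrite /H -mulN1r -circle_avgZ// -circle_avgD//; last by apply: circle_contM => //; exact: circle_cont_cst.
    apply: eq_circle_avg => w; have h1 := circB_neq0 x w r10 r20 r12.
    have h2 := circB_neq0 y w r10 r20 r12; field.
    by rewrite h1 h2.
  rewrite normcM; apply: ler_wpM2l; first exact: normc_ge0.
  apply: circle_avg_bound; first by apply: circle_contM => //; apply: circle_cont_cauchy => //; exact: circle_cont_cst.
  apply: circle_boundM; first by rewrite divr_ge0.
    exact: circle_bound_cauchy.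
  have -> : (`|r1 - r2|)^-1 = 1 / `|r1 - r2| by rewrite div1r.
  by apply: circle_bound_cauchy => // z _; rewrite normc1.
have [cc1 cc2] := ccont_circ r1.
pose d x y := (`|complex.Re (circ r1 x) - complex.Re (circ r1 y)| +
               `|complex.Im (circ r1 x) - complex.Im (circ r1 y)|) * D.
have dcvg (x : R) : d x y @[y --> x] --> (0 : R).
  have c0 (c : R -> R) : continuous c -> `|c x - c y| @[y --> x] --> (0 : R).
    move=> cc; rewrite -(normr0 R) -(subrr (c x)); apply: cvg_norm.
    by apply: cvgB; [exact: cvg_cst|exact: cc].
  by have := cvgM (cvgD (c0 _ cc1) (c0 _ cc2)) (cvg_cst D); rewrite addr0 mul0r; apply.
have ReB (u v : R[i]) : complex.Re (u - v) = complex.Re u - complex.Re v by case: u; case: v.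
have ImB (u v : R[i]) : complex.Im (u - v) = complex.Im u - complex.Im v by case: u; case: v.
have lipd x y : normc (H y - H x) <= d x y.
  apply: le_trans (lip x y) _; apply: ler_wpM2r => //.
  by rewrite -ReB -ImB; exact: normc_ReIm.
by split=> x; apply: (cvg_dom (d := d x)) (dcvg x) => y; apply: le_trans (lipd x y);
  rewrite -?ReB -?ImB; [exact: Re_normc|exact: Im_normc].
Qed.

(** The measure is the normalized angle, not dz dw. Since dz = i z dtheta, contour integrals divided
    by (2 pi i)^2 carry an extra [z * w], which goes into [F] and [G]; see
    [double_circle_integralE]. *)
Definition cauchy_int : R -> R -> (R[i] -> R[i]) -> (R[i] -> R[i]) -> R[i] :=
  locked_with cauchy_int_key (fun r1 r2 F G => double_avg r1 r2 (fun z w => F z * (G w / (z - w)))).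

Lemma cauchy_intE (r1 r2 : R) F G : cauchy_int r1 r2 F G = double_avg r1 r2 (fun z w => F z * (G w / (z - w))).
Proof. by rewrite /cauchy_int unlock. Qed.

Lemma eq_cauchy_int r1 r2 F F' G G' : (forall x, F (circ r1 x) = F' (circ r1 x)) ->
  (forall x, G (circ r2 x) = G' (circ r2 x)) -> cauchy_int r1 r2 F G = cauchy_int r1 r2 F' G'.
Proof. by move=> Phi_z Phi_w; rewrite !cauchy_intE; apply: eq_circle_avg => x; apply: eq_circle_avg => y; rewrite Phi_z Phi_w. Qed.

Section Radii.
Variables (r1 r2 : R).
Hypotheses (r10 : 0 < r1) (r20 : 0 < r2) (r12 : r1 != r2).

Lemma cauchy_intDl F F' G : circle_cont r1 F -> circle_cont r1 F' -> circle_cont r2 G ->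
  cauchy_int r1 r2 (fun z => F z + F' z) G = cauchy_int r1 r2 F G + cauchy_int r1 r2 F' G.
Proof.
move=> Fc Fc' Gc; rewrite !cauchy_intE -double_avgD; try exact: double_cont_cauchy.
by apply: eq_circle_avg => x; apply: eq_circle_avg => y; rewrite mulrDl.
Qed.

Lemma cauchy_intDr F G G' : circle_cont r1 F -> circle_cont r2 G -> circle_cont r2 G' ->
  cauchy_int r1 r2 F (fun z => G z + G' z) = cauchy_int r1 r2 F G + cauchy_int r1 r2 F G'.
Proof.
move=> Fc Gc Gc'; rewrite !cauchy_intE -double_avgD; try exact: double_cont_cauchy.
by apply: eq_circle_avg => x; apply: eq_circle_avg => y; rewrite mulrDl mulrDr.
Qed.

Lemma cauchy_intZl c F G : circle_cont r1 F -> circle_cont r2 G ->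
  cauchy_int r1 r2 (fun z => c * F z) G = c * cauchy_int r1 r2 F G.
Proof.
move=> Fc Gc; rewrite !cauchy_intE -double_avgZ; try exact: double_cont_cauchy.
by apply: eq_circle_avg => x; apply: eq_circle_avg => y; rewrite -mulrA.
Qed.

Lemma cauchy_intZr c F G : circle_cont r1 F -> circle_cont r2 G ->
  cauchy_int r1 r2 F (fun z => c * G z) = c * cauchy_int r1 r2 F G.
Proof.
move=> Fc Gc; rewrite !cauchy_intE -double_avgZ; try exact: double_cont_cauchy.
by apply: eq_circle_avg => x; apply: eq_circle_avg => y; rewrite -!mulrA mulrCA.
Qed.

(* [z - (z - w) = w]: multiplying by [z] or by [w] differs by a decoupled integral *)
Lemma cauchy_int_shift F G : circle_cont r1 F -> circle_cont r2 G ->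
  cauchy_int r1 r2 (fun z => z * F z) G = cauchy_int r1 r2 F (fun w => w * G w) + circle_avg r1 F * circle_avg r2 G.
Proof.
move=> Fc Gc; rewrite !cauchy_intE -double_avg_prod// -double_avgD.
- apply: eq_circle_avg => x; apply: eq_circle_avg => y.
  have h := circB_neq0 x y r10 r20 r12; field.
  by rewrite h.
- by apply: double_cont_cauchy => //; apply: circle_contM => //; exact: circle_cont_id.
- exact: double_cont_prod.
Qed.

Lemma cauchy_int_bound F G A B : 0 <= A -> 0 <= B -> circle_cont r1 F -> circle_cont r2 G ->
  circle_bound r1 F A -> circle_bound r2 G B -> normc (cauchy_int r1 r2 F G) <= 4 * (A * B / `|r1 - r2|).
Proof.
move=> A0 B0 Fc Gc FA GB; rewrite cauchy_intE; have [g1 g2] := double_cont_cauchy r10 r20 r12 Fc Gc.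
have -> : 4 * (A * B / `|r1 - r2|) = 2 * (A * (2 * (B / `|r1 - r2|))) by ring.
apply: circle_avg_bound => // x xi.
rewrite circle_avgZ; last exact: circle_cont_cauchy.
rewrite normcM ler_pM ?normc_ge0 ?FA//.
by apply: circle_avg_bound; [exact: circle_cont_cauchy|exact: circle_bound_cauchy].
Qed.

End Radii.

Lemma circle_integralE r F : circle_cont r F ->
  circle_integral r F = (2 * pi)%:C * 'i * circle_avg r (fun z => F z * z).
Proof.
move=> Fc; have Fzc := circle_contM Fc (circle_cont_id r).
rewrite -circle_avgZ// circle_avgE avgZ//.
rewrite /circle_integral /avg -mulrA.
have -> : (fun th => F (r%:C * cexpi th) * ('i * r%:C * cexpi th)) =
   (fun th => 'i * (F (circ r th) * circ r th)) by apply/funext => x; rewrite /circ; ring.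
rewrite integral02piZ// mulrCA; congr (_ * _).
by rewrite mulrA -rmorphM/= mulfV ?mul1r// lt0r_neq0 ?twopi_gt0.
Qed.

Lemma double_circle_integralE r1 r2 F G : 0 < r1 -> 0 < r2 -> r1 != r2 ->
  circle_cont r1 F -> circle_cont r2 G ->
  ((2 * pi)%:C * 'i)^-2 * circle_integral r1 (fun z => circle_integral r2 (fun w =>
    F z * G w / (z - w))) = cauchy_int r1 r2 (fun z => F z * z) (fun w => G w * w).
Proof.
move=> r10 r20 r12 Fc Gc.
have Fzc := circle_contM Fc (circle_cont_id r1); have Gzc := circle_contM Gc (circle_cont_id r2).
have p0 : (2 * pi)%:C * 'i != 0 :> R[i].
  apply: mulf_neq0; first by rewrite eq_complex /= negb_and lt0r_neq0 ?twopi_gt0.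
  by rewrite eq_complex /= oner_eq0 andbF.
have inner x : circle_integral r2 (fun w => F (circ r1 x) * G w / (circ r1 x - w)) =
   (2 * pi)%:C * 'i * circle_avg r2 (fun w => F (circ r1 x) * (G w * w / (circ r1 x - w))).
  rewrite circle_integralE.
    by congr (_ * _); apply: eq_circle_avg => y; ring.
  apply: eq_circle_cont (circle_contM (circle_cont_cst r2 (F (circ r1 x))) (circle_cont_cauchy x r10 r20 r12 Gc)) => y.
  by rewrite mulrA.
have [g1 g2] := double_cont_cauchy r10 r20 r12 Fc Gzc.
have [h1 h2] := double_cont_cauchy r10 r20 r12 Fzc Gzc.
set P := (2 * pi)%:C * 'i in p0 inner *.
rewrite circle_integralE; last first.
  by apply: eq_circle_cont (circle_contM (circle_cont_cst r1 P) g2) => x; rewrite inner.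
have -> : circle_avg r1 (fun z => circle_integral r2 (fun w => F z * G w / (z - w)) * z) =
    P * cauchy_int r1 r2 (fun z => F z * z) (fun w => G w * w).
  rewrite cauchy_intE /double_avg -circle_avgZ//; apply: eq_circle_avg => x.
  have cc := circle_cont_cauchy x r10 r20 r12 Gzc.
  by rewrite inner !circle_avgZ//; ring.
move: (cauchy_int _ _ _ _) => k; rewrite -/P expr2; by field.
Qed.

End CircleKernel.

(** * Laurent coefficients *)

Fact lcoef_key : unit. Proof. by []. Qed.

Section Laurent.
Variable R : realType.
Local Notation C := R[i].
Implicit Types (F G : C -> C) (r x b : R) (S : R -> Prop) (a c d : int -> C) (D : int -> int -> C).

Definition lcoef : R -> (C -> C) -> int -> C :=
  locked_with lcoef_key (fun r F n => circle_avg r (fun z => F z * z ^ (- n))).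

Lemma lcoefE r F (n : int) : lcoef r F n = circle_avg r (fun z => F z * z ^ (- n)).
Proof. by rewrite /lcoef unlock. Qed.

Lemma le0_geometric (y B s : R) : 0 <= s < 1 -> (forall k : nat, y <= B * s ^+ k) -> y <= 0.
Proof.
move=> /andP[s0 s1] yB.
have cv : B * s ^+ k @[k --> \oo] --> (0 : R).
  rewrite -(mulr0 B); apply: cvgM; first exact: cvg_cst.
  by apply: cvg_expr; rewrite ger0_norm.
rewrite -(cvg_lim _ cv)//; apply: limr_ge; first by apply/cvg_ex; exists 0.
by apply: nearW => k; exact: yB.
Qed.

Lemma normc_le0 (z : C) : normc z <= 0 -> z = 0.
Proof. by move=> z0; apply: eq0_normc; apply/le_anti; rewrite z0 normc_ge0. Qed.

Lemma normc_le_geo0 (z : C) (B s : R) : 0 <= s < 1 ->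
  (forall k : nat, normc z <= B * s ^+ k) -> z = 0.
Proof. by move=> s01 zB; apply: normc_le0; exact: le0_geometric zB. Qed.

Lemma circle_cont_lcoef r F n : 0 < r -> circle_cont r F -> circle_cont r (fun z => F z * z ^ (- n)).
Proof. by move=> r0 Fc; apply: circle_contM => //; exact: circle_contXz. Qed.

Lemma lcoef_bound r F : 0 < r -> circle_cont r F ->
  exists2 B, 0 <= B & forall n, normc (lcoef r F n) <= B * r ^ (- n).
Proof.
move=> r0 Fc; have [B B0 FB] := circle_cont_bounded Fc.
exists (2 * B); [lra|move=> n; rewrite lcoefE -mulrA].
apply: circle_avg_bound; first exact: circle_cont_lcoef.
by apply: circle_boundM => //; exact: circle_boundXz.
Qed.

(* The Laurent coefficients of [F] do not depend on the circle as long as its radius satisfies [S]. *)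
Definition laurent S F c := (forall r, S r -> 0 < r /\ circle_cont r F) /\
  (forall r n, S r -> lcoef r F n = c n).

Lemma circM_Xz r y (k : int) : 0 < r -> circ r y * circ r y ^ k = circ r y ^ (k + 1).
Proof. by move=> r0; rewrite expfzDr ?circ_neq0// expr1z mulrC. Qed.

Definition facP x (z : C) : C := 1 - z * x%:C.
Definition facM b (z : C) : C := 1 - b%:C / z.

Lemma circle_cont_facP r x : circle_cont r (facP x).
Proof.
apply: circle_contD; first exact: circle_cont_cst.
by apply: eq_circle_cont (circle_contM (circle_cont_id r) (circle_cont_cst r (- x%:C))) => y; rewrite mulrN.
Qed.

Lemma circle_cont_facM r b : 0 < r -> circle_cont r (facM b).
Proof.
move=> r0; apply: circle_contD; first exact: circle_cont_cst.
have ic : circle_cont r (fun z => z^-1).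
  by apply: circle_contV; [exact: circle_cont_id|move=> x; exact: circ_neq0].
by apply: eq_circle_cont (circle_contM (circle_cont_cst r (- b%:C)) ic) => y; rewrite mulNr.
Qed.

Lemma facP_neq0 r x y : 0 < r -> 0 <= x -> x * r < 1 -> facP x (circ r y) != 0.
Proof.
move=> r0 x0 xr; apply/eqP => /eqP; rewrite subr_eq0 => /eqP/(congr1 (@normc R)).
by rewrite normcM normc_circ// normc_real normc1 ger0_norm//; lra.
Qed.

Lemma facM_neq0 r b y : 0 <= b -> b < r -> facM b (circ r y) != 0.
Proof.
move=> b0 br; have r0 : 0 < r by lra.
apply/eqP => /eqP; rewrite subr_eq0 => /eqP/(congr1 (@normc R)).
rewrite normcM normcV normc_circ// normc_real normc1 ger0_norm// => e.
by have := divfK (lt0r_neq0 r0) b; rewrite -e mul1r; lra.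
Qed.

Lemma lcoef_facP r F x n : 0 < r -> circle_cont r F ->
  lcoef r (fun z => F z * facP x z) n = lcoef r F n - x%:C * lcoef r F (n - 1).
Proof.
move=> r0 Fc; rewrite !lcoefE -mulNr -circle_avgZ; last exact: circle_cont_lcoef.
rewrite -circle_avgD; [|exact: circle_cont_lcoef|]; last first.
  by apply: circle_contM; [exact: circle_cont_cst|exact: circle_cont_lcoef].
apply: eq_circle_avg => y; rewrite /facP opprB [1 - n]addrC -circM_Xz//; ring.
Qed.

Lemma lcoef_facM r F b n : 0 < r -> circle_cont r F ->
  lcoef r (fun z => F z * facM b z) n = lcoef r F n - b%:C * lcoef r F (n + 1).
Proof.
move=> r0 Fc; rewrite !lcoefE -mulNr -circle_avgZ; last exact: circle_cont_lcoef.
rewrite -circle_avgD; [|exact: circle_cont_lcoef|]; last first.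
  by apply: circle_contM; [exact: circle_cont_cst|exact: circle_cont_lcoef].
apply: eq_circle_avg => y; have := circM_Xz y (- (n + 1)) r0.
have -> : - (n + 1) + 1 = - n by ring.
have z0 := circ_neq0 y r0.
by move=> <-; rewrite /facM; field.
Qed.

(** Iterating [k] times gives [d n = x ^ k * d (n - k)], which tends to 0 with [k]. This serves both
    for the independence of the radius (applied to a difference) and for the vanishing of low
    coefficients. *)
Lemma rec_down_zero d x (n0 : int) :
  (forall n, n < n0 -> d n = x%:C * d (n - 1)) ->
  (forall n, exists B s, 0 <= s < 1 /\ forall k : nat, normc (x%:C ^+ k * d (n - k%:Z)) <= B * s ^+ k) ->
  forall n, n < n0 -> d n = 0.
Proof.
move=> rec dec n nn0; have [B [s [s01 H]]] := dec n.
apply: (normc_le_geo0 s01 (B := B)) => k; suff -> : d n = x%:C ^+ k * d (n - k%:Z) by [].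
elim: k => [|k IH]; first by rewrite expr0 mul1r subr0.
rewrite IH exprSr rec; last by lia.
by rewrite mulrA; congr (_ * d _); lia.
Qed.

Lemma rec_up_zero d x (n0 : int) :
  (forall n, n0 < n -> d n = x%:C * d (n + 1)) ->
  (forall n, exists B s, 0 <= s < 1 /\ forall k : nat, normc (x%:C ^+ k * d (n + k%:Z)) <= B * s ^+ k) ->
  forall n, n0 < n -> d n = 0.
Proof.
move=> rec dec n nn0; rewrite -[n]opprK.
apply: (@rec_down_zero (fun n => d (- n)) x (- n0)); last by lia.
  by move=> m mn; rewrite rec; [congr (_ * d _)|]; lia.
move=> m; have [B [s [s01 H]]] := dec (- m); exists B, s; split=> // k.
by have -> : - (m - k%:Z) = - m + k%:Z by ring.
Qed.

Lemma geometric_down d x r B n : 0 < r -> 0 <= x -> (forall n, normc (d n) <= B * r ^ (- n)) ->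
  forall k : nat, normc (x%:C ^+ k * d (n - k%:Z)) <= B * r ^ (- n) * (x * r) ^+ k.
Proof.
move=> r0 x0 dB k; rewrite normcM exprnP normcXz normc_real ger0_norm//.
apply: le_trans (ler_wpM2l (exprn_ge0 k x0) (dB _)) _.
rewrite opprB expfzDr ?gt_eqF// exprMn -exprnP.
by rewrite le_eqVlt; apply/orP; left; apply/eqP; ring.
Qed.

Lemma geometric_up d x r B n : 0 < r -> 0 <= x -> (forall n, normc (d n) <= B * r ^ (- n)) ->
  forall k : nat, normc (x%:C ^+ k * d (n + k%:Z)) <= B * r ^ (- n) * (x / r) ^+ k.
Proof.
move=> r0 x0 dB k; rewrite normcM exprnP normcXz normc_real ger0_norm//.
apply: le_trans (ler_wpM2l (exprn_ge0 k x0) (dB _)) _.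
rewrite opprD expfzDr ?gt_eqF// exprMn exprVn exprnN.
by rewrite le_eqVlt; apply/orP; left; apply/eqP; ring.
Qed.

Lemma geometric_add (A B s s' : R) : 0 <= A -> 0 <= B -> 0 <= s < 1 -> 0 <= s' < 1 ->
  exists2 t, 0 <= t < 1 & forall k : nat, A * s ^+ k + B * s' ^+ k <= (A + B) * t ^+ k.
Proof.
move=> A0 B0 /andP[s0 s1] /andP[t0 t1]; exists (Num.max s s').
  by rewrite le_max s0 gt_max s1 t1.
move=> k; rewrite mulrDl lerD// ler_wpM2l// lerXn2r// ?nnegrE ?le_max ?s0 ?lexx ?orbT//.
Qed.

Lemma normcB_le (z w : C) : normc (z - w) <= normc z + normc w.
Proof. by rewrite -[normc w]normcN; exact: le_normcD. Qed.

Lemma rec_sub (e a1 a2 b1 b2 x : C) : e = a1 - x * a2 -> e = b1 - x * b2 ->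
  a1 - b1 = x * (a2 - b2).
Proof.
move=> -> /eqP; rewrite eq_sym subr_eq => /eqP ->; ring.
Qed.

Section Laur.
Variables (S : R -> Prop) (r0 : R) (Sr0 : S r0).

Lemma laurent1 : (forall r, S r -> 0 < r) -> laurent S (fun=> 1) (fun n => (n == 0)%:R).
Proof.
move=> S0; split=> [r /S0|r n /S0] rp; first by split=> //; exact: circle_cont_cst.
rewrite lcoefE; have := circle_avgXz (- n) rp; rewrite oppr_eq0 => <-.
by apply: eq_circle_avg => x; rewrite mul1r.
Qed.

Lemma laurent_facP F c x : laurent S F c ->
  laurent S (fun z => F z * facP x z) (fun n => c n - x%:C * c (n - 1)).
Proof.
move=> [F1 F2]; split=> [r /F1[rp Fc]|r n Sr].
  by split=> //; apply: circle_contM => //; exact: circle_cont_facP.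
by have [rp Fc] := F1 _ Sr; rewrite lcoef_facP// !F2.
Qed.

Lemma laurent_facM F c b : laurent S F c ->
  laurent S (fun z => F z * facM b z) (fun n => c n - b%:C * c (n + 1)).
Proof.
move=> [F1 F2]; split=> [r /F1[rp Fc]|r n Sr].
  by split=> //; apply: circle_contM => //; exact: circle_cont_facM.
by have [rp Fc] := F1 _ Sr; rewrite lcoef_facM// !F2.
Qed.

Lemma laurent_bound F c : laurent S F c -> exists2 B, 0 <= B & forall n, normc (c n) <= B * r0 ^ (- n).
Proof.
move=> [F1 F2]; have [rp Fc] := F1 _ Sr0; have [B B0 FB] := lcoef_bound rp Fc.
by exists B => // n; rewrite -(F2 r0).
Qed.

Lemma laurent_eq F G c : (forall r y, S r -> F (circ r y) = G (circ r y)) -> laurent S F c -> laurent S G c.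
Proof.
move=> FG [F1 F2]; split=> [r Sr|r n Sr].
  have [rp Fc] := F1 r Sr; split=> //; apply: eq_circle_cont Fc => y; exact: FG.
by rewrite -(F2 r)// !lcoefE; apply: eq_circle_avg => y; rewrite FG.
Qed.

(** Stands in for Cauchy's theorem. The coefficients of the quotient on two circles solve the same
    first-order recurrence, so their difference is homogeneous; iterated downwards it decays like
    powers of [x * r] and [x * r0], hence vanishes. *)
Lemma laurent_facP_div F c x : 0 <= x -> (forall r, S r -> x * r < 1) -> laurent S F c ->
  exists2 c', laurent S (fun z => F z / facP x z) c' & forall n, c n = c' n - x%:C * c' (n - 1).
Proof.
move=> x0 xS [F1 F2].
pose F' := fun z => F z / facP x z.
have F'c r : S r -> circle_cont r F'.
  move=> Sr; have [rp Fc] := F1 _ Sr; apply: circle_contM => //; apply: circle_contV; first exact: circle_cont_facP.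
  by move=> y; apply: facP_neq0 => //; exact: xS.
have F'rec r n : S r -> c n = lcoef r F' n - x%:C * lcoef r F' (n - 1).
  move=> Sr; have [rp Fc] := F1 _ Sr; rewrite -lcoef_facP; [|done|exact: F'c].
  rewrite -(F2 r)//; rewrite !lcoefE; apply: eq_circle_avg => y; rewrite /F' divfK//.
  by apply: facP_neq0 => //; exact: xS.
exists (lcoef r0 F') => [|n]; last exact: F'rec.
split=> [r Sr|r n Sr]; first by split; [have [] := F1 _ Sr|exact: F'c].
have [rp Fc] := F1 _ Sr; have [r0p _] := F1 _ Sr0.
have [B B0 HB] := lcoef_bound rp (F'c _ Sr).
have [B' B0' HB'] := lcoef_bound r0p (F'c _ Sr0).
apply/eqP; rewrite -subr_eq0; apply/eqP.
apply: (@rec_down_zero (fun n => lcoef r F' n - lcoef r0 F' n) x (n + 1)); last by lia.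
  move=> m _; have h1 := F'rec r m Sr; have h2 := F'rec r0 m Sr0.
  exact: rec_sub h1 h2.
move=> m.
have [||||t t01 Ht] := @geometric_add (B * r ^ (- m)) (B' * r0 ^ (- m)) (x * r) (x * r0).
- by rewrite mulr_ge0// exprz_ge0// ltW.
- by rewrite mulr_ge0// exprz_ge0// ltW.
- by apply/andP; split; [apply: mulr_ge0 => //; exact: ltW|exact: xS].
- by apply/andP; split; [apply: mulr_ge0 => //; exact: ltW|exact: xS].
exists (B * r ^ (- m) + B' * r0 ^ (- m)), t; split=> // k.
apply: le_trans (Ht k); rewrite mulrBr; apply: le_trans (normcB_le _ _) _.
by apply: lerD; exact: geometric_down.
Qed.

(** Mirror image: the homogeneous recurrence is iterated upwards, with ratios [b / r] and
    [b / r0]. *)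
Lemma laurent_facM_div F c b : 0 <= b -> (forall r, S r -> b < r) -> laurent S F c ->
  exists2 c', laurent S (fun z => F z / facM b z) c' & forall n, c n = c' n - b%:C * c' (n + 1).
Proof.
move=> b0 bS [F1 F2].
pose F' := fun z => F z / facM b z.
have F'c r : S r -> circle_cont r F'.
  move=> Sr; have [rp Fc] := F1 _ Sr; apply: circle_contM => //; apply: circle_contV; first exact: circle_cont_facM.
  by move=> y; apply: facM_neq0 => //; exact: bS.
have F'rec r n : S r -> c n = lcoef r F' n - b%:C * lcoef r F' (n + 1).
  move=> Sr; have [rp Fc] := F1 _ Sr; rewrite -lcoef_facM; [|done|exact: F'c].
  rewrite -(F2 r)//; rewrite !lcoefE; apply: eq_circle_avg => y; rewrite /F' divfK//.
  by apply: facM_neq0 => //; exact: bS.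
exists (lcoef r0 F') => [|n]; last exact: F'rec.
split=> [r Sr|r n Sr]; first by split; [have [] := F1 _ Sr|exact: F'c].
have [rp Fc] := F1 _ Sr; have [r0p _] := F1 _ Sr0.
have [B B0 HB] := lcoef_bound rp (F'c _ Sr).
have [B' B0' HB'] := lcoef_bound r0p (F'c _ Sr0).
apply/eqP; rewrite -subr_eq0; apply/eqP.
apply: (@rec_up_zero (fun n => lcoef r F' n - lcoef r0 F' n) b (n - 1)); last by lia.
  move=> m _; have h1 := F'rec r m Sr; have h2 := F'rec r0 m Sr0.
  exact: rec_sub h1 h2.
move=> m.
have [||||t t01 Ht] := @geometric_add (B * r ^ (- m)) (B' * r0 ^ (- m)) (b / r) (b / r0).
- by rewrite mulr_ge0// exprz_ge0// ltW.
- by rewrite mulr_ge0// exprz_ge0// ltW.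
- by apply/andP; split; [apply: divr_ge0 => //; exact: ltW|rewrite ltr_pdivrMr// mul1r bS].
- by apply/andP; split; [apply: divr_ge0 => //; exact: ltW|rewrite ltr_pdivrMr// mul1r bS].
exists (B * r ^ (- m) + B' * r0 ^ (- m)), t; split=> // k.
apply: le_trans (Ht k); rewrite mulrBr; apply: le_trans (normcB_le _ _) _.
by apply: lerD; exact: geometric_up.
Qed.

Definition prodP (l : seq R) (z : C) : C := \prod_(x <- l) facP x z.
Definition prodM (l : seq R) (z : C) : C := \prod_(b <- l) facM b z.

Lemma laurent_prodP la : (forall r, S r -> 0 < r) ->
  exists2 c, laurent S (prodP la) c & forall n, n < 0 -> c n = 0.
Proof.
move=> S0; elim: la => [|x la [c cF c0]].
  exists (fun n => (n == 0)%:R); last by move=> n n0; case: eqVneq => //; lia.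
  by apply: laurent_eq (laurent1 S0) => r y _; rewrite /prodP big_nil.
exists (fun n => c n - x%:C * c (n - 1)); last by move=> n n0; rewrite !c0 ?mulr0 ?subr0//; lia.
by apply: laurent_eq (laurent_facP x cF) => r y _; rewrite /prodP big_cons mulrC.
Qed.

(** The lowest power in [prodM lb] is [- size lb], and dividing by [1 - x z] inside its disc brings
    in only nonnegative powers. In the proof, the recurrence becomes homogeneous below that
    index. *)
Lemma laurent_ratio_MP la lb : (forall r, S r -> 0 < r) -> (forall x, x \in la -> 0 <= x) ->
  (forall r x, S r -> x \in la -> x * r < 1) ->
  exists2 c, laurent S (fun z => prodM lb z / prodP la z) c & forall n, n < - (size lb)%:Z -> c n = 0.
Proof.
move=> S0; elim: la => [|x la IH] la0 laS.
  elim: lb => [|b lb [c cF c0]].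
    exists (fun n => (n == 0)%:R); last by move=> n n0; case: eqVneq => //; lia.
    by apply: laurent_eq (laurent1 S0) => r y _; rewrite /prodM /prodP !big_nil divr1.
  exists (fun n => c n - b%:C * c (n + 1)); last by move=> n /= n0; rewrite !c0 ?mulr0 ?subr0//; lia.
  apply: laurent_eq (laurent_facM b cF) => r y _; rewrite /prodM big_cons; ring.
have [|r z Sr zla|c cF c0] := IH; first by move=> z zla; rewrite la0// inE zla orbT.
  by rewrite laS// inE zla orbT.
have xS r : S r -> x * r < 1 by move=> Sr; rewrite laS// mem_head.
have x0 : 0 <= x by rewrite la0// mem_head.
have [c' c'F c'rec] := laurent_facP_div x0 xS cF.
exists c'; first by apply: laurent_eq c'F => r y _; rewrite /prodP big_cons invfM; ring.
have [B B0 HB] := laurent_bound c'F; have r0p := S0 _ Sr0.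
apply: (rec_down_zero (x := x)).
  by move=> n nlt; apply/eqP; rewrite -subr_eq0 -c'rec c0.
move=> n; exists (B * r0 ^ (- n)), (x * r0); split.
  by apply/andP; split; [apply: mulr_ge0 => //; exact: ltW|exact: xS].
exact: geometric_down.
Qed.

(** The same at infinity: [prodP la] has degree at most [size la], and dividing by [1 - b / z]
    outside the disc of radius [b] brings in only nonpositive powers. *)
Lemma laurent_ratio_PM la lb : (forall r, S r -> 0 < r) -> (forall x, x \in lb -> 0 <= x) ->
  (forall r x, S r -> x \in lb -> x < r) ->
  exists2 c, laurent S (fun z => prodP la z / prodM lb z) c & forall n, (size la)%:Z < n -> c n = 0.
Proof.
move=> S0; elim: lb => [|x lb IH] lb0 lbS.
  elim: la => [|b la [c cF c0]].
    exists (fun n => (n == 0)%:R); last by move=> n n0; case: eqVneq => //; lia.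
    by apply: laurent_eq (laurent1 S0) => r y _; rewrite /prodM /prodP !big_nil divr1.
  exists (fun n => c n - b%:C * c (n - 1)); last by move=> n /= n0; rewrite !c0 ?mulr0 ?subr0//; lia.
  apply: laurent_eq (laurent_facP b cF) => r y _; rewrite /prodP big_cons; ring.
have [|r z Sr zlb|c cF c0] := IH; first by move=> z zlb; rewrite lb0// inE zlb orbT.
  by rewrite lbS// inE zlb orbT.
have xS r : S r -> x < r by move=> Sr; rewrite lbS// mem_head.
have x0 : 0 <= x by rewrite lb0// mem_head.
have [c' c'F c'rec] := laurent_facM_div x0 xS cF.
exists c'; first by apply: laurent_eq c'F => r y _; rewrite /prodM big_cons invfM; ring.
have [B B0 HB] := laurent_bound c'F; have r0p := S0 _ Sr0.
apply: (rec_up_zero (x := x)).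
  by move=> n nlt; apply/eqP; rewrite -subr_eq0 -c'rec c0.
move=> n; exists (B * r0 ^ (- n)), (x / r0); split.
  by apply/andP; split; [apply: divr_ge0 => //; exact: ltW|rewrite ltr_pdivrMr// mul1r xS].
exact: geometric_up.
Qed.

End Laur.
End Laurent.

(** * The kernel as a function of its two exponents, and its jump when the circles cross *)

Fact kernelFG_key : unit. Proof. by []. Qed.
Fact jump_key : unit. Proof. by []. Qed.

Section KernelMoments.
Variable R : realType.
Local Notation C := R[i].
Implicit Types (F G : C -> C) (r x : R) (S : R -> Prop) (a b c d : int -> C) (D : int -> int -> C).

(** The exponents are those of the contour integral, [- J1 - 1] and [J2], each raised by one by the
    change from dz dw to angles. *)
Definition kernelFG : R -> R -> (C -> C) -> (C -> C) -> int -> int -> C :=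
  locked_with kernelFG_key (fun r1 r2 F G J1 J2 =>
    cauchy_int r1 r2 (fun z => F z * z ^ (- J1)) (fun w => G w * w ^ (J2 + 1))).

Lemma kernelFGE (r1 r2 : R) F G (J1 J2 : int) : kernelFG r1 r2 F G J1 J2 =
  cauchy_int r1 r2 (fun z => F z * z ^ (- J1)) (fun w => G w * w ^ (J2 + 1)).
Proof. by rewrite /kernelFG unlock. Qed.

(** Raising both exponents by one multiplies the integrand by [w / z], of modulus [r2 / r1]; so the
    order of the radii decides between [decay_up] and [decay_down]. *)
Definition decay_up D := forall J1 J2, exists B s, 0 <= s < 1 /\
  forall k : nat, normc (D (J1 + k%:Z) (J2 + k%:Z)) <= B * s ^+ k.
Definition decay_down D := forall J1 J2, exists B s, 0 <= s < 1 /\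
  forall k : nat, normc (D (J1 - k%:Z) (J2 - k%:Z)) <= B * s ^+ k.

Lemma geometric_sub (y1 y2 : nat -> C) (B s B' s' : R) : 0 <= s < 1 -> 0 <= s' < 1 ->
  (forall k, normc (y1 k) <= B * s ^+ k) -> (forall k, normc (y2 k) <= B' * s' ^+ k) ->
  exists B s, 0 <= s < 1 /\ forall k : nat, normc (y1 k - y2 k) <= B * s ^+ k.
Proof.
move=> s01 s01' H1 H2.
have B0 : 0 <= B by have := H1 0; rewrite mulr1; apply: le_trans; exact: normc_ge0.
have B0' : 0 <= B' by have := H2 0; rewrite mulr1; apply: le_trans; exact: normc_ge0.
have [t t01 Ht] := geometric_add B0 B0' s01 s01'.
exists (B + B'), t; split=> // k; apply: le_trans (Ht k).
by apply: le_trans (normcB_le _ _) _; apply: lerD.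
Qed.

Lemma decay_upB D D' : decay_up D -> decay_up D' -> decay_up (fun J1 J2 => D J1 J2 - D' J1 J2).
Proof.
move=> H H' J1 J2; have [B [s [s01 h]]] := H J1 J2; have [B' [s' [s01' h']]] := H' J1 J2.
exact: (geometric_sub s01 s01' h h').
Qed.

Lemma decay_downB D D' : decay_down D -> decay_down D' -> decay_down (fun J1 J2 => D J1 J2 - D' J1 J2).
Proof.
move=> H H' J1 J2; have [B [s [s01 h]]] := H J1 J2; have [B' [s' [s01' h']]] := H' J1 J2.
exact: (geometric_sub s01 s01' h h').
Qed.

Lemma decay_up_eq0 D (m : int) : decay_up D ->
  (forall J1 J2, m <= J2 -> D (J1 - 1) J2 = D J1 (J2 + 1)) ->
  forall J1 J2, m <= J2 -> D J1 J2 = 0.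
Proof.
move=> Dd Drec J1 J2 mJ; have [B [s [s01 H]]] := Dd J1 J2.
apply: (normc_le_geo0 s01 (B := B)) => k.
suff -> : D J1 J2 = D (J1 + k%:Z) (J2 + k%:Z) by [].
elim: k => [|k ->]; first by rewrite !addr0.
have -> : J1 + k%:Z = J1 + k.+1%:Z - 1 by lia.
by rewrite Drec; [congr (D _ _)|]; lia.
Qed.

Lemma decay_down_eq0 D (m : int) : decay_down D ->
  (forall J1 J2, J2 < m -> D (J1 - 1) (J2 - 1) = D J1 J2) ->
  forall J1 J2, J2 < m -> D J1 J2 = 0.
Proof.
move=> Dd Drec J1 J2 mJ; have [B [s [s01 H]]] := Dd J1 J2.
apply: (normc_le_geo0 s01 (B := B)) => k.
suff -> : D J1 J2 = D (J1 - k%:Z) (J2 - k%:Z) by [].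
elim: k => [|k ->]; first by rewrite !subr0.
by rewrite -Drec; [congr (D _ _)|]; lia.
Qed.

Lemma eq_kernelFG r1 r2 F F' G G' J1 J2 : (forall x, F (circ r1 x) = F' (circ r1 x)) ->
  (forall x, G (circ r2 x) = G' (circ r2 x)) -> kernelFG r1 r2 F G J1 J2 = kernelFG r1 r2 F' G' J1 J2.
Proof. by move=> Phi_z Phi_w; rewrite !kernelFGE; apply: eq_cauchy_int => x; rewrite ?Phi_z ?Phi_w. Qed.

Section Radii.
Variables (r1 r2 : R).
Hypotheses (r10 : 0 < r1) (r20 : 0 < r2) (r12 : r1 != r2).
Variables (F G : C -> C).
Hypotheses (Fc : circle_cont r1 F) (Gc : circle_cont r2 G).

Let FJc J : circle_cont r1 (fun z => F z * z ^ J).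
Proof. by apply: circle_contM => //; exact: circle_contXz. Qed.
Let GJc J : circle_cont r2 (fun z => G z * z ^ J).
Proof. by apply: circle_contM => //; exact: circle_contXz. Qed.

Lemma kernelFG_shift J1 J2 :
  kernelFG r1 r2 F G (J1 - 1) J2 = kernelFG r1 r2 F G J1 (J2 + 1) + lcoef r1 F J1 * lcoef r2 G (- J2 - 1).
Proof.
have E := cauchy_int_shift r10 r20 r12 (FJc (- J1)) (GJc (J2 + 1)).
have -> : kernelFG r1 r2 F G (J1 - 1) J2 = cauchy_int r1 r2 (fun z => z * (F z * z ^ (- J1))) (fun z => G z * z ^ (J2 + 1)).
  rewrite kernelFGE; apply: eq_cauchy_int => x //; have -> : - (J1 - 1) = - J1 + 1 by ring.
  by rewrite -circM_Xz//; ring.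
have -> : kernelFG r1 r2 F G J1 (J2 + 1) =
    cauchy_int r1 r2 (fun z => F z * z ^ (- J1)) (fun w => w * (G w * w ^ (J2 + 1))).
  by rewrite kernelFGE; apply: eq_cauchy_int => x //; rewrite -(circM_Xz x (J2 + 1))//; ring.
have -> : lcoef r2 G (- J2 - 1) = circle_avg r2 (fun z => G z * z ^ (J2 + 1)).
  by rewrite lcoefE; have -> : - (- J2 - 1) = J2 + 1 by ring.
by rewrite lcoefE; exact: E.
Qed.

Lemma kernelFG_bound : exists2 B, 0 <= B &
  forall J1 J2, normc (kernelFG r1 r2 F G J1 J2) <= B * (r1 ^ (- J1) * r2 ^ J2).
Proof.
have [A A0 FA] := circle_cont_bounded Fc; have [B B0 GB] := circle_cont_bounded Gc.
have d0 : 0 < `|r1 - r2| by rewrite normr_gt0 subr_eq0.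
exists (4 * (A * B * r2 / `|r1 - r2|)); first by rewrite mulr_ge0// divr_ge0// mulr_ge0 ?mulr_ge0// ltW.
move=> J1 J2.
have -> : 4 * (A * B * r2 / `|r1 - r2|) * (r1 ^ (- J1) * r2 ^ J2) =
   4 * ((A * r1 ^ (- J1)) * (B * r2 ^ (J2 + 1)) / `|r1 - r2|).
  by rewrite expfzDr ?gt_eqF// expr1z; ring.
rewrite kernelFGE; apply: cauchy_int_bound => //; try by rewrite mulr_ge0// exprz_ge0// ltW.
- by apply: circle_boundM => //; exact: circle_boundXz.
- by apply: circle_boundM => //; exact: circle_boundXz.
Qed.

Lemma kernelFG_decay_up : r2 < r1 -> decay_up (kernelFG r1 r2 F G).
Proof.
move=> lt J1 J2; have [B B0 H] := kernelFG_bound.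
exists (B * (r1 ^ (- J1) * r2 ^ J2)), (r2 / r1); split.
  by apply/andP; split; [apply: divr_ge0; exact: ltW|rewrite ltr_pdivrMr// mul1r].
move=> k; apply: le_trans (H _ _) _.
rewrite opprD !expfzDr ?gt_eqF// exprMn exprVn exprnN -!exprnP.
by rewrite le_eqVlt; apply/orP; left; apply/eqP; ring.
Qed.

Lemma kernelFG_decay_down : r1 < r2 -> decay_down (kernelFG r1 r2 F G).
Proof.
move=> lt J1 J2; have [B B0 H] := kernelFG_bound.
exists (B * (r1 ^ (- J1) * r2 ^ J2)), (r1 / r2); split.
  by apply/andP; split; [apply: divr_ge0; exact: ltW|rewrite ltr_pdivrMr// mul1r].
move=> k; apply: le_trans (H _ _) _.
rewrite opprB addrC !expfzDr ?gt_eqF// exprMn exprVn exprnN -!exprnP.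
by rewrite le_eqVlt; apply/orP; left; apply/eqP; ring.
Qed.

Lemma kernelFG_facP_r x J1 J2 : kernelFG r1 r2 F (fun w => G w * facP x w) J1 J2 =
  kernelFG r1 r2 F G J1 J2 - x%:C * kernelFG r1 r2 F G J1 (J2 + 1).
Proof.
have zc : circle_cont r2 (fun w => - x%:C * (G w * w ^ (J2 + 1 + 1))) by apply: circle_contM; [exact: circle_cont_cst|exact: GJc].
rewrite !kernelFGE -mulNr -(cauchy_intZr r10 r20 r12 (- x%:C) (FJc (- J1)) (GJc (J2 + 1 + 1))).
rewrite -(cauchy_intDr r10 r20 r12 (FJc (- J1)) (GJc (J2 + 1)) zc).
apply: eq_cauchy_int => // y; rewrite -(circM_Xz y (J2 + 1))// /facP; ring.
Qed.

Lemma kernelFG_facP_l x J1 J2 : kernelFG r1 r2 (fun w => F w * facP x w) G J1 J2 =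
  kernelFG r1 r2 F G J1 J2 - x%:C * kernelFG r1 r2 F G (J1 - 1) J2.
Proof.
have zc : circle_cont r1 (fun w => - x%:C * (F w * w ^ (- (J1 - 1)))) by apply: circle_contM; [exact: circle_cont_cst|exact: FJc].
rewrite !kernelFGE -mulNr -(cauchy_intZl r10 r20 r12 (- x%:C) (FJc (- (J1 - 1))) (GJc (J2 + 1))).
rewrite -(cauchy_intDl r10 r20 r12 (FJc (- J1)) zc (GJc (J2 + 1))).
apply: eq_cauchy_int => // y; have -> : - (J1 - 1) = - J1 + 1 by ring.
rewrite -(circM_Xz y (- J1))// /facP; ring.
Qed.

Lemma kernelFG_facM_r (b : R) J1 J2 : kernelFG r1 r2 F (fun w => G w * facM b w) J1 J2 =
  kernelFG r1 r2 F G J1 J2 - b%:C * kernelFG r1 r2 F G J1 (J2 - 1).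
Proof.
have zc : circle_cont r2 (fun w => - b%:C * (G w * w ^ (J2 - 1 + 1))) by apply: circle_contM; [exact: circle_cont_cst|exact: GJc].
rewrite !kernelFGE -mulNr -(cauchy_intZr r10 r20 r12 (- b%:C) (FJc (- J1)) (GJc (J2 - 1 + 1))).
rewrite -(cauchy_intDr r10 r20 r12 (FJc (- J1)) (GJc (J2 + 1)) zc).
apply: eq_cauchy_int => // y; have -> : J2 - 1 + 1 = J2 by ring.
have z0 := circ_neq0 y r20.
rewrite -(circM_Xz y J2)// /facM; field.
by [].
Qed.

Lemma kernelFG_facM_l (b : R) J1 J2 : kernelFG r1 r2 (fun w => F w * facM b w) G J1 J2 =
  kernelFG r1 r2 F G J1 J2 - b%:C * kernelFG r1 r2 F G (J1 + 1) J2.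
Proof.
have zc : circle_cont r1 (fun w => - b%:C * (F w * w ^ (- (J1 + 1)))) by apply: circle_contM; [exact: circle_cont_cst|exact: FJc].
rewrite !kernelFGE -mulNr -(cauchy_intZl r10 r20 r12 (- b%:C) (FJc (- (J1 + 1))) (GJc (J2 + 1))).
rewrite -(cauchy_intDl r10 r20 r12 (FJc (- J1)) zc (GJc (J2 + 1))).
apply: eq_cauchy_int => // y; have -> : - J1 = - (J1 + 1) + 1 by ring.
have z0 := circ_neq0 y r10.
rewrite -(circM_Xz y (- (J1 + 1)))// /facM; field.
by [].
Qed.

End Radii.

(* The kernel is determined by the Laurent coefficients of its two factors: the difference of two
   such kernels is constant along the diagonals, where both tend to 0. *)
Lemma kernelFG_radii (S S' : R -> Prop) F G a b r1 r2 s1 s2 : laurent S F a -> laurent S' G b ->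
  S r1 -> S' r2 -> S s1 -> S' s2 -> (r2 < r1 /\ s2 < s1) \/ (r1 < r2 /\ s1 < s2) ->
  forall J1 J2, kernelFG r1 r2 F G J1 J2 = kernelFG s1 s2 F G J1 J2.
Proof.
move=> [F1 F2] [G1 G2] Sr1 Sr2 Ss1 Ss2 lt J1 J2.
have [r10 Fr] := F1 _ Sr1; have [r20 Gr] := G1 _ Sr2.
have [s10 Fs] := F1 _ Ss1; have [s20 Gs] := G1 _ Ss2.
have r12 : r1 != r2 by case: lt => -[h _]; [rewrite gt_eqF|rewrite lt_eqF].
have s12 : s1 != s2 by case: lt => -[_ h]; [rewrite gt_eqF|rewrite lt_eqF].
pose D J1 J2 := kernelFG r1 r2 F G J1 J2 - kernelFG s1 s2 F G J1 J2.
have Drec K1 K2 : D (K1 - 1) K2 = D K1 (K2 + 1).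
  have e1 := kernelFG_shift r10 r20 r12 Fr Gr K1 K2.
  have e2 := kernelFG_shift s10 s20 s12 Fs Gs K1 K2.
  rewrite /D e1 e2 (F2 _ _ Sr1) (F2 _ _ Ss1) (G2 _ _ Sr2) (G2 _ _ Ss2).
  by rewrite opprD addrACA subrr addr0.
apply/eqP; rewrite -subr_eq0; apply/eqP; rewrite -/(D J1 J2).
case: lt => -[lr ls].
  by apply: (decay_up_eq0 (m := J2)) => //; apply: decay_upB; exact: kernelFG_decay_up.
apply: (decay_down_eq0 (m := J2 + 1)); last by lia.
  by apply: decay_downB; exact: kernelFG_decay_down.
by move=> K1 K2 _; rewrite Drec subrK.
Qed.

(** For [J2 >= m] the product term of [kernelFG_shift] contains the coefficient of [G] at
    [- J2 - 1 < - m], which is 0: the kernel is constant along upward diagonals and tends to 0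
    there. *)
Lemma kernelFG_up_eq0 (S S' : R -> Prop) F G a b r1 r2 (m : int) : laurent S F a -> laurent S' G b ->
  S r1 -> S' r2 -> r2 < r1 -> (forall n, n < - m -> b n = 0) ->
  forall J1 J2, m <= J2 -> kernelFG r1 r2 F G J1 J2 = 0.
Proof.
move=> [F1 F2] [G1 G2] Sr1 Sr2 lt b0 J1 J2.
have [r10 Fr] := F1 _ Sr1; have [r20 Gr] := G1 _ Sr2.
have r12 : r1 != r2 by rewrite gt_eqF.
apply: decay_up_eq0; first exact: kernelFG_decay_up.
by move=> K1 K2 mK; rewrite kernelFG_shift// (G2 r2)// b0 ?mulr0 ?addr0//; lia.
Qed.

Lemma kernelFG_down_eq0 (S S' : R -> Prop) F G a b r1 r2 (m : int) : laurent S F a -> laurent S' G b ->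
  S r1 -> S' r2 -> r1 < r2 -> (forall n, - m < n -> b n = 0) ->
  forall J1 J2, J2 < m -> kernelFG r1 r2 F G J1 J2 = 0.
Proof.
move=> [F1 F2] [G1 G2] Sr1 Sr2 lt b0 J1 J2.
have [r10 Fr] := F1 _ Sr1; have [r20 Gr] := G1 _ Sr2.
have r12 : r1 != r2 by rewrite lt_eqF.
apply: decay_down_eq0; first exact: kernelFG_decay_down.
by move=> K1 K2 mK; rewrite kernelFG_shift// (G2 r2)// b0 ?mulr0 ?addr0 ?subrK//; lia.
Qed.

Section Jump.
Variables (S : R -> Prop) (lo hi : R).
Hypotheses (Slo : S lo) (Shi : S hi) (lohi : lo < hi).

(** Plays the role of the residue at [z = w]. *)
Definition jump : (C -> C) -> (C -> C) -> int -> int -> C :=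
  locked_with jump_key (fun F G J1 J2 => kernelFG hi lo F G J1 J2 - kernelFG lo hi F G J1 J2).

Lemma jumpE F G J1 J2 : jump F G J1 J2 = kernelFG hi lo F G J1 J2 - kernelFG lo hi F G J1 J2.
Proof. by rewrite /jump unlock. Qed.

(** The product term of [kernelFG_shift] depends only on Laurent coefficients, so it is the same for
    both orders of the radii and cancels. *)
Lemma jump_diag F G a b J1 J2 : laurent S F a -> laurent S G b ->
  jump F G (J1 - 1) J2 = jump F G J1 (J2 + 1).
Proof.
move=> [F1 F2] [G1 G2].
have [lo0 Fl] := F1 _ Slo; have [hi0 Fh] := F1 _ Shi.
have [_ Gl] := G1 _ Slo; have [_ Gh] := G1 _ Shi.
have n1 : lo != hi by rewrite lt_eqF.
have n2 : hi != lo by rewrite gt_eqF.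
have e1 := kernelFG_shift hi0 lo0 n2 Fh Gl J1 J2.
have e2 := kernelFG_shift lo0 hi0 n1 Fl Gh J1 J2.
rewrite !jumpE e1 e2 (F2 _ _ Slo) (F2 _ _ Shi) (G2 _ _ Slo) (G2 _ _ Shi).
by rewrite opprD addrACA subrr addr0.
Qed.

(** By [jump_diag], multiplying by [z] and multiplying by [w] have the same effect on the jump; a
    factor may thus pass from [G] to [F]. *)
Lemma jump_facP F G a b x J1 J2 : laurent S F a -> laurent S G b ->
  jump F (fun w => G w * facP x w) J1 J2 = jump (fun w => F w * facP x w) G J1 J2.
Proof.
move=> lF lG; have e := jump_diag J1 J2 lF lG.
have [[F1 F2] [G1 G2]] := (lF, lG).
have [lo0 Fl] := F1 _ Slo; have [hi0 Fh] := F1 _ Shi.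
have [_ Gl] := G1 _ Slo; have [_ Gh] := G1 _ Shi.
have n1 : lo != hi by rewrite lt_eqF.
have n2 : hi != lo by rewrite gt_eqF.
have e1 := kernelFG_facP_r hi0 lo0 n2 Fh Gl x J1 J2.
have e2 := kernelFG_facP_r lo0 hi0 n1 Fl Gh x J1 J2.
have e3 := kernelFG_facP_l hi0 lo0 n2 Fh Gl x J1 J2.
have e4 := kernelFG_facP_l lo0 hi0 n1 Fl Gh x J1 J2.
rewrite !jumpE e1 e2 e3 e4.
transitivity (jump F G J1 J2 - x%:C * jump F G J1 (J2 + 1)); first by rewrite !jumpE; ring.
by rewrite -e !jumpE; ring.
Qed.

Lemma jump_facM F G a b x J1 J2 : laurent S F a -> laurent S G b ->
  jump F (fun w => G w * facM x w) J1 J2 = jump (fun w => F w * facM x w) G J1 J2.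
Proof.
move=> lF lG; have e := jump_diag (J1 + 1) (J2 - 1) lF lG.
have [[F1 F2] [G1 G2]] := (lF, lG).
have [lo0 Fl] := F1 _ Slo; have [hi0 Fh] := F1 _ Shi.
have [_ Gl] := G1 _ Slo; have [_ Gh] := G1 _ Shi.
have n1 : lo != hi by rewrite lt_eqF.
have n2 : hi != lo by rewrite gt_eqF.
rewrite addrK subrK in e.
have e1 := kernelFG_facM_r hi0 lo0 n2 Fh Gl x J1 J2.
have e2 := kernelFG_facM_r lo0 hi0 n1 Fl Gh x J1 J2.
have e3 := kernelFG_facM_l hi0 lo0 n2 Fh Gl x J1 J2.
have e4 := kernelFG_facM_l lo0 hi0 n1 Fl Gh x J1 J2.
rewrite !jumpE e1 e2 e3 e4.
transitivity (jump F G J1 J2 - x%:C * jump F G J1 (J2 - 1)); first by rewrite !jumpE; ring.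
by rewrite e !jumpE; ring.
Qed.

Lemma jump1 J1 J2 : (forall r, S r -> 0 < r) -> jump (fun=> 1) (fun=> 1) J1 J2 = (J1 == J2)%:R.
Proof.
move=> S0; have l1 := laurent1 S0.
have lo0 := S0 _ Slo; have hi0 := S0 _ Shi.
have n1 : lo != hi by rewrite lt_eqF.
have n2 : hi != lo by rewrite gt_eqF.
have diag (k : nat) K1 K2 : jump (fun=> 1) (fun=> 1) (K1 + k%:Z) (K2 + k%:Z) = jump (fun=> 1) (fun=> 1) K1 K2.
  elim: k => [|k <-]; first by rewrite !addr0.
  have -> : K2 + k.+1%:Z = (K2 + k%:Z) + 1 by lia.
  have := jump_diag (K1 + k.+1%:Z) (K2 + k%:Z) l1 l1.
  by have -> : K1 + k.+1%:Z - 1 = K1 + k%:Z by lia.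
have E0 K : jump (fun=> 1) (fun=> 1) K 0 = (K == 0)%:R.
  rewrite !jumpE (kernelFG_up_eq0 (m := 0) l1 l1)//; last by move=> n n0; case: eqVneq => //; lia.
  have c1 r := circle_cont_cst r (1 : C).
  (* Across [J2 = -1]: the kernel with [lo] inside vanishes at [-1], so its value at [0] is minus
     the product of coefficients, which is the delta. *)
  have := kernelFG_shift lo0 hi0 n1 (c1 lo) (c1 hi) K (-1).
  rewrite (kernelFG_down_eq0 (m := 0) l1 l1)//; last by move=> n n0; case: eqVneq => //; lia.
  rewrite !(proj2 l1)// addNr opprK subrr eqxx mulr1 => /eqP.
  by rewrite eq_sym addr_eq0 => /eqP ->; rewrite sub0r opprK.
have [J20|J20] := leP 0 J2.
  have -> : J2 = 0 + `|J2|%N%:Z by lia.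
  have -> : J1 = (J1 - J2) + `|J2|%N%:Z by lia.
  rewrite diag E0; congr (_%:R); lia.
rewrite -(diag `|J2|%N).
have -> : J2 + `|J2|%N%:Z = 0 by lia.
by rewrite E0; congr (_%:R); lia.
Qed.

Lemma eq_jump F F' G G' J1 J2 : (forall r y, S r -> F (circ r y) = F' (circ r y)) ->
  (forall r y, S r -> G (circ r y) = G' (circ r y)) -> jump F G J1 J2 = jump F' G' J1 J2.
Proof.
by move=> Phi_z Phi_w; rewrite !jumpE; congr (_ - _); apply: eq_kernelFG => y; (exact: Phi_z || exact: Phi_w).
Qed.

(** The two functions are mutually inverse. Moving the factors of the second one by one to the first
    cancels them, down to [jump1]. *)
Lemma jump_delta la lb J1 J2 : (forall r, S r -> 0 < r) ->
  (forall x, x \in la -> 0 <= x) -> (forall r x, S r -> x \in la -> x * r < 1) ->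
  (forall x, x \in lb -> 0 <= x) -> (forall r x, S r -> x \in lb -> x < r) ->
  jump (fun z => prodM lb z / prodP la z) (fun w => prodP la w / prodM lb w) J1 J2 = (J1 == J2)%:R.
Proof.
move=> S0.
have ext F F' G G' : (forall r y, S r -> F (circ r y) = F' (circ r y)) ->
    (forall r y, S r -> G (circ r y) = G' (circ r y)) -> jump F G J1 J2 = jump F' G' J1 J2.
  exact: eq_jump.
elim: la => [|x la IH].
  move=> _ _; elim: lb => [|x lb IH] lb0 lbS.
    rewrite -(jump1 _ _ S0); apply: ext => r y _;
      by rewrite /prodM /prodP !big_nil divr1.
  have [||a lF _] := @laurent_ratio_MP R S lo Slo [::] lb S0; [by []|by []|].
  have [||b lG _] := @laurent_ratio_PM R S lo Slo [::] (x :: lb) S0; [by []|by []|].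
  have Mf0 r y : S r -> facM x (circ r y) != 0.
    by move=> Sr; apply: facM_neq0; [exact/lb0/mem_head|apply: lbS => //; exact: mem_head].
  rewrite -{}IH.
  - rewrite -(ext (fun w => prodM lb w / prodP [::] w * facM x w) _ (fun w => prodP [::] w / prodM (x :: lb) w)) => //.
    + rewrite -(jump_facM _ _ _ lF lG); apply: ext => // r y Sr.
      by rewrite [prodM (x :: lb) _]big_cons invfM mulrA mulrAC divfK ?Mf0.
    + by move=> r y Sr; rewrite [in RHS]/prodM big_cons -/(prodM lb _); ring.
  - by move=> z zl; rewrite lb0// inE zl orbT.
  - by move=> r z Sr zl; rewrite lbS// inE zl orbT.
move=> la0 laS lb0 lbS.
have la0' z : z \in la -> 0 <= z by move=> zl; rewrite la0// inE zl orbT.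
have laS' r z : S r -> z \in la -> z * r < 1 by move=> Sr zl; rewrite laS// inE zl orbT.
have [||a lF _] := @laurent_ratio_MP R S lo Slo (x :: la) lb S0; [by []|by []|].
have [||b lG _] := @laurent_ratio_PM R S lo Slo la lb S0; [by []|by []|].
have Pf0 r y : S r -> facP x (circ r y) != 0.
  by move=> Sr; apply: facP_neq0; [exact: S0|exact/la0/mem_head|apply: laS => //; exact: mem_head].
rewrite -{}IH//.
rewrite -(ext (fun w => prodM lb w / prodP (x :: la) w) _ (fun w => prodP la w / prodM lb w * facP x w)) => //.
  rewrite (jump_facP _ _ _ lF lG); apply: ext => // r y Sr.
  by rewrite {1}/prodP big_cons invfM -/(prodP la _) mulrA mulrAC divfK ?Pf0.
by move=> r y Sr; rewrite [in RHS]/prodP big_cons -/(prodP la _); ring.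
Qed.

End Jump.
End KernelMoments.

Lemma mem_irange (a b k : int) : (k \in irange a b) = (a <= k < b).
Proof.
rewrite /irange; case: ifP => ab; last by rewrite in_nil; lia.
apply/mapP/idP => [|kab]; first by case=> i; rewrite mem_iota => ? ->; lia.
by exists (absz (k - a)%R); [rewrite mem_iota|]; lia.
Qed.

Lemma uniq_irange (a b : int) : uniq (irange a b).
Proof.
rewrite /irange; case: ifP => // _; rewrite map_inj_uniq ?iota_uniq//.
by move=> i j; lia.
Qed.

Lemma irange_rcons (a b : int) : a <= b -> irange a (b + 1) = rcons (irange a b) b.
Proof.
move=> ab; rewrite /irange ab ifT; last by lia.
have -> : absz (b + 1 - a)%R = (absz (b - a)%R).+1 by lia.
rewrite -addn1 iotaD map_cat /= cats1; congr rcons; lia.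
Qed.

Lemma irange_nil (a b : int) : b <= a -> irange a b = [::].
Proof.
move=> ba; rewrite /irange; case: ifP => // ab.
by have -> : absz (b - a)%R = 0 by lia.
Qed.

(** * The correlation kernel *)

Fact canon_kernel_key : unit. Proof. by []. Qed.

Section Setting.
Variables (R : realType) (N : nat) (u v : nat -> int) (q : int -> R).
Hypothesis hN : (1 <= N)%N.
Hypothesis huv : forall i : nat, (i < N)%N -> u i < v i.+1 < u i.+1.
Hypothesis hq : forall t : int, u 0%N < t < u N -> 0 < q t < 1.
Local Notation Dp := (inDplus N u v).
Local Notation Dm := (inDminus N u v).
Local Notation xp := (xplus u q).
Local Notation xm := (xminus u q).

Lemma u_mono (i j : nat) : (i <= j <= N)%N -> u i <= u j.
Proof.
elim: j => [|j IH] /andP[ij jN]; first by have -> : i = 0 by lia.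
have [->//|ij'] := eqVneq i j.+1.
have h1 := IH ltac:(lia); have h2 := huv jN; lia.
Qed.

Lemma u0_lt_uN : u 0 < u N.
Proof. by have := huv hN; have := @u_mono 1 N; lia. Qed.

(** The intervals [[u i, v i.+1)] and [[v i.+1, u i.+1)] tile [[u 0, u N)]. *)
Lemma inDplusE (k : int) : u 0%N <= k < u N -> Dp k = ~~ Dm k.
Proof.
move=> kuN; have [i iN /andP[k1 k2]] : exists2 i, (i < N)%N & u i <= k < u i.+1.
  have : forall n, (n <= N)%N -> k < u n -> exists2 i, (i < n)%N & u i <= k < u i.+1.
    elim=> [|n IH] nN kn; first lia.
    have [h|h] := ltP k (u n); last by exists n => //; lia.
    by have [||i iN ?] := IH; [lia|lia|exists i => //; lia].
  by move=> /(_ N (leqnn N)) [|i]; [lia|exists i].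
have Dpi : v i.+1 <= k -> Dp k by move=> h; apply/existsP; exists (Ordinal iN); rewrite /=; lia.
have Dmi : k < v i.+1 -> Dm k by move=> h; apply/existsP; exists (Ordinal iN); rewrite /=; lia.
have excl : Dp k -> Dm k -> False.
  move=> /existsP[a /andP[a1 a2]] /existsP[b /andP[b1 b2]].
  have := huv (ltn_ord a); have := huv (ltn_ord b).
  have [ab|ab] := ltnP a b; first by have := @u_mono a.+1 b; have := ltn_ord b; lia.
  have [ab'|ab'] := ltnP b a; first by have := @u_mono b.+1 a; have := ltn_ord a; lia.
  have eab : a = b by apply/val_inj; rewrite /=; lia.
  by rewrite eab in a1; lia.
have [h|h] := ltP k (v i.+1).
  by rewrite (Dmi h); case Dk : (Dp k) => //; have := excl Dk (Dmi h).
by rewrite (Dpi h); case Dk : (Dm k) => //; have := excl (Dpi h) Dk.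
Qed.

Lemma xplus_u0 : xp (u 0) = 1.
Proof. by rewrite /xplus irange_nil ?big_nil//; lia. Qed.

Lemma xplusS (k : int) : u 0%N <= k -> xp (k + 1) = xp k * q (k + 1).
Proof. by move=> uk; rewrite /xplus irange_rcons; [rewrite -cats1 big_cat big_seq1|lia]. Qed.

Lemma xplus_gt0 (k : int) : u 0%N <= k < u N -> 0 < xp k.
Proof.
move=> uk; rewrite /xplus big_seq; apply: prodr_gt0 => t.
by rewrite mem_irange => tk; have /andP[] : 0 < q t < 1 by apply: hq; lia.
Qed.

Lemma xplus_decr (k k' : int) : u 0%N <= k -> k < k' -> k' < u N -> xp k' < xp k.
Proof.
move=> uk kk'; have -> : k' = k + 1 + (absz (k' - (k + 1))%R)%:Z by lia.
elim: (absz _) => [|n IH] kN.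
  have /andP[q0 q1] : 0 < q (k + 1) < 1 by apply: hq; lia.
  by rewrite addr0 xplusS// gtr_pMr// xplus_gt0//; lia.
apply: lt_trans (IH _); last by lia.
have -> : k + 1 + n.+1%:Z = k + 1 + n%:Z + 1 by lia.
have /andP[q0 q1] : 0 < q (k + 1 + n%:Z + 1) < 1 by apply: hq; lia.
rewrite xplusS; last by lia.
by rewrite gtr_pMr// xplus_gt0//; lia.
Qed.

Definition plus_pts (t : int) : seq R := [seq xp k | k <- irange (u 0) (u N) & Dp k && (t <= k)].
Definition minus_pts (t : int) : seq R := [seq xm k | k <- irange (u 0) (u N) & Dm k && (k < t)].

Lemma mem_plus_pts x t : reflect (exists2 k : int, [/\ u 0%N <= k < u N, Dp k & t <= k] & x = xp k) (x \in plus_pts t).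
Proof.
apply: (iffP mapP) => -[k]; first by rewrite mem_filter mem_irange => /andP[/andP[? ?] ?] ->; exists k.
by case=> ? ? ? ->; exists k => //; rewrite mem_filter mem_irange; apply/andP; split => //; apply/andP.
Qed.

Lemma mem_minus_pts x t : reflect (exists2 k : int, [/\ u 0%N <= k < u N, Dm k & k < t] & x = xm k) (x \in minus_pts t).
Proof.
apply: (iffP mapP) => -[k]; first by rewrite mem_filter mem_irange => /andP[/andP[? ?] ?] ->; exists k.
by case=> ? ? ? ->; exists k => //; rewrite mem_filter mem_irange; apply/andP; split => //; apply/andP.
Qed.

Lemma plus_pts_gt0 x t : x \in plus_pts t -> 0 < x.
Proof. by move=> /mem_plus_pts[k [? _ _] ->]; exact: xplus_gt0. Qed.

Lemma minus_pts_gt0 x t : x \in minus_pts t -> 0 < x.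
Proof. by move=> /mem_minus_pts[k [? _ _] ->]; rewrite invr_gt0 xplus_gt0. Qed.

(** This is R*(t') < R(t): minus points come before [t'], plus points not before [t], and [xp]
    decreases. It leaves room for both circles in the case [t2 <= t1]. *)
Lemma minus_pts_plus_pts_lt (b x : R) (t t' : int) : t' <= t -> b \in minus_pts t' -> x \in plus_pts t -> b * x < 1.
Proof.
move=> tt' /mem_minus_pts[k [k1 k2 k3] ->] /mem_plus_pts[k' [k1' k2' k3'] ->].
by rewrite ltr_pdivrMl ?xplus_gt0// mulr1; apply: xplus_decr; lia.
Qed.

Lemma Phi_plusE z t : Phi_plus N u v q z t = prodP (plus_pts t) z.
Proof. by rewrite /prodP big_map big_filter. Qed.

Lemma Phi_minusE z t : Phi_minus N u v q z t = prodM (minus_pts t) z.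
Proof. by rewrite /prodM big_map big_filter. Qed.

(** Written as [x * r < 1], the condition needs no infinite radius when there are no points. *)
Definition adm_z (t : int) (r : R) := 0 < r /\ forall x, x \in plus_pts t -> x * r < 1.
Definition adm_w (t : int) (r : R) := 0 < r /\ forall b, b \in minus_pts t -> b < r.

Lemma lt_bigmin_seq (I : Type) (s : seq I) (P : pred I) (F : I -> R) (r : R) :
  (r%:E < \big[Order.min/+oo%E]_(i <- s | P i) (F i)%:E)%E =
  all (fun i => P i ==> (r < F i)) s.
Proof.
elim: s => [|i s IH]; first by rewrite big_nil ltry.
by rewrite big_cons /=; case: (P i) => //=; rewrite lt_min lte_fin IH.
Qed.

Lemma bigmax_lt_seq (I : Type) (s : seq I) (P : pred I) (F : I -> R) (r : R) :
  (\big[Num.max/0]_(i <- s | P i) F i < r) = (0 < r) && all (fun i => P i ==> (F i < r)) s.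
Proof.
elim: s => [|i s IH]; first by rewrite big_nil andbT.
by rewrite big_cons /=; case: (P i) => //=; rewrite gt_max IH andbCA.
Qed.

Lemma admissibleP t1 t2 r1 r2 : admissible_radii N u v q t1 t2 r1 r2 <->
  [/\ adm_z t1 r1, adm_w t2 r2 & if t2 <= t1 then r2 < r1 else r1 < r2].
Proof.
rewrite /admissible_radii /Rrad /Rstar lt_bigmin_seq bigmax_lt_seq.
split=> [[r10 [/allP h1 [/andP[r20 /allP h2] h3]]]|[[r10 h1] [r20 h2] h3]]; split=> //.
- split=> // x /mem_plus_pts[k [k1 k2 k3] ->].
  have := h1 k; rewrite mem_irange k1 k2 k3 /= => /(_ isT) h.
  by rewrite mulrC -ltr_pdivlMr ?xplus_gt0// div1r.
- split=> // x /mem_minus_pts[k [k1 k2 k3] ->].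
  by have := h2 k; rewrite mem_irange k1 k2 k3 /= => /(_ isT).
split.
  apply/allP => k; rewrite mem_irange => k1; apply/implyP => /andP[k2 k3].
  by rewrite -div1r ltr_pdivlMr ?xplus_gt0// mulrC; apply: h1; apply/mem_plus_pts; exists k.
split=> //; rewrite r20 /=.
apply/allP => k; rewrite mem_irange => k1; apply/implyP => /andP[k2 k3].
by apply: h2; apply/mem_minus_pts; exists k.
Qed.

Lemma between_seq (A B : seq R) : (forall a, a \in A -> 0 <= a) -> (forall b, b \in B -> 0 < b) ->
  (forall a b, a \in A -> b \in B -> a < b) ->
  exists r, [/\ 0 < r, forall a, a \in A -> a < r & forall b, b \in B -> r < b].
Proof.
move=> A0 B0 AB.
pose al := \big[Num.max/0]_(a <- A) a.
have al0 : 0 <= al by rewrite /al; elim: (A) => [|a l IH]; rewrite ?big_nil// big_cons le_max IH orbT.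
have alA a : a \in A -> a <= al.
  rewrite /al; elim: (A) => [//|c l IH]; rewrite inE big_cons le_max => /orP[/eqP->|/IH ->]; rewrite ?lexx ?orbT//.
have alB b : b \in B -> al < b.
  move=> bB; rewrite bigmax_lt_seq B0//=; apply/allP => a aA.
  exact: AB.
have [be [be1 be2]] : exists be, al < be /\ forall b, b \in B -> be <= b.
  (* The default [al + 1] only keeps the bound above [al] when [B] is empty. *)
  exists (\big[Num.min/(al + 1)]_(b <- B) b); split.
    elim: (B) alB => [_|b l IH lB]; first by rewrite big_nil; lra.
    rewrite big_cons lt_min lB ?mem_head//= IH// => c cl; apply: lB.
    by rewrite inE cl orbT.
  elim: (B) => [//|c l IH] b; rewrite inE big_cons ge_min => /orP[/eqP->|/IH ->]; rewrite ?lexx ?orbT//.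
exists ((al + be) / 2); split; first lra.
  by move=> a /alA; lra.
by move=> b /be2; lra.
Qed.

(** The extra bound on the radius of [w] is what yields the decay in [canon_kernel_decay]. *)
Lemma exists_admissible_lt (t1 t2 : int) (y : R) : 0 < y -> (forall b, b \in minus_pts t2 -> b < y) ->
  exists r1 r2, admissible_radii N u v q t1 t2 r1 r2 /\ r2 < y.
Proof.
move=> y0 yLM.
have inv0 b : b \in [seq x^-1 | x <- plus_pts t1] -> 0 < b.
  by move=> /mapP[x xl ->]; rewrite invr_gt0 (plus_pts_gt0 xl).
have invE x r : x \in plus_pts t1 -> r < x^-1 -> x * r < 1.
  by move=> xl; rewrite -div1r ltr_pdivlMr ?(plus_pts_gt0 xl)// mulrC.
have [t21|t12] := leP t2 t1.
  have [|||r2 [r20 r2A r2B]] := @between_seq (minus_pts t2) (y :: [seq x^-1 | x <- plus_pts t1]).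
  - by move=> a /minus_pts_gt0/ltW.
  - by move=> b; rewrite inE => /orP[/eqP->//|]; exact: inv0.
  - move=> a b aA; rewrite inE => /orP[/eqP->|/mapP[x xl ->]]; first exact: yLM.
    by rewrite -div1r ltr_pdivlMr ?(plus_pts_gt0 xl)//; exact: minus_pts_plus_pts_lt aA xl.
  have [|||r1 [r10 r1A r1B]] := @between_seq [:: r2] [seq x^-1 | x <- plus_pts t1].
  - by move=> a; rewrite inE => /eqP ->; exact: ltW.
  - exact: inv0.
  - by move=> a b; rewrite inE => /eqP -> bl; apply: r2B; rewrite inE bl orbT.
  exists r1, r2; split; last by apply: r2B; exact: mem_head.
  apply/admissibleP; rewrite t21; split; last by apply: r1A; exact: mem_head.
    by split=> // x xl; apply: invE => //; apply: r1B; exact: map_f.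
  by split.
have [|||r2 [r20 r2A r2B]] := @between_seq (minus_pts t2) [:: y].
- by move=> a /minus_pts_gt0/ltW.
- by move=> b; rewrite inE => /eqP ->.
- by move=> a b aA; rewrite inE => /eqP ->; exact: yLM.
have [|||r1 [r10 r1A r1B]] := @between_seq [::] (r2 :: [seq x^-1 | x <- plus_pts t1]).
- by [].
- by move=> b; rewrite inE => /orP[/eqP->//|]; exact: inv0.
- by [].
exists r1, r2; split; last by apply: r2B; exact: mem_head.
apply/admissibleP; rewrite leNgt t12 /=; split; last by apply: r1B; exact: mem_head.
  by split=> // x xl; apply: invE => //; apply: r1B; rewrite inE map_f ?orbT.
by split.
Qed.

Lemma exists_admissible (t1 t2 : int) : exists r1 r2, admissible_radii N u v q t1 t2 r1 r2.
Proof.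
have [|||y [y0 yA _]] := @between_seq (minus_pts t2) [::]; [by move=> a /minus_pts_gt0/ltW|by []|by []|].
by have [r1 [r2 [h _]]] := exists_admissible_lt t1 y0 yA; exists r1, r2.
Qed.

(** At equal times [Phi_z] and [Phi_w] are inverse to each other wherever their factors do not
    vanish; hence the jump is a pure delta. *)
Definition Phi_z (t : int) (z : R[i]) := prodM (minus_pts t) z / prodP (plus_pts t) z.
Definition Phi_w (t : int) (w : R[i]) := prodP (plus_pts t) w / prodM (minus_pts t) w.

Lemma size_plus_pts t : ((size (plus_pts t))%:Z <= u N - u 0).
Proof.
rewrite size_map size_filter; have := count_size (fun k => Dp k && (t <= k)) (irange (u 0) (u N)).
have := u0_lt_uN; rewrite {2}/irange => h; rewrite ltW// size_map size_iota; lia.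
Qed.

Lemma laurent_Phi_z t (r : R) : adm_z t r -> exists a, laurent (adm_z t) (Phi_z t) a.
Proof.
move=> Sr; have [|||a h _] := @laurent_ratio_MP R (adm_z t) r Sr (plus_pts t) (minus_pts t).
- by move=> r' [].
- by move=> x /plus_pts_gt0/ltW.
- by move=> r' x [_ h]; exact: h.
by exists a.
Qed.

Lemma laurent_Phi_w t (r : R) : adm_w t r ->
  exists2 b, laurent (adm_w t) (Phi_w t) b & forall n, (size (plus_pts t))%:Z < n -> b n = 0.
Proof.
move=> Sr; apply: (laurent_ratio_PM Sr).
- by move=> r' [].
- by move=> x /minus_pts_gt0/ltW.
- by move=> r' x [_ h]; exact: h.
Qed.

Lemma corr_kernelE t1 J1 t2 J2 r1 r2 : admissible_radii N u v q t1 t2 r1 r2 ->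
  corr_kernel N u v q r1 r2 t1 J1 t2 J2 = kernelFG r1 r2 (Phi_z t1) (Phi_w t2) J1 J2.
Proof.
move=> /admissibleP[SF1 SG2 ord].
have [a [F1 _]] := laurent_Phi_z SF1; have [b [G1 _] _] := laurent_Phi_w SG2.
have [r10 Fc] := F1 _ SF1; have [r20 Gc] := G1 _ SG2.
have r12 : r1 != r2 by case: ifP ord => _ h; [rewrite gt_eqF|rewrite lt_eqF].
rewrite /corr_kernel.
have -> : (fun z => circle_integral r2 (fun w =>
    (Phi_minus N u v q z t1 * Phi_plus N u v q w t2) / (Phi_plus N u v q z t1 * Phi_minus N u v q w t2) *
      ((z ^ (- J1 - 1) * w ^ J2) / (z - w)))) =
  (fun z => circle_integral r2 (fun w => (Phi_z t1 z * z ^ (- J1 - 1)) * (Phi_w t2 w * w ^ J2) / (z - w))).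
  apply/funext => z; congr circle_integral; apply/funext => w.
  rewrite !Phi_plusE !Phi_minusE /Phi_z /Phi_w invfM; ring.
rewrite double_circle_integralE//; first last.
- by apply: circle_contM => //; exact: circle_contXz.
- by apply: circle_contM => //; exact: circle_contXz.
rewrite kernelFGE; apply: eq_cauchy_int => x; rewrite -mulrA [_ ^ _ * _]mulrC circM_Xz//.
by rewrite subrK.
Qed.

Local Notation adm := (admissible_radii N u v q).

Lemma prod_split (P P' : pred int) (F : int -> R[i]) (s a b : int) : a <= s < b ->
  P' s -> P s = false -> (forall k, k != s -> P k = P' k) ->
  \prod_(k <- irange a b | P' k) F k = F s * \prod_(k <- irange a b | P k) F k.
Proof.
move=> sab P's Ps PP'; rewrite big_mkcond [in RHS]big_mkcond.
have sr : s \in irange a b by rewrite mem_irange.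
rewrite (bigD1_seq s sr (uniq_irange a b))/= [in RHS](bigD1_seq s sr (uniq_irange a b))/= P's Ps mul1r.
by congr (_ * _); apply: eq_bigr => k ks; rewrite PP'.
Qed.

(** Going back across [s] adds a factor to the numerator if [s] is in D^+ and removes one from the
    denominator if [s] is in D^-; either way [Phi_w] gains one factor. *)
Lemma Phi_w_stepP (s : int) (w : R[i]) : u 0%N <= s < u N -> Dp s -> Phi_w s w = Phi_w (s + 1) w * facP (xp s) w.
Proof.
move=> us Ds; rewrite /Phi_w /prodP /prodM !big_map !big_filter.
rewrite (@prod_split (fun k => Dp k && (s + 1 <= k)) _ _ s)//; first last.
- by move=> k ks; congr (_ && _); lia.
- by apply/negbTE; rewrite negb_and; lia.
- by rewrite Ds /=; lia.
have -> : \prod_(k <- irange (u 0) (u N) | Dm k && (k < s + 1)) facM (xm k) w =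
          \prod_(k <- irange (u 0) (u N) | Dm k && (k < s)) facM (xm k) w.
  apply: eq_bigl => k; have [->|ks] := eqVneq k s; last by congr (_ && _); lia.
  by move: Ds; rewrite (inDplusE us) => /negbTE ->.
ring.
Qed.

Lemma Phi_w_stepM (s : int) (r y : R) : u 0%N <= s < u N -> Dm s -> adm_w (s + 1) r ->
  Phi_w s (circ r y) = Phi_w (s + 1) (circ r y) * facM (xm s) (circ r y).
Proof.
move=> us Ds [r0 rb]; have xl : xm s \in minus_pts (s + 1) by apply/mem_minus_pts; exists s => //; split=> //; lia.
have m0 : facM (xm s) (circ r y) != 0.
  by apply: facM_neq0; [rewrite ltW// (minus_pts_gt0 xl)|exact: rb].
rewrite /Phi_w /prodP /prodM !big_map !big_filter.
rewrite (@prod_split (fun k => Dm k && (k < s)) (fun k => Dm k && (k < s + 1)) _ s)//; first last.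
- by move=> k ks; congr (_ && _); lia.
- by apply/negbTE; rewrite negb_and; lia.
- by rewrite Ds /=; lia.
have -> : \prod_(k <- irange (u 0) (u N) | Dp k && (s + 1 <= k)) facP (xp k) (circ r y) =
          \prod_(k <- irange (u 0) (u N) | Dp k && (s <= k)) facP (xp k) (circ r y).
  apply: eq_bigl => k; have [->|ks] := eqVneq k s; last by congr (_ && _); lia.
  by rewrite (inDplusE us) Ds.
by rewrite invfM mulrA mulrAC divfK.
Qed.

Lemma adm_w_mono (s s' : int) r : s <= s' -> adm_w s' r -> adm_w s r.
Proof.
move=> ss [r0 h]; split=> // b /mem_minus_pts[k [k1 k2 k3] ->]; apply: h; apply/mem_minus_pts.
by exists k => //; split=> //; lia.
Qed.

Lemma Phi_z_cont t r : adm_z t r -> 0 < r /\ circle_cont r (Phi_z t).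
Proof. by move=> Sr; have [a [F1 _]] := laurent_Phi_z Sr; exact: F1. Qed.

Lemma Phi_w_cont t r : adm_w t r -> 0 < r /\ circle_cont r (Phi_w t).
Proof. by move=> Sr; have [b [G1 _] _] := laurent_Phi_w Sr; exact: G1. Qed.

Lemma kernelFG_stepP (t1 s J1 J : int) r1 r2 : u 0%N <= s < u N -> adm_z t1 r1 -> adm_w (s + 1) r2 -> r1 != r2 ->
  Dp s -> kernelFG r1 r2 (Phi_z t1) (Phi_w s) J1 J =
  kernelFG r1 r2 (Phi_z t1) (Phi_w (s + 1)) J1 J - (xp s)%:C * kernelFG r1 r2 (Phi_z t1) (Phi_w (s + 1)) J1 (J + 1).
Proof.
move=> us S1 S2 r12 Ds; have [r10 Fc] := Phi_z_cont S1; have [r20 Gc] := Phi_w_cont S2.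
have <- := kernelFG_facP_r r10 r20 r12 Fc Gc (xp s) J1 J.
by apply: eq_kernelFG => x //; exact: Phi_w_stepP.
Qed.

Lemma kernelFG_stepM (t1 s J1 J : int) r1 r2 : u 0%N <= s < u N -> adm_z t1 r1 -> adm_w (s + 1) r2 -> r1 != r2 ->
  Dm s -> kernelFG r1 r2 (Phi_z t1) (Phi_w s) J1 J =
  kernelFG r1 r2 (Phi_z t1) (Phi_w (s + 1)) J1 J - (xm s)%:C * kernelFG r1 r2 (Phi_z t1) (Phi_w (s + 1)) J1 (J - 1).
Proof.
move=> us S1 S2 r12 Ds; have [r10 Fc] := Phi_z_cont S1; have [r20 Gc] := Phi_w_cont S2.
have <- := kernelFG_facM_r r10 r20 r12 Fc Gc (xm s) J1 J.
by apply: eq_kernelFG => x //; exact: Phi_w_stepM.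
Qed.

Lemma corr_kernel_radii t1 t2 J1 J2 r1 r2 r1' r2' : adm t1 t2 r1 r2 -> adm t1 t2 r1' r2' ->
  corr_kernel N u v q r1 r2 t1 J1 t2 J2 = corr_kernel N u v q r1' r2' t1 J1 t2 J2.
Proof.
move=> h h'; rewrite !corr_kernelE//.
have /admissibleP[S1 S2 lt] := h; have /admissibleP[S1' S2' lt'] := h'.
have [a lF] := laurent_Phi_z S1; have [b lG _] := laurent_Phi_w S2.
by apply: (kernelFG_radii lF lG) => //; move: lt lt'; case: ifP => _; [left|right].
Qed.

(* The kernel for an arbitrary choice of admissible radii. *)
Definition canon_kernel : int -> int -> int -> int -> R[i] := locked_with canon_kernel_key (fun t1 J1 t2 J2 => xget 0
  [set k | exists r1 r2, adm t1 t2 r1 r2 /\ k = corr_kernel N u v q r1 r2 t1 J1 t2 J2]).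

Lemma canon_kernelE t1 J1 t2 J2 r1 r2 : adm t1 t2 r1 r2 ->
  corr_kernel N u v q r1 r2 t1 J1 t2 J2 = canon_kernel t1 J1 t2 J2.
Proof.
move=> h; rewrite /canon_kernel unlock; case: xgetP => [k _ [r1' [r2' [h' ->]]]|]; first exact: corr_kernel_radii.
by move=> /(_ (corr_kernel N u v q r1 r2 t1 J1 t2 J2)) []; exists r1, r2.
Qed.

Lemma canon_kernelFG t1 J1 t2 J2 r1 r2 : adm t1 t2 r1 r2 -> canon_kernel t1 J1 t2 J2 = kernelFG r1 r2 (Phi_z t1) (Phi_w t2) J1 J2.
Proof. by move=> h; rewrite -(canon_kernelE _ _ h) corr_kernelE. Qed.

(** No minus points precede [u 0], so [Phi_w] is a polynomial there, and the circle of [w] is the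
    inner one. *)
Lemma canon_kernel_init (t1 J1 J2 : int) : u 0%N < t1 -> 0 <= J2 -> canon_kernel t1 J1 (u 0) J2 = 0.
Proof.
move=> ut J20; have [r1 [r2 h]] := exists_admissible t1 (u 0); rewrite (canon_kernelFG _ _ h).
have /admissibleP[S1 S2] := h; rewrite ifT; last by lia.
move=> lt; have [a lF] := laurent_Phi_z S1.
have LM0 : minus_pts (u 0) = [::].
  case E : (minus_pts (u 0)) => [//|b l]; have : b \in minus_pts (u 0) by rewrite E mem_head.
  by move=> /mem_minus_pts[k [k1 _ k2]]; lia.
have [|c cG c0] := @laurent_prodP R (adm_w (u 0)) (plus_pts (u 0)); first by move=> r [].
apply: (kernelFG_up_eq0 (m := 0) lF (laurent_eq _ cG) S1 S2 lt) => //.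
by move=> r y _; rewrite /Phi_w LM0 /prodM big_nil divr1.
Qed.

(** At [u N] no plus points are left, so [Phi_w] has only nonpositive powers, and the circle of [w]
    is the outer one. The negative [J2] are the points of L for the empty partition. *)
Lemma canon_kernel_final (t1 J1 J2 : int) : t1 < u N -> J2 < 0 -> canon_kernel t1 J1 (u N) J2 = 0.
Proof.
move=> ut J20; have [r1 [r2 h]] := exists_admissible t1 (u N); rewrite (canon_kernelFG _ _ h).
have /admissibleP[S1 S2] := h; rewrite ifF; last by lia.
move=> lt; have [a lF] := laurent_Phi_z S1; have [b lG b0] := laurent_Phi_w S2.
have LP0 : plus_pts (u N) = [::].
  case E : (plus_pts (u N)) => [//|c l]; have : c \in plus_pts (u N) by rewrite E mem_head.
  by move=> /mem_plus_pts[k [k1 _ k2]]; lia.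
apply: (kernelFG_down_eq0 (m := 0) lF lG S1 S2 lt) => //.
by move=> n; rewrite oppr0 => n0; apply: b0; rewrite LP0.
Qed.

(** At equal times the kernel has [w] inside; subtracting the delta gives the integral with [z]
    inside, the order that belongs to later second times. *)
Lemma kernelFG_jump (t1 J1 J2 : int) r1 r2 : adm_z t1 r1 -> adm_w t1 r2 -> r1 < r2 ->
  canon_kernel t1 J1 t1 J2 - (J1 == J2)%:R = kernelFG r1 r2 (Phi_z t1) (Phi_w t1) J1 J2.
Proof.
move=> S1 S2 lt; have [hi [lo h]] := exists_admissible t1 t1; rewrite (canon_kernelFG _ _ h).
have /admissibleP[Shi Slo] := h; rewrite lexx => lohi.
have Shi' : adm_w t1 hi by split=> [|b bl]; [case: Shi|apply: lt_trans lohi; exact: (proj2 Slo)].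
have Slo' : adm_z t1 lo.
  split=> [|x xl]; first by case: Slo.
  by apply: le_lt_trans (proj2 Shi x xl); rewrite ler_pM2l ?(plus_pts_gt0 xl)// ltW.
have [a lF] := laurent_Phi_z S1; have [b lG b0] := laurent_Phi_w S2.
have -> : kernelFG r1 r2 (Phi_z t1) (Phi_w t1) J1 J2 = kernelFG lo hi (Phi_z t1) (Phi_w t1) J1 J2.
  by apply: (kernelFG_radii lF lG) => //; right.
have := @jump_delta R (fun r => adm_z t1 r /\ adm_w t1 r) lo hi (conj Slo' Slo) (conj Shi Shi') lohi (plus_pts t1) (minus_pts t1) J1 J2.
move=> <-; first by rewrite jumpE opprB addrCA subrr addr0.
- by move=> r [[]].
- by move=> x /plus_pts_gt0/ltW.
- by move=> r x [[_ h1] _]; exact: h1.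
- by move=> x /minus_pts_gt0/ltW.
- by move=> r x [_ [_ h1]]; exact: h1.
Qed.

(** Radii admissible for [s + 1] are admissible for [s] as well, except at [s = t1], where the
    required order flips. With the delta subtracted, one pair of circles serves both ends of every
    step. *)
Lemma canon_kernel_step_side (t1 s J1 J : int) : u 0%N <= s < u N -> exists r1 r2,
  [/\ adm_z t1 r1, adm_w (s + 1) r2, r1 != r2, canon_kernel t1 J1 (s + 1) =1 kernelFG r1 r2 (Phi_z t1) (Phi_w (s + 1)) J1 &
   canon_kernel t1 J1 s J - ((s == t1) && (J == J1))%:R = kernelFG r1 r2 (Phi_z t1) (Phi_w s) J1 J].
Proof.
move=> us; have [r1 [r2 h]] := exists_admissible t1 (s + 1).
have /admissibleP[S1 S2 ord] := h.
exists r1, r2; split=> //.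
- by move: ord; case: ifP => _ lt; [rewrite gt_eqF|rewrite lt_eqF].
- by move=> J'; exact: canon_kernelFG.
have S2' : adm_w s r2 by apply: adm_w_mono S2; lia.
have [st|st] := eqVneq s t1.
  rewrite st in S2' ord *; rewrite /= [J == J1]eq_sym; apply: kernelFG_jump => //.
  by move: ord; rewrite ifF//; lia.
rewrite subr0; apply: canon_kernelFG; apply/admissibleP; split=> //.
by move: ord; have -> : (s + 1 <= t1) = (s <= t1) by lia.
Qed.

Lemma canon_kernel_stepP (t1 s J1 J : int) : u 0%N <= s < u N -> Dp s ->
  canon_kernel t1 J1 (s + 1) J - (xp s)%:C * canon_kernel t1 J1 (s + 1) (J + 1) =
  canon_kernel t1 J1 s J - ((s == t1) && (J == J1))%:R.
Proof.
move=> us Ds; have [r1 [r2 [S1 S2 r12 e1 e2]]] := canon_kernel_step_side t1 J1 J us.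
by rewrite e2 (kernelFG_stepP _ _ us S1 S2 r12 Ds) !e1.
Qed.

Lemma canon_kernel_stepM (t1 s J1 J : int) : u 0%N <= s < u N -> Dm s ->
  canon_kernel t1 J1 (s + 1) J - (xm s)%:C * canon_kernel t1 J1 (s + 1) (J - 1) =
  canon_kernel t1 J1 s J - ((s == t1) && (J == J1))%:R.
Proof.
move=> us Ds; have [r1 [r2 [S1 S2 r12 e1 e2]]] := canon_kernel_step_side t1 J1 J us.
by rewrite e2 (kernelFG_stepM _ _ us S1 S2 r12 Ds) !e1.
Qed.

(** The degree of [Phi_w s] is at most the number of plus points, hence at most [u N - u 0]. *)
Lemma canon_kernel_far_after (t1 s J1 J : int) : u 0%N <= s <= u N -> t1 < s -> J < u 0%N - u N ->
  canon_kernel t1 J1 s J = 0.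
Proof.
move=> us ts JT; have [r1 [r2 h]] := exists_admissible t1 s; rewrite (canon_kernelFG _ _ h).
have /admissibleP[S1 S2] := h; rewrite ifF; last by lia.
move=> lt; have [a lF] := laurent_Phi_z S1; have [b lG b0] := laurent_Phi_w S2.
apply: (kernelFG_down_eq0 (m := u 0 - u N) lF lG S1 S2 lt) => //.
move=> n n0; apply: b0; have := size_plus_pts s; lia.
Qed.

(** The vanishing is carried backwards in time by the recursion. Each step looks one position aside,
    which accounts for the margin [d]; [J + d < J1] keeps the delta out of reach. *)
Lemma canon_kernel_far_before (t1 J1 J : int) (d : nat) : t1 < u N -> u 0%N <= t1 - d%:Z -> J < u 0%N - u N - d%:Z ->
  J + d%:Z < J1 -> canon_kernel t1 J1 (t1 - d%:Z) J = 0.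
Proof.
elim: d J => [|d IH] J tN td JT JJ1.
  rewrite subr0; have us : u 0 <= t1 < u N by lia.
  have [r1 [r2 [S1 S2 r12 e1 e2]]] := canon_kernel_step_side t1 J1 J us.
  have : canon_kernel t1 J1 t1 J - ((t1 == t1) && (J == J1))%:R = 0.
    have [Ds|Dn] := boolP (Dm t1).
      by rewrite -canon_kernel_stepM// !canon_kernel_far_after ?mulr0 ?subr0//; lia.
    rewrite -canon_kernel_stepP ?(inDplusE us)//.
    (* The neighbour [J + 1] may lie just outside [canon_kernel_far_after]. The two terms are
       instead recombined into one integral with [Phi_w t1], whose degree is bounded in the same
       way. *)
    have [r1' [r2' h]] := exists_admissible t1 (t1 + 1).
    have /admissibleP[S1' S2'] := h; rewrite ifF; last by lia.
    move=> lt; rewrite !(canon_kernelFG _ _ h).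
    have S2t : adm_w t1 r2' by apply: adm_w_mono S2'; lia.
    have Dt : Dp t1 by rewrite (inDplusE us).
    rewrite -(kernelFG_stepP _ _ us S1' S2' _ Dt); last by rewrite lt_eqF.
    have [a lF] := laurent_Phi_z S1'; have [b lG b0] := laurent_Phi_w S2t.
    apply: (kernelFG_down_eq0 (m := u 0 - u N) lF lG S1' S2t lt); last by lia.
    move=> n n0; apply: b0; have := size_plus_pts t1; lia.
  have ne : (J == J1) = false.
    by apply/negbTE/eqP => JE; move: JJ1; rewrite JE; lia.
  rewrite ne andbF.
  by rewrite subr0.
have us : u 0 <= t1 - d.+1%:Z < u N by lia.
have e : t1 - d.+1%:Z + 1 = t1 - d%:Z by lia.
have ne : (t1 - d.+1%:Z == t1) = false by lia.
have [Ds|Dn] := boolP (Dm (t1 - d.+1%:Z)).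
  have := canon_kernel_stepM t1 J1 J us Ds; rewrite e ne /= subr0 => <-.
  have z1 : canon_kernel t1 J1 (t1 - d%:Z) J = 0 by apply: IH; lia.
  have z2 : canon_kernel t1 J1 (t1 - d%:Z) (J - 1) = 0 by apply: IH; lia.
  by rewrite z1 z2 mulr0 subr0.
have Ds : Dp (t1 - d.+1%:Z) by rewrite (inDplusE us).
have := canon_kernel_stepP t1 J1 J us Ds; rewrite e ne /= subr0 => <-.
have z1 : canon_kernel t1 J1 (t1 - d%:Z) J = 0 by apply: IH; lia.
have z2 : canon_kernel t1 J1 (t1 - d%:Z) (J + 1) = 0 by apply: IH; lia.
by rewrite z1 z2 mulr0 subr0.
Qed.

(** As [s] is in D^+, all minus points at time [s + 1] are below [1 / xp s], so the circle of [w]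
    can be taken with [xp s * r2 < 1]. *)
Lemma canon_kernel_decay (t1 s J1 : int) : u 0%N <= s < u N -> Dp s -> exists B r, 0 < r < 1 /\
  forall J : int, normc ((xp s)%:C ^ J * canon_kernel t1 J1 (s + 1) J) <= B * r ^ J.
Proof.
move=> us Ds; have x0 := xplus_gt0 us.
have [||r1 [r2 [h r2x]]] := @exists_admissible_lt t1 (s + 1) (xp s)^-1.
- by rewrite invr_gt0.
- move=> b /mem_minus_pts[k [k1 k2 k3] ->]; rewrite ltf_pV2 ?posrE ?xplus_gt0//.
  apply: xplus_decr => //; [lia| |lia].
  have [ks|//] := eqVneq k s; last by lia.
  by move: Ds; rewrite (inDplusE us) -ks k2.
have /admissibleP[S1 S2 ord] := h.
have [r10 Fc] := Phi_z_cont S1; have [r20 Gc] := Phi_w_cont S2.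
have r12 : r1 != r2 by move: ord; case: ifP => _ lt; [rewrite gt_eqF|rewrite lt_eqF].
have [B B0 HB] := kernelFG_bound r10 r20 r12 Fc Gc.
exists (B * r1 ^ (- J1)), (xp s * r2); split.
  rewrite mulr_gt0//=.
  by rewrite mulrC -ltr_pdivlMr// div1r.
move=> J; rewrite (canon_kernelFG _ _ h) normcM normcXz normc_real gtr0_norm//.
apply: le_trans (ler_wpM2l _ (HB J1 J)) _; first by rewrite exprz_ge0// ltW.
rewrite exprzMl ?unitfE ?gt_eqF//.
by rewrite le_eqVlt; apply/orP; left; apply/eqP; ring.
Qed.

End Setting.

(** * One interlacing step *)

Section SummationLemmas.
Variable R : realType.

Lemma esumZl (T : choiceType) (I : set T) (c : R) (a : T -> \bar R) : (0 <= c)%R ->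
  (forall i, 0 <= a i)%E -> (\esum_(i in I) (c%:E * a i) = c%:E * \esum_(i in I) a i)%E.
Proof.
move=> c0 a0; rewrite /esum -ereal_supZl//; last first.
  by apply/set0P; exists (\sum_(x \in set0) a x)%E; exists set0 => //; exact: fsets_set0.
congr ereal_sup; rewrite image_comp; apply/eq_imagel => X _ /=.
by rewrite ge0_mule_fsumr.
Qed.

Lemma esum_nat_lim (P : pred nat) (f : nat -> R) (l : R) : (forall c, P c -> 0 <= f c) ->
  (\sum_(0 <= c < n | P c) f c) @[n --> \oo] --> l ->
  \esum_(c in [set c | P c]) (f c)%:E = l%:E.
Proof.
move=> f0 fl; rewrite -nneseries_esum; last by move=> n /f0; rewrite lee_fin.
apply/cvg_lim => //; under eq_fun do rewrite sumEFin.
by apply: cvg_EFin => //; exact: nearW.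
Qed.

Definition box (m : nat) (I : nat -> pred nat) : set (seq nat) :=
  [set s | size s = m /\ forall k, (k < m)%N -> I k (nth 0%N s k)].

(** Distributivity over independent coordinates; [x] collects the factors of the entries already
    fixed, as the induction requires. *)
Lemma esum_box (m : nat) (I : nat -> pred nat) (F : nat -> nat -> R) (H : nat -> R) (x : R) :
  0 <= x -> (forall k c, 0 <= F k c) ->
  (forall k, (k < m)%N -> (\sum_(0 <= c < n | I k c) F k c) @[n --> \oo] --> H k) ->
  \esum_(s in box m I) (x * \prod_(k < m) F k (nth 0%N s k))%:E = (x * \prod_(k < m) H k)%:E.
Proof.
elim: m I F H x => [|m IH] I F H x x0 F0 FH.
  have -> : box 0 I = [set [::]].
    apply/seteqP; split=> s /=; first by case=> /size0nil.
    by move=> ->; split.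
  by rewrite esum_set1 !big_ord0// lee_fin mulr1.
pose I' k := I k.+1.
rewrite (@reindex_esum _ _ _ ([set c | I 0 c] `*`` (fun _ => box m I')) _ (fun p => p.1 :: p.2)); last first.
  split=> [[c s] /= [Ic [sm sI]]|[c s] [c' s'] _ _ /= [-> ->]//|s [sm sI]].
    by split=> /= [|[|k]]; [rewrite sm| |exact: sI].
  case: s sm sI => // c s [sm] sI; exists (c, s) => //=; split; first exact: (sI 0).
  by split=> // k km; exact: (sI k.+1).
rewrite -(@esum_esum _ _ _ _ _ (fun c s => (x * \prod_(k < m.+1) F k (nth 0%N (c :: s) k))%:E)); last first.
  by move=> c s _ _; rewrite lee_fin mulr_ge0// prodr_ge0.
transitivity (\esum_(c in [set c | I 0 c]) (x * (\prod_(k < m) H k.+1) * F 0 c)%:E).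
  apply: eq_esum => c Ic; under eq_esum do rewrite big_ord_recl /= mulrA.
  rewrite (IH I' (fun k => F k.+1) (fun k => H k.+1))//; first by congr (_%:E); ring.
    by rewrite mulr_ge0.
  by move=> k km; exact: (FH k.+1).
have H0 k : (k < m.+1)%N -> 0 <= H k.
  move=> km; have h := FH k km; rewrite -(cvg_lim _ h)//.
  apply: limr_ge; first by apply/cvg_ex; exists (H k).
  by apply: nearW => n; exact: sumr_ge0.
apply: esum_nat_lim.
  move=> c _; rewrite mulr_ge0// mulr_ge0// prodr_ge0// => k _.
  by apply: H0; have := ltn_ord k; lia.
have -> : x * \prod_(k < m.+1) H k = x * (\prod_(k < m) H k.+1) * H 0%N.
  by rewrite big_ord_recl [H ord0 * _]mulrC mulrA.
under eq_fun do rewrite -mulr_sumr.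
by apply: cvgM; [exact: cvg_cst|exact: (FH 0%N)].
Qed.

End SummationLemmas.

(** * Partitions versus sequences padded with zeros *)

Section Strip.

Definition strip (s : seq nat) := [seq x <- s | (0 < x)%N].

Lemma sorted_nth_le (s : seq nat) : sorted (fun a b => b <= a)%N s <->
  forall k, (nth 0%N s k.+1 <= nth 0%N s k)%N.
Proof.
split=> [/(sortedP 0%N) h k|h]; last by apply/(sortedP 0%N).
by have [/h//|sk] := ltnP k.+1 (size s); rewrite nth_default.
Qed.

Lemma nth_strip (s : seq nat) k : sorted (fun a b => b <= a)%N s -> nth 0%N (strip s) k = nth 0%N s k.
Proof.
elim: s k => [|a s IH] k //= ps; have ss := path_sorted ps.
case: ltnP => a0 /=; first by case: k => //= k; rewrite IH.
have tr : transitive (fun a b => b <= a)%N by move=> x y z h1 h2; exact: leq_trans h2 h1.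
have := order_path_min tr ps; move: a0; rewrite leqn0 => /eqP -> /allP s0.
rewrite IH//; have z j : nth 0%N s j = 0%N.
  have [js|js] := ltnP j (size s); last by rewrite nth_default.
  by have /= := s0 _ (mem_nth 0%N js); rewrite leqn0 => /eqP.
by rewrite z; case: k => //= k; rewrite z.
Qed.

Lemma is_partition_strip (s : seq nat) : sorted (fun a b => b <= a)%N s -> is_partition (strip s).
Proof.
move=> ss; rewrite /is_partition sorted_filter ?filter_all//.
by move=> x y z h1 h2; exact: leq_trans h2 h1.
Qed.

Lemma partition_eq (s s' : seq nat) : is_partition s -> is_partition s' ->
  (forall k, nth 0%N s k = nth 0%N s' k) -> s = s'.
Proof.
move=> /andP[_ /allP p1] /andP[_ /allP p2] e; apply: (@eq_from_nth _ 0%N) => [|k _]; last exact: e.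
apply/eqP; rewrite eqn_leq; apply/andP; split; rewrite leqNgt; apply/negP => lt.
  by have := p1 _ (mem_nth 0%N lt); rewrite e nth_default.
by have := p2 _ (mem_nth 0%N lt); rewrite -e nth_default.
Qed.

End Strip.

(** * Summing determinants over the predecessors of a partition *)

Section OneStep.
Variables (R : realType) (M : nat).

Definition bounded_partition : set (seq nat) := [set l | is_partition l /\ (size l <= M)%N].
Definition inter (b : bool) (y z : seq nat) := if b then succ_interlace z y else succ_interlace y z.
Definition predecessors b z : set (seq nat) := [set y | bounded_partition y /\ inter b y z].
Definition pos (z : seq nat) (k : nat) : nat := (nth 0%N z k + (M.-1 - k))%N.
Definition interlace_range (b : bool) (z : seq nat) (k : nat) : pred nat := fun c =>
  if b then (nth 0%N z k.+1 <= c <= nth 0%N z k)%N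
  else ((nth 0%N z k <= c) && ((k == 0) || (c <= nth 0%N z k.-1)))%N.

Lemma bounded_partition_nth0 z k : bounded_partition z -> (M <= k)%N -> nth 0%N z k = 0%N.
Proof. by move=> [_ zM] Mk; rewrite nth_default//; lia. Qed.

Lemma box_sorted b z s : bounded_partition z -> box M (interlace_range b z) s -> sorted (fun a b => b <= a)%N s.
Proof.
move=> zP [sM sI]; apply/sorted_nth_le => k.
have [kM|kM] := ltnP k.+1 M; last by rewrite nth_default// sM.
have := sI k ltac:(lia); have := sI k.+1 kM; rewrite /interlace_range.
by case: (b) => /=; lia.
Qed.

(** With [z] fixed, interlacing bounds each padded entry of [y] separately, and the ranges already
    force [y] to decrease. *)
Lemma bij_strip b z : bounded_partition z -> set_bij (box M (interlace_range b z)) (predecessors b z) strip.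
Proof.
move=> zP; split=> [s sP|s s'|y [[yP yM] yI]].
- have ss := box_sorted zP sP; have [sM sI] := sP.
  split; first by split; [exact: is_partition_strip|rewrite size_filter -sM count_size].
  rewrite /inter; case: b sP sI => sP sI k; rewrite !nth_strip//;
    (have [kM|kM] := ltnP k M; [|by rewrite !(bounded_partition_nth0 zP, nth_default) ?sM//; lia]).
    by have := sI k kM; rewrite /interlace_range; lia.
  have := sI k kM; rewrite /interlace_range => /andP[h1 h2]; split=> //.
  have [kM'|kM'] := ltnP k.+1 M; last by rewrite nth_default ?sM.
  by have := sI k.+1 kM'; rewrite /interlace_range /= => /andP[].
- rewrite !inE => sP sP' e; have ss := box_sorted zP sP; have ss' := box_sorted zP sP'.
  have [sM _] := sP; have [sM' _] := sP'.
  apply: (@eq_from_nth _ 0%N) => [|k _]; first by rewrite sM sM'.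
  by rewrite -(nth_strip _ ss) e nth_strip.
have [sy _] := andP yP.
have npart k : nth 0%N (mkseq (nth 0%N y) M) k = nth 0%N y k.
  have [kM|kM] := ltnP k M; first by rewrite nth_mkseq.
  by rewrite !nth_default// ?size_mkseq//; lia.
have sm : sorted (fun a b => b <= a)%N (mkseq (nth 0%N y) M).
  by apply/sorted_nth_le => k; rewrite !npart; move: k; apply/sorted_nth_le.
exists (mkseq (nth 0%N y) M).
  split; first by rewrite size_mkseq.
  move=> k kM; rewrite npart /interlace_range; move: yI; rewrite /inter; case: b => yI.
    by have [h1 h2] := yI k; rewrite h1 h2.
  have [h1 _] := yI k; rewrite h1 /=; case: k kM {h1} => //= k kM.
  by have [_ h2] := yI k.
apply: partition_eq => // [|k]; first exact: is_partition_strip.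
by rewrite nth_strip.
Qed.

Definition pre (f : nat -> R) (z : nat) := \sum_(0 <= y < z) f y.
Definition tot (f : nat -> R) := limn (pre f).
(* [b = true]: the next partition is larger, so positions are summed from below; otherwise from above. *)
Definition stepf (b : bool) (f : nat -> R) (z : nat) := if b then pre f z.+1 else tot f - pre f z.

Definition interlace_sum (b : bool) (f : nat -> R) (z : seq nat) (k : nat) : R :=
  if b then stepf true f (pos z k) - (if k.+1 == M then 0 else stepf true f (pos z k.+1))
  else stepf false f (pos z k) - (if k == 0 then 0 else stepf false f (pos z k.-1)).

Lemma pre_shift (f : nat -> R) (P : pred nat) (a b d : nat) : (a <= b)%N ->
  (forall c, P c = (a <= c < b)%N) ->
  (\sum_(0 <= c < n | P c) f (c + d)%N) @[n --> \oo] --> pre f (b + d)%N - pre f (a + d)%N.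
Proof.
move=> ab PE; apply: cvg_near_cst; exists b => // n /= bn.
rewrite (eq_bigl _ _ PE) (big_cat_nat (n := a))//=; last by lia.
rewrite [X in X + _]big1_seq ?add0r; last by move=> c; rewrite mem_index_iota; lia.
rewrite (big_cat_nat (n := b))//= [X in _ + X]big1_seq ?addr0; last by move=> c; rewrite mem_index_iota; lia.
rewrite /pre (big_cat_nat (n := (a + d)%N) (p := (b + d)%N))//=; last by lia.
rewrite [RHS]addrAC subrr add0r big_addn addnK.
rewrite big_nat_cond [in RHS]big_nat_cond; apply: eq_big => [c|//]; lia.
Qed.

Lemma pre_shift_inf (f : nat -> R) (P : pred nat) (a d : nat) : cvgn (pre f) ->
  (forall c, P c = (a <= c)%N) ->
  (\sum_(0 <= c < n | P c) f (c + d)%N) @[n --> \oo] --> tot f - pre f (a + d)%N.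
Proof.
move=> fc PE.
have h : (pre f (n + d)%N - pre f (a + d)%N) @[n --> \oo] --> tot f - pre f (a + d)%N.
  by apply: cvgB; [rewrite (cvg_shiftn d (pre f))|exact: cvg_cst].
apply: cvg_trans h; apply: near_eq_cvg; exists a => // n /= an.
rewrite (eq_bigl _ _ PE) (big_cat_nat (n := a))//=.
rewrite [X in _ = X + _]big1_seq ?add0r; last by move=> c; rewrite mem_index_iota; lia.
rewrite /pre (big_cat_nat (n := (a + d)%N) (p := (n + d)%N))//=; last by lia.
rewrite [LHS]addrAC subrr add0r big_addn addnK.
rewrite big_nat_cond [in RHS]big_nat_cond; apply: eq_big => [c|//]; lia.
Qed.

(** The shift [M.-1 - k] makes the ranges of consecutive rows abut, so both ends of each sum are
    values of one function [stepf] at positions of [z]. The last row starts at position 0 (growing),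
    the first is unbounded above (shrinking): no second term there. *)
Lemma interlace_range_sum b f z k : bounded_partition z -> (k < M)%N -> cvgn (pre f) ->
  (\sum_(0 <= c < n | interlace_range b z k c) f (c + (M.-1 - k))%N) @[n --> \oo] --> interlace_sum b f z k.
Proof.
move=> zP kM fc; have zs : forall j, (nth 0%N z j.+1 <= nth 0%N z j)%N.
  by have [/andP[/sorted_nth_le]] := zP.
rewrite /interlace_sum; case: b; rewrite /stepf.
  have := zs k; have [km|km] := eqVneq k.+1 M => zk.
    have z0 := bounded_partition_nth0 zP (eq_leq (esym km)).
    have h := @pre_shift f (interlace_range true z k) 0 (nth 0%N z k).+1 (M.-1 - k) isT.
    have e : (0 + (M.-1 - k))%N = 0 by lia.
    rewrite e {2}/pre big_geq// subr0 in h; rewrite subr0 /pos.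
    by rewrite addSn in h; apply: h => c; rewrite /interlace_range z0; lia.
  have h := @pre_shift f (interlace_range true z k) (nth 0%N z k.+1) (nth 0%N z k).+1 (M.-1 - k) ltac:(lia).
  rewrite addSn in h; rewrite /pos.
  have -> : (nth 0%N z k.+1 + (M.-1 - k.+1)).+1 = (nth 0%N z k.+1 + (M.-1 - k))%N by lia.
  by apply: h => c; rewrite /interlace_range; lia.
have [k0|k0] := eqVneq k 0.
  by rewrite subr0 /pos; apply: pre_shift_inf => // c; rewrite /interlace_range k0 eqxx; lia.
have zk := zs k.-1; rewrite prednK in zk; last by lia.
have h := @pre_shift f (interlace_range false z k) (nth 0%N z k) (nth 0%N z k.-1).+1 (M.-1 - k) ltac:(lia).
rewrite opprB addrC addrA subrK /pos.
have -> : (nth 0%N z k.-1 + (M.-1 - k.-1))%N = ((nth 0%N z k.-1).+1 + (M.-1 - k))%N by lia.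
by apply: h => c; rewrite /interlace_range (negbTE k0) /=; lia.
Qed.

(** Subtracting a neighbouring row is multiplication by a bidiagonal unitriangular matrix. *)
Lemma det_step b (g : 'I_M -> nat -> R) z :
  \det (\matrix_(k < M, i < M) interlace_sum b (g i) z k) = \det (\matrix_(k < M, i < M) stepf b (g i) (pos z k)).
Proof.
pose B := \matrix_(k < M, i < M) stepf b (g i) (pos z k).
pose sh (k l : 'I_M) : bool := if b then l == k.+1 :> nat else l.+1 == k :> nat.
pose D : 'M[R]_M := \matrix_(k, l) ((k == l)%:R - (sh k l)%:R).
have -> : \matrix_(k < M, i < M) interlace_sum b (g i) z k = D *m B.
  apply/matrixP => k i; rewrite !mxE.
  under eq_bigr do rewrite !mxE mulrBl.
  rewrite sumrB (bigD1 k)//= eqxx mul1r [X in _ + X - _]big1 ?addr0; last first.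
    by move=> l lk; rewrite eq_sym (negbTE lk) mul0r.
  rewrite /interlace_sum /sh; case: (b); congr (_ - _).
    case: eqVneq => [kM|kM].
      by rewrite big1// => l _; rewrite (_ : (_ == _) = false) ?mul0r//; have := ltn_ord l; lia.
    have kM' : (k.+1 < M)%N by have := ltn_ord k; lia.
    rewrite (bigD1 (Ordinal kM'))//= eqxx mul1r big1 ?addr0// => l.
    by rewrite -val_eqE /= => /negbTE ->; rewrite mul0r.
  case: eqVneq => [k0|k0].
    by rewrite big1// => l _; rewrite (_ : (_ == _) = false) ?mul0r//; lia.
  have kM' : (k.-1 < M)%N by have := ltn_ord k; lia.
  rewrite (bigD1 (Ordinal kM'))//= prednK ?lt0n// eqxx mul1r big1 ?addr0// => l.
  rewrite -val_eqE /= => lk; rewrite (_ : (_ == _) = false) ?mul0r//; lia.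
rewrite det_mulmx.
suff -> : \det D = 1 by rewrite mul1r.
have diag i : D i i = 1.
  by rewrite !mxE eqxx /sh; case: (b); rewrite (_ : (_ == _) = false) ?subr0//; lia.
case bE : b.
  rewrite -det_tr det_trig; first by rewrite big1// => i _; rewrite mxE diag.
  apply/is_trig_mxP => i j ij; rewrite !mxE /sh bE -val_eqE /=.
  have -> : (j == i :> nat) = false by lia.
  have e2 : (nat_of_ord i == j.+1) = false by apply/negbTE; rewrite neq_ltn; apply/orP; left; lia.
  by rewrite e2 subrr.
rewrite det_trig; first by rewrite big1// => i _; rewrite diag.
apply/is_trig_mxP => i j ij; rewrite !mxE /sh bE -val_eqE /=.
have -> : (i == j :> nat) = false by lia.
have e2 : (j.+1 == nat_of_ord i) = false by apply/negbTE; rewrite neq_ltn; apply/orP; right; lia.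
by rewrite e2 subrr.
Qed.

(** Each Leibniz term is a product over rows, so its sum over the box is the product of the row
    sums, and these assemble into a determinant again. *)
Lemma esum_step b (g : 'I_M -> nat -> R) z : bounded_partition z ->
  (forall i y, 0 <= g i y) -> (forall i, cvgn (pre (g i))) ->
  (forall y, predecessors b z y -> 0 <= \det (\matrix_(k < M, i < M) g i (pos y k))) ->
  \esum_(y in predecessors b z) (\det (\matrix_(k < M, i < M) g i (pos y k)))%:E =
  (\det (\matrix_(k < M, i < M) stepf b (g i) (pos z k)))%:E.
Proof.
move=> zP g0 gc det0; rewrite -det_step.
rewrite (reindex_esum _ _ _ _ (bij_strip b zP)).
pose tm (s : seq nat) (p : 'S_M) := \prod_(k < M) g (p k) (nth 0%N s k + (M.-1 - k))%N.
have detE s : box M (interlace_range b z) s -> \det (\matrix_(k < M, i < M) g i (pos (strip s) k)) =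
    \sum_(p : 'S_M | ~~ odd_perm p) tm s p - \sum_(p : 'S_M | odd_perm p) tm s p.
  move=> sP; rewrite /determinant (bigID (fun p : 'S_M => odd_perm p))/= addrC -sumrN.
  congr (_ + _); apply: eq_bigr => p; [move=> /negbTE ->|move=> ->];
    rewrite ?expr0 ?expr1 ?mul1r ?mulN1r; [|congr (- _)];
    apply: eq_bigr => k _; rewrite mxE /pos nth_strip//; exact: box_sorted sP.
have tm0 s p : 0 <= tm s p by apply: prodr_ge0.
pose V p := \prod_(k < M) interlace_sum b (g (p k)) z k.
have tmV p : \esum_(s in box M (interlace_range b z)) (tm s p)%:E = (V p)%:E.
  (* Extended by 0 outside ['I_M] to fit [esum_box], which indexes rows by naturals. *)
  pose F (k c : nat) := oapp (fun i : 'I_M => g (p i) (c + (M.-1 - k))%N) 0 (insub k).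
  pose H (k : nat) := oapp (fun i : 'I_M => interlace_sum b (g (p i)) z k) 0 (insub k).
  have FE (k : 'I_M) c : F k c = g (p k) (c + (M.-1 - k))%N by rewrite /F valK.
  have HE (k : 'I_M) : H k = interlace_sum b (g (p k)) z k by rewrite /H valK.
  have -> : V p = 1 * \prod_(k < M) H k by rewrite mul1r; apply: eq_bigr => k _; rewrite HE.
  rewrite -(@esum_box R M (interlace_range b z) F H 1 ler01).
  - by apply: eq_esum => s _; rewrite mul1r; congr (_%:E); apply: eq_bigr => k _; rewrite FE.
  - by move=> k c; rewrite /F; case: insub => //= i.
  move=> k kM; rewrite /H; under eq_fun do under eq_bigr do rewrite /F.
  by rewrite (insubT (fun k => k < M)%N kM) /=; exact: interlace_range_sum.
have detV : \det (\matrix_(k < M, i < M) interlace_sum b (g i) z k) =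
    \sum_(p : 'S_M | ~~ odd_perm p) V p - \sum_(p : 'S_M | odd_perm p) V p.
  rewrite /determinant (bigID (fun p : 'S_M => odd_perm p))/= addrC -sumrN.
  congr (_ + _); apply: eq_bigr => p; [move=> /negbTE ->|move=> ->];
    rewrite ?expr0 ?expr1 ?mul1r ?mulN1r; [|congr (- _)];
    by apply: eq_bigr => k _; rewrite mxE.
have esumP (P : pred 'S_M) : \esum_(s in box M (interlace_range b z)) (\sum_(p | P p) tm s p)%:E =
    (\sum_(p | P p) V p)%:E.
  under eq_esum do rewrite -sumEFin.
  rewrite esum_sum; last by move=> s p _ _; rewrite lee_fin.
  by under eq_bigr do rewrite tmV; rewrite sumEFin.
have [_ _ bijs] := bij_strip b zP; have [hom _ _] := bij_strip b zP.
(* The odd terms are moved to the other side so that all summands are nonnegative; being finite,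
   their sum can be cancelled afterwards. *)
have h : (\esum_(s in box M (interlace_range b z)) (\det (\matrix_(k < M, i < M) g i (pos (strip s) k)))%:E +
    \esum_(s in box M (interlace_range b z)) (\sum_(p | odd_perm p) tm s p)%:E =
    \esum_(s in box M (interlace_range b z)) (\sum_(p | ~~ odd_perm p) tm s p)%:E)%E.
  rewrite -esumD; first by apply: eq_esum => s sP; rewrite -EFinD detE// subrK.
    by move=> s sP; rewrite lee_fin; apply: det0; exact: hom.
  by move=> s sP; rewrite lee_fin; exact: sumr_ge0.
rewrite !esumP in h; rewrite detV EFinB -h addeK//.
Qed.

End OneStep.

(** * Weighted sums over configurations *)

Section Paths.
Variables (R : realType) (M : nat) (up : nat -> bool) (h : nat -> nat -> R).
Hypothesis h0 : forall n y, 0 <= h n y.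

Fixpoint row_fun (n : nat) (i : 'I_M) : nat -> R :=
  if n is m.+1 then fun y => stepf (up m) (row_fun m i) y * h m.+1 y
  else fun y => (y == M.-1 - i)%N%:R.

Definition slice_weight (n : nat) (z : seq nat) : R := \prod_(k < M) h n (pos M z k).

(** Emptiness beyond [n] makes a function on all of [nat] determined by its first [n] steps, so that
    no path is counted twice. *)
Definition paths (n : nat) (z : seq nat) : set (nat -> seq nat) :=
  [set p | [/\ p 0%N = [::], p n = z, forall m, (n < m)%N -> p m = [::], forall m, bounded_partition M (p m) &
            forall m, (m < n)%N -> inter (up m) (p m) (p m.+1)]].

Definition pathsum (n : nat) (z : seq nat) : \bar R :=
  \esum_(p in paths n z) (\prod_(1 <= m < n.+1) slice_weight m (p m))%:E.

Lemma slice_weight_ge0 n z : 0 <= slice_weight n z.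
Proof. exact: prodr_ge0. Qed.

Definition extend (n : nat) (z : seq nat) (p : nat -> seq nat) : nat -> seq nat :=
  fun m => if m == n then z else p m.

Lemma bounded_partition_nil : bounded_partition M [::].
Proof. by []. Qed.

Lemma bij_extend n z : bounded_partition M z -> set_bij (predecessors M (up n) z `*`` paths n) (paths n.+1 z)
  (fun yp => extend n.+1 z yp.2).
Proof.
move=> zP; split=> [[y p] /= [[yP yI] [p0 pn pgt pP pI]]|[y p] [y' p']|p [p0 pn pgt pP pI]].
- rewrite /extend; split=> /=; [by []|by rewrite eqxx| | |].
  + by move=> m nm; rewrite gtn_eqF// pgt//; lia.
  + by move=> m; case: eqP.
  + move=> m mn; rewrite ltn_eqF//; case: eqP => [[->]|/eqP mn']; first by rewrite pn.
    by apply: pI; lia.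
- rewrite !inE /= => -[_ [p0 pn pgt _ _]] [_ [p0' pn' pgt' _ _]] e.
  have pp m : p m = p' m.
    have := congr1 (fun f => f m) e; rewrite /extend; case: eqP => // -> _.
    by rewrite pgt// pgt'.
  by rewrite -pn -pn' pp; congr (_, _); apply/funext.
exists (p n, extend n.+1 [::] p) => /=.
  split; first by split; [exact: pP|have := pI n (ltnSn n); rewrite pn].
  rewrite /extend; split=> /=; [by []|by rewrite ltn_eqF| | |].
  - by move=> m nm; case: eqP => // /eqP mn; apply: pgt; lia.
  - by move=> m; case: eqP.
  - by move=> m mn; rewrite !ltn_eqF//; [apply: pI|]; lia.
by apply/funext => m; rewrite /extend; case: eqP => // ->.
Qed.

Lemma det_scale (c : 'I_M -> R) (A : 'M[R]_M) :
  \det (\matrix_(k < M, i < M) (A k i * c k)) = \det A * \prod_(k < M) c k.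
Proof.
have -> : \matrix_(k < M, i < M) (A k i * c k) = diag_mx (\row_k c k) *m A.
  by apply/matrixP => k i; rewrite mul_diag_mx !mxE mulrC.
rewrite det_mulmx det_diag mulrC; congr (_ * _).
by apply: eq_bigr => i _; rewrite mxE.
Qed.

Variable T : nat.
Hypothesis row_fun_cvg : forall n i, (n < T)%N -> cvgn (pre (row_fun n i)).

Lemma stepf_ge0 b f y : (forall y, 0 <= f y) -> cvgn (pre f) -> 0 <= stepf b f y :> R.
Proof.
move=> f0 fc; rewrite /stepf; case: b; first exact: sumr_ge0.
rewrite subr_ge0 /tot; apply: nondecreasing_cvgn_le => //.
by apply/nondecreasing_seqP => n; rewrite /pre big_nat_recr//= lerDl.
Qed.

Lemma row_fun_ge0 n i y : (n <= T)%N -> 0 <= row_fun n i y.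
Proof.
elim: n y => [|n IH] y horizon /=; first by [].
rewrite mulr_ge0// stepf_ge0//; last exact: row_fun_cvg.
by move=> y'; apply: IH; lia.
Qed.

Definition row_mxat n z : 'M[R]_M := \matrix_(k, i) row_fun n i (pos M z k).

Lemma det_row_mxat0 z : bounded_partition M z -> \det (row_mxat 0 z) = (z == [::])%:R.
Proof.
move=> zP; case: eqP => [->|/eqP z0].
  have -> : row_mxat 0 [::] = 1%:M.
    apply/matrixP => k i; rewrite !mxE /= /pos nth_nil add0n -val_eqE /=.
    suff -> : (M.-1 - k == M.-1 - i)%N = (k == i :> nat) by [].
    have := ltn_ord k; have := ltn_ord i => hi hk.
    by apply/eqP/eqP; lia.
  exact: det1.
have M0 : (0 < M)%N by case: zP => _; case: z z0 => //= a z _; lia.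
have z1 : (0 < nth 0%N z 0)%N.
  by case: zP => /andP[_]; case: z z0 => //= a z _ /andP[].
(* The first particle of a nonempty partition lies above every starting position, so row 0 is
   zero. *)
rewrite /determinant big1// => s _; rewrite (bigD1 (Ordinal M0))//= mxE /= /pos /=.
rewrite (_ : (_ == _) = false) ?mul0r ?mulr0//.
by apply/negbTE; rewrite neq_ltn; apply/orP; right; lia.
Qed.

Lemma pathsumE n z : (n <= T)%N -> bounded_partition M z -> pathsum n z = (\det (row_mxat n z))%:E.
Proof.
elim: n z => [|n IH] z horizon zP.
  rewrite det_row_mxat0// /pathsum; case: eqP => [->|z0].
    have -> : paths 0 [::] = [set (fun=> [::])].
      apply/seteqP; split=> p /=; last by move=> ->; split.
      by case=> p0 _ pgt _ _; apply/funext => -[|m]; rewrite ?p0// pgt.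
    by rewrite esum_set1 big_geq// lee_fin.
  have -> : paths 0 z = set0.
    by apply/seteqP; split=> p //= -[p0 pz _ _ _]; apply: z0; rewrite -pz.
  by rewrite esum_set0.
rewrite /pathsum (reindex_esum _ _ _ _ (bij_extend n zP)).
rewrite -(@esum_esum _ _ _ _ _ (fun y p => (\prod_(1 <= m < n.+2) slice_weight m (extend n.+1 z p m))%:E)); last first.
  by move=> y p _ _; rewrite lee_fin; apply: prodr_ge0 => m _; exact: slice_weight_ge0.
have inner y : predecessors M (up n) z y ->
    \esum_(p in paths n y) (\prod_(1 <= m < n.+2) slice_weight m (extend n.+1 z p m))%:E =
    ((slice_weight n.+1 z)%:E * (\det (row_mxat n y))%:E)%E.
  move=> [yP _]; rewrite -IH//; last by lia.
  rewrite /pathsum -esumZl ?slice_weight_ge0//; last first.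
    by move=> p; rewrite lee_fin; apply: prodr_ge0 => m _; exact: slice_weight_ge0.
  apply: eq_esum => p _; rewrite -EFinM big_nat_recr//= {2}/extend eqxx mulrC; congr (_ * _)%:E.
  by apply: eq_big_nat => m mn; rewrite /extend ltn_eqF//; lia.
(* Positivity of these determinants is not algebraic: by induction they are sums of weights. *)
have det0 y : predecessors M (up n) z y -> 0 <= \det (row_mxat n y).
  move=> [yP _]; rewrite -lee_fin -IH//; last by lia.
  by apply: esum_ge0 => p _; rewrite lee_fin; apply: prodr_ge0 => m _; exact: slice_weight_ge0.
rewrite (eq_esum inner).
(* [esumZl] wants nonnegativity for every [y], while the determinant is known to be nonnegative only
   on predecessors; the maximum bridges this. *)
rewrite (eq_esum (b := fun y => ((slice_weight n.+1 z)%:E * (Num.max 0 (\det (row_mxat n y)))%:E)%E)); last first.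
  by move=> y yI; rewrite max_r// det0.
rewrite esumZl ?slice_weight_ge0//; last by move=> y; rewrite lee_fin le_max lexx.
rewrite (eq_esum (b := fun y => (\det (row_mxat n y))%:E)); last by move=> y yI; rewrite max_r// det0.
rewrite esum_step//; first last.
- by move=> i; exact: row_fun_cvg.
- by move=> i y; apply: row_fun_ge0; lia.
rewrite -EFinM; congr (_%:E); rewrite mulrC -det_scale; congr (\det _).
by apply/matrixP => k i; rewrite !mxE.
Qed.

End Paths.

(** * Forbidden points *)

Section DetLemmas.
Variable F : comPzRingType.

(** Sylvester's identity, from two triangular factorizations of one block matrix. *)
Lemma det_1_mulmxC (m n : nat) (A : 'M[F]_(m, n)) (B : 'M[F]_(n, m)) :
  \det (1%:M - A *m B) = \det (1%:M - B *m A).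
Proof.
have e1 : block_mx 1%:M A B 1%:M = block_mx 1%:M 0 B 1%:M *m block_mx 1%:M A 0 (1%:M - B *m A).
  by rewrite mulmx_block !mul1mx !mulmx0 !mul0mx !mulmx1 !addr0 addrC subrK.
have e2 : block_mx 1%:M A B 1%:M = block_mx 1%:M A 0 1%:M *m block_mx (1%:M - A *m B) 0 B 1%:M.
  by rewrite mulmx_block !mul1mx !mulmx0 !mul0mx !mulmx1 !add0r subrK.
have := e2; rewrite e1 => /(congr1 determinant).
by rewrite !det_mulmx !det_lblock !det_ublock !det1 !mul1r !mulr1.
Qed.

End DetLemmas.

(** Triangularity without sorting the indices: a permutation with nonzero product never raises [ht]
    and lowers it at every moved index, yet it preserves the sum of [ht]. *)
Lemma det_graded (F : idomainType) (n : nat) (A : 'M[F]_n) (ht : 'I_n -> nat) :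
  (forall i, A i i = 1) -> (forall i j, i != j -> A i j != 0 -> (ht j < ht i)%N) -> \det A = 1.
Proof.
move=> A1 Aht; rewrite /determinant (bigD1 (1%g : 'S_n))//= [X in _ + X]big1 ?addr0.
  by rewrite odd_perm1 mul1r big1// => i _; rewrite perm1.
move=> s s1; apply/eqP; rewrite mulf_eq0 signr_eq0 /=; apply/negPn/negP => /prodf_neq0 h.
have le i : (ht (s i) <= ht i)%N.
  by have [<-//|ne] := eqVneq i (s i); apply/ltnW/Aht => //; exact: h.
have [i0 i0s] : exists i, i != s i.
  apply/existsP; apply: contraNT s1; rewrite negb_exists => /forallP h'.
  by apply/eqP/permP => i; rewrite perm1; apply/eqP; rewrite eq_sym; have := h' i; rewrite negbK.
have : (\sum_i ht (s i) < \sum_i ht i)%N.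
  rewrite (bigD1 i0)//= [X in (_ < X)%N](bigD1 i0)//= -addSn leq_add//.
    by apply: Aht => //; exact: h.
  exact: leq_sum.
by rewrite [X in (_ < X)%N](reindex_inj (@perm_inj _ s)) /= ltnn.
Qed.

(** * Geometrically decaying functions, on which the evolution is linear *)

Section Geo.
Variable R : realType.
Implicit Types f g : nat -> R.

Definition geo_decay f := exists C r, [/\ 0 <= C, 0 <= r < 1 & forall y, `|f y| <= C * r ^+ y].

Lemma geo_decay0 : geo_decay (fun _ => 0).
Proof. by exists 0, 0; split=> // [|y]; rewrite ?lexx ?ltr01 ?normr0 ?mul0r. Qed.

Lemma geo_decayD f g : geo_decay f -> geo_decay g -> geo_decay (fun y => f y + g y).
Proof.
move=> [C [r [C0 /andP[r0 r1] fC]]] [D [s [D0 /andP[s0 s1] gD]]].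
exists (C + D), (Num.max r s); split; first exact: addr_ge0.
  by rewrite le_max r0 gt_max r1 s1.
move=> y; apply: le_trans (ler_normD _ _) _; rewrite mulrDl lerD//.
  apply: le_trans (fC y) _; rewrite ler_wpM2l// lerXn2r ?nnegrE ?le_max ?r0 ?lexx//.
apply: le_trans (gD y) _; rewrite ler_wpM2l// lerXn2r ?nnegrE ?le_max ?s0 ?lexx ?orbT//.
Qed.

Lemma geo_decay_delta (b : bool) (y0 : nat) : geo_decay (fun y => (b && (y == y0))%:R).
Proof.
(* Chosen so that the bound equals 1 at [y0]. *)
exists (2 ^+ y0), 2^-1; split; first exact: exprn_ge0.
  by apply/andP; split; lra.
move=> y; case: eqVneq => [->|_]; last by rewrite andbF normr0 mulr_ge0// exprn_ge0//; lra.
rewrite exprVn divff ?expf_neq0// andbT; case: b; rewrite ?normr1 ?normr0//.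
Qed.

Lemma geo_decay_bound f : geo_decay f -> cvgn (pre f) /\ exists B, forall b z, `|stepf b f z| <= B.
Proof.
move=> [C [r [C0 /andP[r0 r1] fC]]].
have nr : `|r| < 1 by rewrite ger0_norm.
have gc := @is_cvg_geometric_series R C r nr.
have fn : cvgn (series (fun y => `|f y|)).
  apply: (series_le_cvg _ _ _ gc) => y //=; first by rewrite mulr_ge0// exprn_ge0.
have fc : cvgn (pre f) by exact: normed_cvg.
have pb z : `|pre f z| <= limn (series (geometric C r)).
  apply: le_trans (ler_norm_sum _ _ _) _.
  apply: le_trans (ler_sum _ (fun y _ => fC y)) _.
  apply: (nondecreasing_cvgn_le _ gc).
  by apply/nondecreasing_seqP => n; rewrite /series /= big_nat_recr//= lerDl mulr_ge0// exprn_ge0.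
split=> //; exists (limn (series (geometric C r)) + limn (series (geometric C r))) => b z.
have L0 := le_trans (normr_ge0 _) (pb 0%N).
rewrite /stepf; case: b; first by apply: le_trans (pb _) _; rewrite lerDl.
apply: le_trans (ler_normB _ _) _; apply: lerD => //.
have cn : `|pre f n| @[n --> \oo] --> `|tot f| by apply: cvg_norm.
rewrite -(cvg_lim _ cn)//; apply: limr_le; first by apply/cvg_ex; exists `|tot f|.
exact: nearW.
Qed.

(** Partial sums are merely bounded; the weight of the new time restores the decay. *)
Lemma geo_decay_step b f (q : R) : 0 <= q < 1 -> geo_decay f -> geo_decay (fun y => stepf b f y * q ^+ y).
Proof.
move=> /andP[q0 q1] /geo_decay_bound[_ [B fB]].
have B0 : 0 <= B by apply: le_trans (fB b 0%N).
exists B, q; split; rewrite ?q0// => y.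
by rewrite normrM [X in _ * X]ger0_norm ?exprn_ge0// ler_wpM2r ?exprn_ge0.
Qed.

Lemma geo_decay_ind f (P : pred nat) : geo_decay f -> geo_decay (fun y => f y * (P y)%:R).
Proof.
move=> [C [r [C0 r01 fC]]]; exists C, r; split=> // y.
apply: le_trans (fC y); rewrite normrM ler_piMr//.
by case: (P y); rewrite ?normr1 ?normr0.
Qed.

Lemma geo_decayZ (c : R) f : geo_decay f -> geo_decay (fun y => c * f y).
Proof.
move=> [C [r [C0 r01 fC]]]; exists (`|c| * C), r; split=> //; first exact: mulr_ge0.
by move=> y; rewrite normrM -mulrA ler_wpM2l.
Qed.

Lemma geo_decay_sum (I : Type) (s : seq I) (F : I -> nat -> R) : (forall i, geo_decay (F i)) ->
  geo_decay (fun y => \sum_(i <- s) F i y).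
Proof.
move=> FG; elim: s => [|i s IH]; first by under eq_fun do rewrite big_nil; exact: geo_decay0.
by under eq_fun do rewrite big_cons; exact: geo_decayD.
Qed.

Lemma eq_stepf b f g : f =1 g -> stepf b f =1 stepf b g.
Proof. by move=> /funext ->. Qed.

Lemma stepfD b f g z : geo_decay f -> geo_decay g -> stepf b (fun y => f y + g y) z = stepf b f z + stepf b g z.
Proof.
move=> /geo_decay_bound[fc _] /geo_decay_bound[gc _].
have pD n : pre (fun y => f y + g y) n = pre f n + pre g n by rewrite /pre big_split.
rewrite /stepf; case: b; first exact: pD.
have -> : tot (fun y => f y + g y) = tot f + tot g.
  rewrite /tot -limD//; congr (limn _); apply/funext => n; exact: pD.
by rewrite pD opprD addrACA.
Qed.

Lemma stepfZ b (c : R) f z : geo_decay f -> stepf b (fun y => c * f y) z = c * stepf b f z.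
Proof.
move=> /geo_decay_bound[fc _].
have pZ n : pre (fun y => c * f y) n = c * pre f n by rewrite /pre mulr_sumr.
rewrite /stepf; case: b; first exact: pZ.
have -> : tot (fun y => c * f y) = c * tot f.
  rewrite /tot; apply: cvg_lim => //.
  have -> : pre (fun y => c * f y) = (fun n => c * pre f n) by apply/funext.
  by apply: cvgM; [exact: cvg_cst|exact: fc].
by rewrite pZ mulrBr.
Qed.

Lemma stepf0 b z : stepf b (fun _ : nat => 0 : R) z = 0.
Proof.
have h := stepfZ b 0 z geo_decay0; by rewrite !mul0r in h.
Qed.

Lemma stepf_sum (I : Type) (s : seq I) (F : I -> nat -> R) b z : (forall i, geo_decay (F i)) ->
  stepf b (fun y => \sum_(i <- s) F i y) z = \sum_(i <- s) stepf b (F i) z.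
Proof.
move=> FG; elim: s => [|i s IH].
  by rewrite big_nil -[RHS](stepf0 b z); apply: eq_stepf => y; rewrite big_nil.
rewrite big_cons -IH -stepfD//; last exact: geo_decay_sum.
by apply: eq_stepf => y; rewrite big_cons.
Qed.

End Geo.

(** * The evolution with forbidden points as a finite-rank perturbation of the free one *)

Section Avoid.
Variables (R : realType) (M T np : nat) (up : nat -> bool) (q : nat -> R).
Variables (ta : 'I_np -> nat) (ya : 'I_np -> nat).
Hypothesis q01 : forall m, (0 < m < T)%N -> 0 <= q m < 1.
Hypothesis qT : 0 <= q T.
Hypothesis ta_in : forall a, (0 < ta a < T)%N.
Hypothesis inj : injective (fun a => (ta a, ya a)).

Definition hits (A : {set 'I_np}) (n y : nat) : bool := [exists a in A, (ta a == n) && (ya a == y)].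
Definition avoid_weight (A : {set 'I_np}) (n y : nat) : R := q n ^+ y * (~~ hits A n y)%:R.
Definition avoid_row (A : {set 'I_np}) n i := @row_fun R M up (avoid_weight A) n i.

(* Trajectory of the free evolution started by a unit source at the space-time point [a]. *)
Fixpoint seed_row (a : 'I_np) (n : nat) : nat -> R :=
  if n is m.+1 then fun y => stepf (up m) (seed_row a m) y * q m.+1 ^+ y + ((m.+1 == ta a) && (y == ya a))%:R
  else fun _ => 0.

(** The mass that row [i] would place on the point [a], had it not been forbidden. *)
Definition removed (A : {set 'I_np}) (i : 'I_M) (a : 'I_np) : R :=
  if a \in A then stepf (up (ta a).-1) (avoid_row A (ta a).-1 i) (ya a) * q (ta a) ^+ (ya a) else 0.

Lemma avoid_rowS (A : {set 'I_np}) n i y : avoid_row A n.+1 i y =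
  stepf (up n) (avoid_row A n i) y * q n.+1 ^+ y * (~~ hits A n.+1 y)%:R.
Proof. by rewrite /avoid_row /= /avoid_weight mulrA. Qed.

Lemma geo_decay_row (A : {set 'I_np}) n i : (n < T)%N -> geo_decay (avoid_row A n i).
Proof.
elim: n => [|n IH] horizon; first exact: (geo_decay_delta R true).
have g := geo_decay_ind (fun y => ~~ hits A n.+1 y) (geo_decay_step (up n) (@q01 n.+1 ltac:(lia)) (IH ltac:(lia))).
by apply: eq_ind g _ _; apply/funext => y; rewrite avoid_rowS.
Qed.

Lemma geo_decay_seed_row a n : (n < T)%N -> geo_decay (seed_row a n).
Proof.
elim: n => [|n IH] horizon; first exact: geo_decay0.
apply: geo_decayD; last exact: geo_decay_delta.
by apply: geo_decay_step; [apply: q01|apply: IH]; lia.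
Qed.

Lemma seed_row_before a n y : (n < ta a)%N -> seed_row a n y = 0.
Proof.
elim: n y => [//|n IH] y nt /=; rewrite ltn_eqF//= addr0.
have -> : seed_row a n = (fun=> 0) by apply/funext => z; apply: IH; lia.
by rewrite stepf0 mul0r.
Qed.

Lemma seed_row_at a y : seed_row a (ta a) y = (y == ya a)%:R.
Proof.
have := ta_in a; case E : (ta a) => [//|m] _ /=; rewrite E eqxx /=.
have -> : seed_row a m = (fun=> 0) by apply/funext => z; apply: seed_row_before; rewrite E.
by rewrite stepf0 mul0r add0r.
Qed.

Lemma hits0 n y : hits finset.set0 n y = false.
Proof. by apply/existsP => -[a]; rewrite inE. Qed.

(** Killing the mass at [a] is the same as adding there a source of the opposite sign, and by
    linearity this source then evolves freely as a multiple of [seed_row a]. *)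
Lemma avoid_row_expand (A : {set 'I_np}) n i y : (n <= T)%N ->
  avoid_row A n i y = avoid_row finset.set0 n i y - \sum_a removed A i a * seed_row a n y.
Proof.
elim: n y => [|n IH] y horizon.
  by rewrite big1 ?subr0// => a _; rewrite mulr0.
have gr := geo_decay_row A i horizon; have gr0 := geo_decay_row finset.set0 i horizon.
have gp a := geo_decay_seed_row a horizon.
have E : stepf (up n) (avoid_row A n i) y =
    stepf (up n) (avoid_row finset.set0 n i) y - \sum_a removed A i a * stepf (up n) (seed_row a n) y.
  rewrite (@eq_stepf R (up n) _ (fun y => avoid_row finset.set0 n i y + \sum_a (- removed A i a) * seed_row a n y)).
    rewrite stepfD//; last by apply: geo_decay_sum => a; exact: geo_decayZ.
    rewrite stepf_sum; last by move=> a; exact: geo_decayZ.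
    rewrite -sumrN; congr (_ + _); apply: eq_bigr => a _.
    by rewrite stepfZ// mulNr.
  by move=> z; rewrite IH; [rewrite -sumrN; congr (_ + _); apply: eq_bigr => a _; rewrite mulNr|lia].
rewrite [in RHS]avoid_rowS hits0 mulr1.
have -> : \sum_a removed A i a * seed_row a n.+1 y =
    (\sum_a removed A i a * stepf (up n) (seed_row a n) y) * q n.+1 ^+ y +
    \sum_a removed A i a * ((n.+1 == ta a) && (y == ya a))%:R.
  rewrite mulr_suml -big_split; apply: eq_bigr => a _.
  by rewrite /= mulrDr mulrA.
rewrite opprD addrA -mulrBl -E avoid_rowS; case: (boolP (hits A n.+1 y)) => /=.
  move=> /existsP[a /and3P[aA /eqP ta_n /eqP ya_y]]; rewrite mulr0.
  rewrite (bigD1 a)//= ta_n ya_y !eqxx mulr1 big1 ?addr0.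
    by rewrite /removed aA ta_n ya_y /= subrr.
  move=> c ca; rewrite (_ : _ && _ = false) ?mulr0//.
  apply/negP => /andP[/eqP e1 /eqP e2]; move/eqP: ca; apply; apply: inj => /=.
  by rewrite -e1 -e2 ta_n ya_y.
move=> nh; rewrite mulr1 big1 ?subr0// => a _.
rewrite /removed; case: ifP => aA; last by rewrite mul0r.
rewrite (_ : _ && _ = false) ?mulr0//; apply/negP => /andP[/eqP e1 /eqP e2].
by move/negP: nh; apply; apply/existsP; exists a; rewrite aA -e1 -e2 !eqxx.
Qed.

Lemma avoid_row_hits (A : {set 'I_np}) a i : a \in A -> avoid_row A (ta a) i (ya a) = 0.
Proof.
move=> aA; have := ta_in a; case E : (ta a) => [//|m] _; rewrite avoid_rowS.
rewrite (_ : hits _ _ _ = true) ?mulr0//.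
by apply/existsP; exists a; rewrite aA E !eqxx.
Qed.

Lemma seed_row_diag a b : ta a = ta b -> seed_row b (ta a) (ya a) = (a == b)%:R.
Proof.
move=> e; rewrite e seed_row_at; suff -> : (ya a == ya b) = (a == b) by []; apply/eqP/eqP => [e'|->//].
by apply: inj; rewrite /= e e'.
Qed.

Local Notation C := R[i].
Definition avoid_mx (A : {set 'I_np}) : 'M[R]_M := row_mxat M up (avoid_weight A) T [::].

(** All that is used of the kernel: the combination of free rows given by [X], minus the seeded
    trajectory, vanishes at the final positions and has the kernel entries, up to the delta, as its
    values at the points. *)
Variable X : 'M[C]_(np, M).
Hypothesis trajectory_final : forall b (k : 'I_M), \sum_i X b i * (avoid_row finset.set0 T i (pos M [::] k))%:C = (seed_row b T (pos M [::] k))%:C.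
Variable KM : 'M[C]_np.
Hypothesis kernel_mxE : forall b a, KM b a =
  \sum_i X b i * (avoid_row finset.set0 (ta a) i (ya a))%:C - (seed_row b (ta a) (ya a))%:C + (a == b)%:R.

(** At the final time, removing the points multiplies the free matrix by [1 - X^T rh], by
    [trajectory_final]. Sylvester's identity turns this into a determinant indexed by points, and
    [Psi] eliminates the unknown masses [rh]. *)
Lemma det_avoid (A : {set 'I_np}) : (\det (avoid_mx A))%:C =
  (\det (avoid_mx finset.set0))%:C * \det (\matrix_(a, b) ((a == b)%:R - (a \in A)%:R * KM b a)).
Proof.
pose toC := real_complex R.
pose rh : 'M[C]_(np, M) := \matrix_(a, i) (removed A i a)%:C.
pose Ph : 'M[C]_(M, np) := \matrix_(k, a) (seed_row a T (pos M [::] k))%:C.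
have detC (B : 'M[R]_M) : (\det B)%:C = \det (map_mx toC B).
  by rewrite det_map_mx.
rewrite !detC.
have PhX : Ph = map_mx toC (avoid_mx finset.set0) *m X^T.
  apply/matrixP => k b; rewrite !mxE -trajectory_final; apply: eq_bigr => i _.
  by rewrite !mxE mulrC.
have -> : map_mx toC (avoid_mx A) = map_mx toC (avoid_mx finset.set0) *m (1%:M - X^T *m rh).
  rewrite mulmxBr mulmx1 mulmxA -PhX; apply/matrixP => k i; rewrite !mxE.
  rewrite -[row_fun up (avoid_weight A) T i _]/(avoid_row A T i _) avoid_row_expand// /toC rmorphB /=; congr (_ - _).
  rewrite rmorph_sum /=; apply: eq_bigr => a _; rewrite !mxE -rmorphM /=.
  by rewrite mulrC.
rewrite det_mulmx det_1_mulmxC; congr (_ * _).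
(* The matrix of the linear system for the removed masses. Seeds act only at later times, and at
   equal times only on themselves, so it is unitriangular for the order of times. *)
pose Psi : 'M[C]_np := \matrix_(a, c) if a \in A then (seed_row c (ta a) (ya a))%:C else (a == c)%:R.
have detPsi : \det Psi = 1.
  apply: (det_graded (ht := ta)) => [a|a c ac]; rewrite mxE.
    by case: ifP => _; rewrite ?eqxx// seed_row_diag// eqxx.
  case: ifP => _; last by rewrite (negbTE ac) eqxx.
  apply: contraNltn; rewrite leq_eqVlt => /orP[/eqP e|lt]; last by rewrite seed_row_before.
  by rewrite seed_row_diag// (negbTE ac).
have -> : \det (1%:M - rh *m X^T) = \det (Psi *m (1%:M - rh *m X^T)).
  by rewrite det_mulmx detPsi mul1r.
rewrite mulmxBr mulmx1 mulmxA.
congr (\det _); apply/matrixP => a b; rewrite !mxE.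
(* The perturbed row vanishes at each forbidden point; expanding it there gives this system. *)
have PsiRh i : (Psi *m rh) a i = (a \in A)%:R * (avoid_row finset.set0 (ta a) i (ya a))%:C.
  rewrite !mxE; case: (boolP (a \in A)) => aA; last first.
    rewrite mul0r (bigD1 a)//= !mxE (negbTE aA) eqxx mul1r {1}/removed (negbTE aA) big1 ?addr0//.
    by move=> c ca; rewrite !mxE (negbTE aA) eq_sym (negbTE ca) mul0r.
  rewrite mul1r; have := avoid_row_hits i aA; rewrite avoid_row_expand; last by have := ta_in a; lia.
  move=> /eqP; rewrite subr_eq0 => /eqP ->; rewrite rmorph_sum /=; apply: eq_bigr => c _.
  by rewrite !mxE aA -rmorphM /= mulrC.
under eq_bigr do rewrite PsiRh mxE.
case: (boolP (a \in A)) => aA; last first.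
  by rewrite big1 ?subr0 ?mul0r ?subr0// => i _; rewrite !mul0r.
rewrite mul1r kernel_mxE; under eq_bigr do rewrite mul1r mulrC.
ring.
Qed.

End Avoid.

(** Passes to the limit in an identity telescoped from 0 to [n] whose upper end [V n] dies out; used
    for the steps that sum from above. *)
Lemma complex_limE (R : realType) (I : finType) (c : I -> R[i]) (f : I -> nat -> R) (g : nat -> R)
    (F : I -> R) (G : R) (V0 : R[i]) (V : nat -> R[i]) (B r : R) :
  (forall i, f i n @[n --> \oo] --> F i) -> g n @[n --> \oo] --> G ->
  0 <= r < 1 -> (forall n, normc (V n) <= B * r ^+ n) ->
  (forall n, V0 - V n = \sum_i c i * (f i n)%:C - (g n)%:C) ->
  V0 = \sum_i c i * (F i)%:C - G%:C.
Proof.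
move=> fF gG r01 VB E; apply/eqP; rewrite -subr_eq0; apply/eqP; apply: normc_le0.
pose e n := B * r ^+ n + (\sum_i normc (c i) * `|f i n - F i| + `|g n - G|).
have e0 : e n @[n --> \oo] --> (0 : R).
  have h1 : B * r ^+ n @[n --> \oo] --> (0 : R).
    rewrite -(mulr0 B); apply: cvgM; first exact: cvg_cst.
    by have /andP[r0 r1] := r01; apply: cvg_expr; rewrite ger0_norm.
  have nz (a : nat -> R) (l : R) : a n @[n --> \oo] --> l -> `|a n - l| @[n --> \oo] --> (0 : R).
    move=> al; rewrite -(normr0 R) -(subrr l); apply: cvg_norm.
    by apply: cvgB => //; exact: cvg_cst.
  have h2 : \sum_i normc (c i) * `|f i n - F i| @[n --> \oo] --> (0 : R).
    elim: (index_enum I) => [|i s IH].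
      by under eq_fun do rewrite big_nil; exact: cvg_cst.
    under eq_fun do rewrite big_cons.
    by have := cvgD (cvgM (cvg_cst (normc (c i))) (nz _ _ (fF i))) IH; rewrite mulr0 addr0; apply.
  have -> : 0 = 0 + (0 + 0) :> R by rewrite !addr0.
  by apply: cvgD => //; apply: cvgD => //; exact: nz.
have le n : normc (V0 - (\sum_i c i * (F i)%:C - G%:C)) <= e n.
  have -> : V0 - (\sum_i c i * (F i)%:C - G%:C) =
      V n + (\sum_i c i * (f i n - F i)%:C - (g n - G)%:C).
    rewrite -[V0](subrK (V n)) E !rmorphB /=.
    under [in RHS]eq_bigr do rewrite rmorphB mulrBr.
    rewrite sumrB; ring.
  apply: le_trans (le_normcD _ _) _; apply: lerD; first exact: VB.
  apply: le_trans (normcB_le _ _) _; rewrite normc_real lerD//.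
  elim/big_ind2: _ => [|x y z w h1 h2|i _]; first by rewrite normc0.
    by apply: le_trans (le_normcD _ _) _; exact: lerD.
  by rewrite normcM normc_real.
rewrite -(cvg_lim _ e0)//; apply: limr_ge; first by apply/cvg_ex; exists 0.
by apply: nearW => n; exact: le.
Qed.

(** * The determinantal formula *)

Section Assembly.
Variables (R : realType) (N : nat) (u v : nat -> int) (q : int -> R).
Hypothesis hN : (1 <= N)%N.
Hypothesis huv : forall i : nat, (i < N)%N -> u i < v i.+1 < u i.+1.
Hypothesis hq : forall t : int, u 0%N < t < u N -> 0 < q t < 1.
Variables (n : nat) (t J : 'I_n -> int).
Hypothesis ht : forall a, u 0%N < t a < u N.
Hypothesis hdist : injective (fun a => (t a, J a)).
Local Notation Dp := (inDplus N u v).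
Local Notation Dm := (inDminus N u v).
Local Notation xp := (xplus u q).
Local Notation xm := (xminus u q).
Local Notation canon_kernel := (canon_kernel N u v q).
Local Notation C := R[i].

Definition horizon : nat := absz (u N - u 0)%R.
(* Large enough for every configuration to have at most [npart] rows and for every [J a] to be a position. *)
Definition npart : nat := locked (2 * horizon + \sum_(a < n) absz (J a)).+1.
Definition isup (m : nat) : bool := Dm (u 0 + m%:Z).
(** At both ends the partition is empty and [q] is unconstrained; the value 1 keeps [gauge]
    positive. *)
Definition wq (m : nat) : R := if (0 < m < horizon)%N then q (u 0 + m%:Z) else 1.
Definition gauge (m : nat) : R := \prod_(1 <= k < m.+1) wq k.
Definition ptime (a : 'I_n) : nat := absz (t a - u 0)%R.
(** [J = lambda_k - k] with [k] counted from 1 becomes [lambda_k + npart - k], which is [pos] with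
    rows counted from 0. *)
Definition ppos (a : 'I_n) : nat := absz (J a + npart%:Z)%R.

Lemma horizonE : u N = u 0 + horizon%:Z.
Proof. by rewrite /horizon; have := u0_lt_uN hN huv; lia. Qed.

Lemma ptimeE a : t a = u 0 + (ptime a)%:Z.
Proof. by rewrite /ptime; have := ht a; lia. Qed.

Lemma ptime_in a : (0 < ptime a < horizon)%N.
Proof. by have := ht a; have := ptimeE a; have := horizonE; lia. Qed.

Lemma J_lt_npart a : (2 * horizon + absz (J a) < npart)%N.
Proof. by rewrite /npart -lock ltnS leq_add2l (bigD1 a)//= leq_addr. Qed.

Lemma pposE a : J a = (ppos a)%:Z - npart%:Z.
Proof. by rewrite /ppos; have := J_lt_npart a; lia. Qed.

Lemma ptime_ppos_inj : injective (fun a => (ptime a, ppos a)).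
Proof. by move=> a b [e1 e2]; apply: hdist => /=; rewrite !ptimeE !pposE e1 e2. Qed.

Lemma wq01 m : (0 < m < horizon)%N -> 0 < wq m < 1.
Proof.
move=> mT; rewrite /wq mT; apply: hq; have := horizonE; lia.
Qed.

Lemma wq_ge0_lt1 m : (0 < m < horizon)%N -> 0 <= wq m < 1.
Proof. by move=> /wq01/andP[/ltW -> ->]. Qed.

Lemma wq_gt0 m : 0 < wq m.
Proof.
have [mT|mT] := boolP (0 < m < horizon)%N; last by rewrite /wq (negbTE mT).
by have /andP[] := wq01 mT.
Qed.

Lemma wq_horizon_ge0 : 0 <= wq horizon.
Proof. exact/ltW/wq_gt0. Qed.

Lemma gauge_gt0 m : 0 < gauge m.
Proof.
by apply: prodr_gt0 => k _; exact: wq_gt0.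
Qed.

Lemma gaugeS m : gauge m.+1 = gauge m * wq m.+1.
Proof. by rewrite /gauge big_nat_recr. Qed.

Lemma gauge_xplus m : (m < horizon)%N -> xp (u 0 + m%:Z) = gauge m.
Proof.
elim: m => [|m IH] mT; first by rewrite addr0 xplus_u0 /gauge big_geq.
have -> : u 0 + m.+1%:Z = u 0 + m%:Z + 1 by lia.
rewrite (xplusS q hN); last by lia.
rewrite gaugeS IH; last by lia.
by rewrite /wq mT; congr (_ * q _); lia.
Qed.

Local Notation rw := (avoid_row (M := npart) isup wq ptime ppos finset.set0).
Local Notation phf := (seed_row isup wq ptime ppos).

(* The factor [gauge m ^+ y] turns the recursion of the kernel into the evolution of the rows. *)
Definition gauged_kernel (b : 'I_n) (m y : nat) : C :=
  (gauge m)%:C ^+ y * canon_kernel (t b) (J b) (u 0 + m%:Z) (y%:Z - npart%:Z) / (gauge (ptime b))%:C ^+ ppos b.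

Definition gauged_kernel_sub (b : 'I_n) (m y : nat) : C := gauged_kernel b m y - ((m == ptime b) && (y == ppos b))%:R.
Definition init_coef : 'M[C]_(n, npart) := \matrix_(b, i) gauged_kernel b 0 (npart.-1 - i)%N.

(** The kernel at time [m + 1] with the gauge of time [m]: the value after the partial sum and
    before the weight of the new time. *)
Definition pre_kernel (b : 'I_n) (m y : nat) : C :=
  (gauge m)%:C ^+ y * canon_kernel (t b) (J b) (u 0 + m%:Z + 1) (y%:Z - npart%:Z) / (gauge (ptime b))%:C ^+ ppos b.

Lemma gaugeC_neq0 m : (gauge m)%:C != 0 :> C.
Proof. by rewrite eq_complex /= negb_and gt_eqF ?gauge_gt0. Qed.

Lemma gauged_kernel_pre_kernel b m y : gauged_kernel b m.+1 y = pre_kernel b m y * (wq m.+1)%:C ^+ y.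
Proof.
rewrite /gauged_kernel /pre_kernel gaugeS rmorphM exprMn /=.
have -> : u 0 + m.+1%:Z = u 0 + m%:Z + 1 by lia.
ring.
Qed.

Lemma delta_ptime b m (y : nat) : (m < horizon)%N ->
  ((u 0 + m%:Z == t b) && (y%:Z - npart%:Z == J b)) = ((m == ptime b) && (y == ppos b)).
Proof. by move=> mT; have := ptimeE b; have := pposE b; lia. Qed.

Lemma gauged_kernel_sub_canon_kernel b m y : (m < horizon)%N -> gauged_kernel_sub b m y =
  (gauge m)%:C ^+ y * (canon_kernel (t b) (J b) (u 0 + m%:Z) (y%:Z - npart%:Z) -
    ((u 0 + m%:Z == t b) && (y%:Z - npart%:Z == J b))%:R) / (gauge (ptime b))%:C ^+ ppos b.
Proof.
move=> mT; rewrite delta_ptime// /gauged_kernel_sub /gauged_kernel mulrBr mulrBl; congr (_ - _).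
case: eqVneq => [->|_] /=; last by rewrite mulr0 mul0r.
case: eqVneq => [->|_] /=; last by rewrite mulr0 mul0r.
by rewrite mulr1 divff// expf_neq0// gaugeC_neq0.
Qed.

Lemma in_range m : (m < horizon)%N -> u 0%N <= u 0%N + m%:Z < u N.
Proof. by have := horizonE; lia. Qed.

(** Just below the lowest position. In [npart], one [horizon] covers the degree of [Phi_w], the
    other the time steps back from [t b], and the sum of the [J a] the distance to [J b]. *)
Lemma pre_kernel_boundary b m : (m < horizon)%N -> canon_kernel (t b) (J b) (u 0 + m%:Z + 1) (- npart%:Z - 1) = 0.
Proof.
move=> mT; have := horizonE; have := J_lt_npart b; have := ht b => htb JM uT.
have [lt|le] := ltP (t b) (u 0 + m%:Z + 1).
  by apply: (canon_kernel_far_after hN huv hq) => //; lia.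
have -> : u 0 + m%:Z + 1 = t b - (absz (t b - (u 0 + m%:Z + 1))%R)%:Z by lia.
by apply: (canon_kernel_far_before hN huv hq); lia.
Qed.

Lemma pre_kernel_up b m y : (m < horizon)%N -> isup m -> pre_kernel b m y = \sum_(0 <= k < y.+1) gauged_kernel_sub b m k.
Proof.
move=> mT Dm_m; have us := in_range mT.
have step k : gauged_kernel_sub b m k = (gauge m)%:C ^+ k * (canon_kernel (t b) (J b) (u 0 + m%:Z + 1) (k%:Z - npart%:Z) -
    ((gauge m)%:C)^-1 * canon_kernel (t b) (J b) (u 0 + m%:Z + 1) (k%:Z - npart%:Z - 1)) / (gauge (ptime b))%:C ^+ ppos b.
  rewrite gauged_kernel_sub_canon_kernel// -(canon_kernel_stepM hN huv hq)// /xminus gauge_xplus//.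
  by rewrite -[(gauge m)^-1%:C]/(real_complex R _) fmorphV.
have c0 := gaugeC_neq0 m.
elim: y => [|y IH].
  rewrite big_nat1 step /pre_kernel /= sub0r pre_kernel_boundary// mulr0 subr0.
  by [].
rewrite big_nat_recr//= -IH step /pre_kernel.
have -> : y.+1%:Z - npart%:Z - 1 = y%:Z - npart%:Z by lia.
rewrite exprS; move: (canon_kernel _ _ _ _) (canon_kernel _ _ _ _) => k1 k2.
have c1 : (gauge (ptime b))%:C ^+ ppos b != 0 :> C by rewrite expf_neq0// gaugeC_neq0.
move: c1 c0; move: (_ ^+ ppos b) => g; move: (_ ^+ y) => c'; move: ((gauge m)%:C) => c.
by move=> c1 c0; field; rewrite c0 c1.
Qed.

(** In the gauge the recursion is a plain difference and telescopes. The value at 0 is not known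
    here; the decay for large [y] later identifies it with the total sum. *)
Lemma pre_kernel_down b m y : (m < horizon)%N -> ~~ isup m -> pre_kernel b m 0 - pre_kernel b m y = \sum_(0 <= k < y) gauged_kernel_sub b m k.
Proof.
move=> mT Dm_m; have us := in_range mT.
have Dpm : Dp (u 0 + m%:Z) by rewrite (inDplusE hN huv us).
elim: y => [|y IH]; first by rewrite big_geq// subrr.
rewrite big_nat_recr//= -IH gauged_kernel_sub_canon_kernel// -(canon_kernel_stepP hN huv hq)// gauge_xplus// /pre_kernel.
have -> : y.+1%:Z - npart%:Z = y%:Z - npart%:Z + 1 by lia.
rewrite exprS; ring.
Qed.

Lemma pre_kernel_decay b m : (m < horizon)%N -> ~~ isup m -> exists B r, 0 <= r < 1 /\
  forall y, normc (pre_kernel b m y) <= B * r ^+ y.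
Proof.
move=> mT Dm_m; have us := in_range mT.
have Dpm : Dp (u 0 + m%:Z) by rewrite (inDplusE hN huv us).
have [B [r [/andP[r0 r1] H]]] := canon_kernel_decay hN huv hq (t b) (J b) us Dpm.
rewrite gauge_xplus// in H.
pose g := (gauge m)%:C ^+ npart / (gauge (ptime b))%:C ^+ ppos b.
exists (normc g * B * r ^ (- npart%:Z)), r; split; first by rewrite ltW.
move=> y; have c0 := gaugeC_neq0 m.
have -> : pre_kernel b m y = g * ((gauge m)%:C ^ (y%:Z - npart%:Z) * canon_kernel (t b) (J b) (u 0 + m%:Z + 1) (y%:Z - npart%:Z)).
  rewrite /pre_kernel /g expfzDr// -exprnP -exprnN.
  have c1 : (gauge m)%:C ^+ npart != 0 :> C by rewrite expf_neq0.
  have c2 : (gauge (ptime b))%:C ^+ ppos b != 0 :> C by rewrite expf_neq0// gaugeC_neq0.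
  by field; rewrite c1 c2.
rewrite normcM; apply: le_trans (ler_wpM2l (normc_ge0 _) (H _)) _.
rewrite expfzDr ?gt_eqF// -[r ^ y%:Z]/(r ^+ y).
by rewrite le_eqVlt; apply/orP; left; apply/eqP; ring.
Qed.

Lemma trajectory b m y : (m <= horizon)%N ->
  gauged_kernel_sub b m y = \sum_i init_coef b i * (rw m i y)%:C - (phf b m y)%:C.
Proof.
elim: m y => [|m IH] y mT.
  (* The initial rows are deltas at positions below [npart], so [init_coef] reproduces the kernel
     there; at higher positions the kernel vanishes by [canon_kernel_init]. *)
  rewrite /gauged_kernel_sub (_ : 0%N == ptime b = false); last by have := ptime_in b; lia.
  rewrite /= !subr0; have [yM|yM] := ltnP y npart.
    have iM : (npart.-1 - y < npart)%N by lia.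
    rewrite (bigD1 (Ordinal iM))//= !mxE /= big1 ?addr0.
      have -> : (npart.-1 - (npart.-1 - y))%N = y by lia.
      by rewrite eqxx mulr1.
    move=> i; rewrite -val_eqE /= => iy.
    rewrite (_ : y == _ = false) ?mulr0//; have := ltn_ord i; lia.
  rewrite /gauged_kernel addr0 (canon_kernel_init v hN hq) ?mulr0 ?mul0r; [|by have := ht b; lia|lia].
  rewrite big1// => i _ /=; rewrite (_ : y == _ = false) ?mulr0//; have := ltn_ord i; lia.
have gr i := @geo_decay_row R npart horizon n isup wq ptime ppos wq_ge0_lt1 wq_horizon_ge0 finset.set0 m i mT.
have gp := @geo_decay_seed_row R horizon n isup wq ptime ppos wq_ge0_lt1 wq_horizon_ge0 b m mT.
have prK z : \sum_(0 <= k < z) gauged_kernel_sub b m k =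
    \sum_i init_coef b i * (pre (rw m i) z)%:C - (pre (phf b m) z)%:C.
  under eq_bigr do rewrite (IH _ (ltnW mT)).
  rewrite sumrB exchange_big /= /pre rmorph_sum /=; congr (_ - _).
  by apply: eq_bigr => i _; rewrite rmorph_sum mulr_sumr.
have KvE : pre_kernel b m y = \sum_i init_coef b i * (stepf (isup m) (rw m i) y)%:C - (stepf (isup m) (phf b m) y)%:C.
  have [Dm_m|Dm_m] := boolP (isup m); first by rewrite pre_kernel_up// prK /stepf.
  rewrite /stepf; have [B [r [r01 HB]]] := pre_kernel_decay b mT Dm_m.
  have V0 : pre_kernel b m 0 = \sum_i init_coef b i * (tot (rw m i))%:C - (tot (phf b m))%:C.
    apply: (complex_limE (f := fun i => pre (rw m i)) (g := pre (phf b m)) _ _ r01 HB) => [i||z].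
    - exact: (proj1 (geo_decay_bound (gr i))).
    - exact: (proj1 (geo_decay_bound gp)).
    - by rewrite -prK pre_kernel_down.
  have E := pre_kernel_down b y mT Dm_m; rewrite prK V0 in E.
  under eq_bigr do rewrite rmorphB mulrBr.
  rewrite sumrB rmorphB /=; move: E; move: (pre_kernel b m y) => k.
  move=> /eqP; rewrite subr_eq => /eqP E.
  by rewrite opprD opprK addrACA E; ring.
rewrite /gauged_kernel_sub gauged_kernel_pre_kernel KvE mulrBl mulr_suml /=.
under [in RHS]eq_bigr do rewrite /avoid_weight hits0 mulr1 rmorphM rmorphXn mulrA.
rewrite rmorphD rmorphM rmorphXn /= opprD addrA; congr (_ - _).
by case: (_ && _).
Qed.


Lemma gauged_kernel_final b y : (y < npart)%N -> gauged_kernel b horizon y = 0.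
Proof.
move=> yM; rewrite /gauged_kernel -horizonE (canon_kernel_final v hN hq) ?mulr0 ?mul0r//; last by lia.
by have := ht b; lia.
Qed.

Definition kernel_mx : 'M[C]_n := \matrix_(b, a) gauged_kernel b (ptime a) (ppos a).

Lemma trajectory_final b (k : 'I_npart) : \sum_i init_coef b i * (rw horizon i (pos npart [::] k))%:C = (phf b horizon (pos npart [::] k))%:C.
Proof.
have := trajectory b (pos npart [::] k) (leqnn horizon).
rewrite /gauged_kernel_sub gauged_kernel_final; last by rewrite /pos nth_nil; have := ltn_ord k; lia.
rewrite (_ : (horizon == ptime b) = false); last by have := ptime_in b; lia.
by rewrite subr0 => /esym/eqP; rewrite subr_eq0 => /eqP.
Qed.

Lemma kernel_mxE b a : kernel_mx b a = \sum_i init_coef b i * (rw (ptime a) i (ppos a))%:C - (phf b (ptime a) (ppos a))%:C + (a == b)%:R.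
Proof.
rewrite mxE -trajectory; last by have := ptime_in a; lia.
rewrite /gauged_kernel_sub; have -> : (ptime a == ptime b) && (ppos a == ppos b) = (a == b).
  by apply/andP/eqP => [[/eqP e1 /eqP e2]|->//]; apply: ptime_ppos_inj; rewrite e1 e2.
by rewrite subrK.
Qed.

Local Notation DG := (avoid_mx npart horizon isup wq ptime ppos).

Lemma det_avoid_mx (A : {set 'I_n}) : (\det (DG A))%:C =
  (\det (DG finset.set0))%:C * \det (\matrix_(a, b) ((a == b)%:R - (a \in A)%:R * kernel_mx b a)).
Proof. exact: (det_avoid wq_ge0_lt1 wq_horizon_ge0 ptime_in ptime_ppos_inj trajectory_final kernel_mxE). Qed.

Definition embed (p : nat -> seq nat) : int -> seq nat :=
  fun s => if s <= u 0%N then [::] else p (absz (s - u 0)%R).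

Lemma embedE p (m : nat) : p 0%N = [::] -> embed p (u 0 + m%:Z) = p m.
Proof.
move=> p0; rewrite /embed; case: ifP => h; first by have -> : m = 0%N by lia.
by congr p; lia.
Qed.

(** One interlacing step adds at most one row. *)
Lemma size_config lam (m : nat) : configuration N u v lam -> (m <= horizon)%N -> (size (lam (u 0 + m%:Z)%R) <= m)%N.
Proof.
move=> [l0 [lP lI]]; elim: m => [|m IH] mT; first by rewrite l0//; lia.
have us := in_range mT; have sm := IH (ltnW mT).
have Pl z k : is_partition z -> (nth 0%N z k = 0)%N -> (size z <= k)%N.
  move=> /andP[_ /allP zp] zk; rewrite leqNgt; apply/negP => lt.
  by have := zp _ (mem_nth 0%N lt); rewrite zk.
have [IM IP] := lI _ us.
have -> : u 0 + m.+1%:Z = u 0 + m%:Z + 1 by lia.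
apply: Pl; first exact: lP.
have [Ds|Ds] := boolP (Dm (u 0 + m%:Z)).
  have [_ h] := IM Ds m; apply/eqP; rewrite -leqn0; apply: leq_trans h _.
  by rewrite nth_default.
have [h _] := IP (etrans (inDplusE hN huv us) Ds) m.+1.
by apply/eqP; rewrite -leqn0; apply: leq_trans h _; rewrite nth_default//; lia.
Qed.

Lemma bij_embed : set_bij (paths npart isup horizon [::]) [set l | configuration N u v l] embed.
Proof.
have uT := horizonE.
split=> [p [p0 pT pgt pP pI]|p p'|lam cl].
- have pend m : (horizon <= m)%N -> p m = [::].
    by rewrite leq_eqVlt => /orP[/eqP<-//|]; exact: pgt.
  split=> [s /orP[h|h]|].
  + by rewrite /embed h.
  + by rewrite /embed; case: ifP => // _; apply: pend; lia.
  split=> [s|k uk].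
    by rewrite /embed; case: ifP => // _; have [] := pP (absz (s - u 0)%R).
  have [m kE mT] : exists2 m : nat, k = u 0 + m%:Z & (m < horizon)%N by exists (absz (k - u 0)%R); lia.
  subst k; have -> : u 0 + m%:Z + 1 = u 0 + m.+1%:Z by lia.
  have := pI _ mT; rewrite !embedE// (inDplusE hN huv uk) /isup /inter.
  by case: (Dm _) => h; split.
- rewrite !inE => -[p0 _ _ _ _] [p0' _ _ _ _] e; apply/funext => m.
  by rewrite -(embedE m p0) -(embedE m p0') e.
have [l0 [lP lI]] := cl.
exists (fun m => lam (u 0 + m%:Z)).
  split.
  + by rewrite addr0 l0// lexx.
  + by rewrite -uT l0// lexx orbT.
  + by move=> m mT; apply: l0; lia.
  + move=> m; split; first exact: lP.
    have [mT|mT] := leqP m horizon; last by rewrite l0//; lia.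
    by apply: leq_trans (size_config cl mT) _; have := leqnn npart; rewrite {1}/npart -lock; lia.
  + move=> m mT; have us := in_range mT; have [IM IP] := lI _ us.
    have -> : u 0 + m.+1%:Z = u 0 + m%:Z + 1 by lia.
    rewrite /inter /isup; have [Ds|Ds] := boolP (Dm (u 0 + m%:Z)); first exact: IM.
    by apply: IP; rewrite (inDplusE hN huv us).
apply/funext => s; rewrite /embed; case: ifP => h; first by rewrite l0// h.
by congr lam; lia.
Qed.

Lemma sumn_nth (z : seq nat) m : (size z <= m)%N -> sumn z = (\sum_(k < m) nth 0 z k)%N.
Proof.
elim: z m => [|a z IH] m zm; first by rewrite big1// => k _; rewrite nth_nil.
case: m zm => // m zm.
by rewrite big_ord_recl /= (IH m).
Qed.

(** The sum of the positions of the empty partition. Weighting positions in place of parts costs the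
    constant factor [ground_weight], which cancels in the probability. *)
Definition c0 : nat := (\sum_(k < npart) (npart.-1 - k))%N.
Definition ground_weight : R := gauge horizon ^+ c0.

Lemma ground_weight_gt0 : 0 < ground_weight.
Proof. by rewrite exprn_gt0// gauge_gt0. Qed.

Definition avoids (A : {set 'I_n}) (lam : int -> seq nat) : Prop :=
  forall a, a \in A -> ~ inL lam (t a) (J a).

Lemma inL_pos p a : p 0%N = [::] -> bounded_partition npart (p (ptime a)) ->
  inL (embed p) (t a) (J a) <-> exists k : 'I_npart, pos npart (p (ptime a)) k = ppos a.
Proof.
move=> p0 pP; have eJ := pposE a; have lJ := J_lt_npart a.
rewrite /inL ptimeE embedE//; split=> [[k kJ']|[k kp]].
  have {kJ'} kJ : (nth 0%N (p (ptime a)) k)%:Z - k.+1%:Z = J a := kJ'.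
  have [kM|kM] := ltnP k npart.
    by exists (Ordinal kM); rewrite /pos /=; lia.
  by move: kJ; rewrite (bounded_partition_nth0 pP kM); lia.
exists k; change ((nth 0%N (p (ptime a)) k)%:Z - k.+1%:Z = J a).
by move: kp; rewrite /pos; have := ltn_ord k; lia.
Qed.

Lemma path_weight (A : {set 'I_n}) p : paths npart isup horizon [::] p ->
  \prod_(1 <= m < horizon.+1) slice_weight npart (avoid_weight wq ptime ppos A) m (p m) =
  ground_weight * (if embed p \in [set l | avoids A l] then weight N u q (embed p) else 0).
Proof.
move=> pC; have [p0 pT pgt pP pI] := pC.
have wtE m : slice_weight npart (avoid_weight wq ptime ppos A) m (p m) =
    wq m ^+ c0 * (wq m ^+ sumn (p m) * \prod_(k < npart) (~~ hits ptime ppos A m (pos npart (p m) k))%:R).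
  rewrite /slice_weight /avoid_weight big_split /= mulrA; congr (_ * _).
  rewrite -exprD prodrXr; congr (_ ^+ _).
  by rewrite /pos big_split /= addnC -sumn_nth//; case: (pP m).
under eq_bigr do rewrite wtE.
rewrite !big_split /= prodrXl -/(gauge horizon) -/ground_weight; congr (_ * _).
have wE : weight N u q (embed p) = \prod_(1 <= m < horizon.+1) wq m ^+ sumn (p m).
  have T0 : (0 < horizon)%N by have := u0_lt_uN hN huv; have := horizonE; lia.
  rewrite big_nat_recr//= pT expr0 mulr1 /weight /irange ifT; last first.
    by have := horizonE; lia.
  rewrite big_map big_add1.
  have -> : absz (u N - (u 0 + 1))%R = horizon.-1 by have := horizonE; lia.
  rewrite /index_iota subn0 big_seq [RHS]big_seq; apply: eq_bigr => i; rewrite mem_iota => iT.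
  have -> : u 0 + 1 + i%:Z = u 0 + i.+1%:Z by lia.
  by rewrite embedE// /wq ifT//; lia.
rewrite -wE.
have [av|nav] := boolP (embed p \in [set l | avoids A l]).
  rewrite big1 ?mulr1// => m _; rewrite big1// => k _.
  case: (boolP (hits _ _ _ _ _)) => //= /existsP[a /and3P[aA /eqP am /eqP ak]].
  move: av; rewrite inE => /(_ a aA) []; apply/inL_pos => //.
  by exists k; rewrite am ak.
have [a [aA aL]] : exists a, a \in A /\ inL (embed p) (t a) (J a).
  apply: contrapT => h; move/negP: nav; apply; rewrite inE => a aA aL.
  by apply: h; exists a.
have [k kp] := (inL_pos p0 (pP (ptime a))).1 aL.
apply/eqP; rewrite mulf_eq0; apply/orP; right.
rewrite prodf_seq_eq0; apply/hasP; exists (ptime a).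
  by rewrite mem_index_iota; have := ptime_in a; lia.
apply/prodf_eq0; exists k => //.
rewrite (_ : hits _ _ _ _ _ = true)//; apply/existsP; exists a.
by rewrite aA kp !eqxx.
Qed.

Lemma weight_ge0 lam : 0 <= weight N u q lam.
Proof.
rewrite /weight big_seq; apply: prodr_ge0 => s; rewrite mem_irange => hs.
by apply: exprn_ge0; have /andP[/ltW] : 0 < q s < 1 by apply: hq; lia.
Qed.

Lemma esum_avoid (A : {set 'I_n}) :
  \esum_(lam in [set l | configuration N u v l] `&` [set l | avoids A l]) (weight N u q lam)%:E =
  (\det (DG A) / ground_weight)%:E.
Proof.
have rc m i : (m < horizon)%N -> cvgn (pre (row_fun isup (avoid_weight wq ptime ppos A) m (i : 'I_npart))).
  by move=> mT; exact: (proj1 (geo_decay_bound (@geo_decay_row R npart horizon n isup wq ptime ppos wq_ge0_lt1 wq_horizon_ge0 A m i mT))).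
have h0 m y : 0 <= avoid_weight wq ptime ppos A m y.
  by rewrite /avoid_weight mulr_ge0// exprn_ge0// ltW// wq_gt0.
have := pathsumE h0 rc (leqnn horizon) (bounded_partition_nil npart).
rewrite esum_mkcondr (reindex_esum _ _ _ _ bij_embed) /pathsum.
set S := (X in X = _ -> _); set S' := (X in _ -> X = _).
have -> : S = (ground_weight%:E * S')%E.
  rewrite /S' -esumZl; [|exact/ltW/ground_weight_gt0|by move=> p; case: ifP => _; rewrite ?lee_fin ?weight_ge0].
  apply: eq_esum => p pC; rewrite path_weight// EFinM; case: ifP => //.
move=> E; have c00 := ground_weight_gt0.
have -> : S' = ((ground_weight^-1)%:E * (ground_weight%:E * S'))%E by rewrite muleA -EFinM mulVf ?mul1e// gt_eqF.
by rewrite E -EFinM mulrC.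
Qed.

Definition mixed_event (l : seq 'I_n) (A : {set 'I_n}) : set (int -> seq nat) :=
  [set lam | [/\ configuration N u v lam, forall b, b \in l -> inL lam (t b) (J b) & avoids A lam]].

(* Rows in [l] are required points, rows in [A] are forbidden points; the others are not constrained. *)
Definition mixed_mx (l : seq 'I_n) (A : {set 'I_n}) : 'M[C]_n :=
  \matrix_(a, b) (if a \in l then kernel_mx b a else (a == b)%:R - (a \in A)%:R * kernel_mx b a).

Lemma mixed_mx_nil : mixed_mx [::] finset.set0 = 1%:M.
Proof. by apply/matrixP => a b; rewrite !mxE finset.in_set0 mul0r subr0. Qed.

(** The unit row of an unconstrained point is the sum of its required and its forbidden row; the
    determinant is linear in that row. *)
Lemma det_mixed_mx x l (A : {set 'I_n}) : x \notin l -> x \notin A ->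
  \det (mixed_mx l A) = \det (mixed_mx (x :: l) A) + \det (mixed_mx l (x |: A)%SET).
Proof.
move=> xl xA; rewrite -[X in _ = X + _]mul1r -[X in _ = _ + X]mul1r.
apply: (determinant_multilinear (i0 := x)).
- apply/rowP => b; rewrite !scale1r !mxE mem_head (negbTE xl) (negbTE xA).
  by rewrite finset.setU11 mul0r mul1r subr0 addrC subrK.
- by apply/matrixP => a b; rewrite !mxE inE eq_sym (negbTE (neq_lift _ _)).
- apply/matrixP => a b; rewrite !mxE finset.in_setU1.
  by rewrite [lift x a == x]eq_sym (negbTE (neq_lift _ _)).
Qed.

(** Inclusion-exclusion one point at a time: required equals unconstrained minus forbidden. The real
    value [r] records that the sums are finite, without which they could not be subtracted. *)
Lemma esum_mixed_event l (A : {set 'I_n}) : uniq l -> (forall a, a \in l -> a \notin A) ->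
  exists2 r : R, \esum_(lam in mixed_event l A) (weight N u q lam)%:E = r%:E &
    r%:C = (\det (DG finset.set0) / ground_weight)%:C * \det (mixed_mx l A).
Proof.
elim: l A => [|x l IH] A.
  move=> _ _; exists (\det (DG A) / ground_weight).
    rewrite -esum_avoid; congr (\esum_(lam in _) _); apply/seteqP.
    by split=> lam [] // ? ?; split.
  by rewrite !rmorphM /= det_avoid_mx mulrAC.
move=> /= /andP[xl ul] lA.
have xA : x \notin A by apply: lA; rewrite mem_head.
have [a al|r1 E1 D1] := IH A ul; first by apply: lA; rewrite inE al orbT.
have [a al|r2 E2 D2] := IH (x |: A)%SET ul.
  rewrite finset.in_setU1 negb_or; apply/andP; split; last by apply: lA; rewrite inE al orbT.
  by apply: contraNneq xl => <-.
exists (r1 - r2); last by rewrite rmorphB /= D1 D2 (det_mixed_mx xl xA); ring.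
move: E1; rewrite (esumID [set lam | inL lam (t x) (J x)]); last first.
  by move=> lam _; rewrite lee_fin weight_ge0.
have -> : mixed_event l A `&` [set lam | inL lam (t x) (J x)] = mixed_event (x :: l) A.
  apply/seteqP; split=> lam /=.
    by move=> [[cl ll lA'] lx]; split=> // b; rewrite inE => /orP[/eqP ->|/ll].
  move=> [cl ll lA']; split; last by apply: ll; rewrite mem_head.
  by split=> // b bl; apply: ll; rewrite inE bl orbT.
have -> : mixed_event l A `&` ~` [set lam | inL lam (t x) (J x)] = mixed_event l (x |: A)%SET.
  apply/seteqP; split=> lam /=.
    by move=> [[cl ll lA'] lx]; split=> // b; rewrite finset.in_setU1 => /orP[/eqP ->|/lA'].
  move=> [cl ll lA']; split; last by apply: lA'; rewrite finset.setU11.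
  by split=> // b bA; apply: lA'; rewrite finset.in_setU1 bA orbT.
by rewrite E2 => E; rewrite EFinB -E addeK.
Qed.

Lemma configuration_empty : configuration N u v (fun=> [::]).
Proof. by split=> //; split=> // k _; split=> _ j; rewrite !nth_nil. Qed.

Lemma mixed_event_nil : mixed_event [::] finset.set0 = [set l | configuration N u v l].
Proof.
by apply/seteqP; split=> lam /= => [[]//|cl]; split=> // a; rewrite inE.
Qed.

(** The empty configuration alone contributes 1. *)
Lemma partition_function_gt0 : 0 < \det (DG finset.set0) / ground_weight.
Proof.
have [//|//|Z E D] := @esum_mixed_event [::] finset.set0.
rewrite mixed_mx_nil det1 mulr1 in D; have [<-] := D; rewrite -lte_fin -E.
apply: (@lt_le_trans _ _ 1%E); first by rewrite lte_fin.
apply: esum_ge; exists [set (fun=> [::])].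
  split; first exact: finite_set1.
  by rewrite mixed_event_nil => _ ->; exact: configuration_empty.
by rewrite fsbig_set1 lee_fin /weight big1.
Qed.

Lemma Prob_detE : (Prob N u v q [set lam | forall a, inL lam (t a) (J a)])%:C = \det kernel_mx.
Proof.
have [//|//|Z EZ DZ] := @esum_mixed_event [::] finset.set0.
have [|a _|P EP DP] := @esum_mixed_event (enum 'I_n) finset.set0; [exact: enum_uniq|by rewrite inE|].
have mxK : mixed_mx (enum 'I_n) finset.set0 = kernel_mx^T.
  by apply/matrixP => a b; rewrite !mxE mem_enum.
rewrite mixed_mx_nil det1 mulr1 in DZ; rewrite mxK det_tr -DZ in DP.
have Z0 : Z != 0 by have [->] := DZ; rewrite gt_eqF// partition_function_gt0.
rewrite /Prob; have -> : [set l | configuration N u v l] `&` [set lam | forall a, inL lam (t a) (J a)] =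
    mixed_event (enum 'I_n) finset.set0.
  apply/seteqP; split=> lam /=; first by move=> [cl h]; split=> // a; rewrite inE.
  by move=> [cl h _]; split=> // a; apply: h; rewrite mem_enum.
rewrite -mixed_event_nil EZ EP /= rmorphM /= DP.
rewrite -[Z^-1%:C]/(real_complex R _) fmorphV /= mulrAC divff ?mul1r//.
by rewrite eq_complex /= negb_and Z0.
Qed.

(** The gauge factors conjugate the matrix by a diagonal one. *)
Lemma det_kernel_mx : \det kernel_mx = \det (\matrix_(a, b) canon_kernel (t a) (J a) (t b) (J b)).
Proof.
pose g a := (gauge (ptime a))%:C ^+ ppos a.
pose KcM := \matrix_(a, b) canon_kernel (t a) (J a) (t b) (J b).
have g0 a : g a != 0 by rewrite expf_neq0// gaugeC_neq0.
have E : diag_mx (\row_a g a) *m kernel_mx = KcM *m diag_mx (\row_a g a).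
  apply/matrixP => a b; rewrite mul_diag_mx mul_mx_diag !mxE /gauged_kernel -ptimeE -pposE -/(g a) -/(g b).
  by have := g0 a => ga; field.
have D0 : \det (diag_mx (\row_a g a)) != 0.
  by rewrite det_diag; apply/prodf_neq0 => a _; rewrite mxE.
by apply: (mulfI D0); rewrite -det_mulmx E det_mulmx mulrC.
Qed.

End Assembly.

Theorem mainTheorem3 (R : realType) (N : nat) (u v : nat -> int) (q : int -> R)
  (hN : (1 <= N)%N)
  (huv : forall i : nat, (i < N)%N -> u i < v i.+1 < u i.+1)
  (hq : forall t : int, u 0%N < t < u N -> 0 < q t < 1)
  (n : nat) (t J : 'I_n -> int)
  (ht : forall a, u 0%N < t a < u N)
  (hdist : injective (fun a => (t a, J a))) :
  (* such radii always exist *)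
  (forall t1 t2 : int, u 0%N < t1 < u N -> u 0%N < t2 < u N ->
     exists rho1 rho2 : R, admissible_radii N u v q t1 t2 rho1 rho2) /\
  (* the kernel does not depend on the choice of admissible radii *)
  (forall (t1 t2 J1 J2 : int) (rho1 rho2 rho1' rho2' : R),
     u 0%N < t1 < u N -> u 0%N < t2 < u N ->
     admissible_radii N u v q t1 t2 rho1 rho2 ->
     admissible_radii N u v q t1 t2 rho1' rho2' ->
     corr_kernel N u v q rho1 rho2 t1 J1 t2 J2 = corr_kernel N u v q rho1' rho2' t1 J1 t2 J2) /\
  (* determinantal formula *)
  (forall rho1 rho2 : 'I_n -> 'I_n -> R,
     (forall a b, admissible_radii N u v q (t a) (t b) (rho1 a b) (rho2 a b)) ->
     (Prob N u v q [set lam | forall a, inL lam (t a) (J a)])%:C =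
     \det (\matrix_(a, b) corr_kernel N u v q (rho1 a b) (rho2 a b) (t a) (J a) (t b) (J b))).
Proof.
split; first by move=> t1 t2 _ _; exact: exists_admissible hN hq t1 t2.
split; first by move=> t1 t2 J1 J2 r1 r2 r1' r2' _ _; exact: (corr_kernel_radii hN hq).
move=> rho1 rho2 adm; rewrite (Prob_detE hN huv hq ht hdist) (det_kernel_mx hN huv hq _ ht).
by congr (\det _); apply/matrixP => a b; rewrite !mxE (canon_kernelE hN hq _ _ (adm a b)).
Qed.
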